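(* Fix $0<\varepsilon<1/100$, $R>0$, $x\in\mathbb R^2$, and let $D\subset\mathbb R^2$ be a possibly unbounded simply connected domain containing $B(x,3R)$. Let $(\Gamma^{\#\delta})_\delta$ be a sequence of graphs embedded in $\mathbb R^2$ satisfying the uniform crossing assumption stated in the context. Let $\mathcal A$ be a set of loops supported in $D$, and let $\mathcal A(\varepsilon,R)$ denote the set of loops in $\mathcal A$ which have diameter at least $\varepsilon R$ and intersect $B(x,R)$. Let $\tau_D$ be the first time that the random walk $X$ on $\Gamma^{\#\delta}$ leaves $D$, and assume $\tau_D<\infty$ almost surely. Then the following two properties hold for all $\delta$ sufficiently small. (1) For all $p>0$ there exists $\eta=\eta(\varepsilon,p)>0$ such that $$\Big(\exists\, y\in B(x,(1+\varepsilon)R):\ \mathbb P_y\big(\ell(X_{\tau_D})\cap\mathcal A(\varepsilon,R)=\emptyset\big)\ge p\Big)\ \Longrightarrow\ \Lambda_D(\mathcal A(\varepsilon,R))\le 1/\eta .$$ (2) For all $0<\eta<1$ there exists $p=p(\varepsilon,\eta)>0$ such that $$\Big(\forall\, y\in B(x,(1+\varepsilon)R):\ \mathbb P_y\big(\ell(X_{\tau_D})\cap\mathcal A(\varepsilon,R)\neq\emptyset\big)\le p\Big)\ \Longrightarrow\ \Lambda_D(\mathcal A(\varepsilon,R))\le\eta .$$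
   Context: Graphs. Each $\Gamma^{\#\delta}$ is a connected graph properly embedded in $\mathbb R^2$ (edges do not cross), with weights on directed edges (no symmetry assumed) defining a random walk $X$ with one-step transition probabilities $q(v\to v')$; points $y$ in the statement range over vertices of $\Gamma^{\#\delta}$. $B(x,r)$ is the Euclidean ball. Uniform crossing assumption. Let $\mathcal R=[0,3]\times[0,1]$, $B_1=B((1/2,1/2),1/4)$, $B_2=B((5/2,1/2),1/4)$. There exist $\delta_0>0$, $\alpha_0>0$ such that for all $z\in\mathbb C$, $\delta>0$, $l\ge1/\delta_0$, and $v\in l\delta B_1$ with $v+z\in\Gamma^{\#\delta}$: $\mathbb P_{v+z}(X\text{ hits } l\delta B_2+z\text{ before exiting } l\delta\mathcal R+z)>\alpha_0$. The same is assumed with the roles of $B_1,B_2$ exchanged and for the vertical rectangle of the same dimensions. Loop measure. A rooted loop is a finite path $\ell=(v_0,\dots,v_n)$, $n\geq 1$, $v_n=v_0$, with $q(\ell)=\prod_{i<n}q(v_i\to v_{i+1})>0$, and $|\ell|=n$. The loop measure is $\Lambda(\ell)=q(\ell)/|\ell|$; it is invariant under re-rooting, hence also viewed as a measure on unrooted loops. $\Lambda_D(\mathcal A)=\sum_{\ell\in\mathcal A,\ \ell\subset D}\Lambda(\ell)$. Erased loops. $\ell(X_{\tau_D})$ is the random collection of unrooted loops erased when performing the chronological loop-erasure of $X[0,\tau_D]$, after the standard merging and random re-splitting of the erased loops; it is characterised in law by the following: conditionally on the loop-erasure $Y$ of $X[0,\tau_D]$, $\ell(X_{\tau_D})$ is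 a Poisson point process on unrooted loops with intensity $\Lambda$ restricted to loops contained in $D$ that intersect $Y$. *)

(* Defs.v *)
From HB Require Import structures.
From mathcomp Require Import all_boot all_order all_algebra.
From mathcomp Require Import all_classical all_reals all_analysis.

Set Implicit Arguments.
Unset Strict Implicit.
Unset Printing Implicit Defensive.

Import Order.TTheory GRing.Theory Num.Theory.
Import numFieldNormedType.Exports.

Local Open Scope classical_set_scope.
Local Open Scope ring_scope.

(* The canonical norm of [R * R] is the sup norm; its topology is the usual one,
   but Euclidean distances and balls have to be defined explicitly. *)
Notation plane R := (R * R)%type.

Definition edist (R : realType) (a b : plane R) : R :=
  Num.sqrt ((a.1 - b.1) ^+ 2 + (a.2 - b.2) ^+ 2).

Definition eball (R : realType) (x : plane R) (r : R) : set (plane R) :=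
  [set y | edist x y < r].

Definition ediam (R : realType) (S : set (plane R)) : \bar R :=
  ereal_sup [set d | exists a b, S a /\ S b /\ d = (edist a b)%:E].

Definition dilate (R : realType) (c : R) (z : plane R) (S : set (plane R)) :
    set (plane R) :=
  [set c *: v + z | v in S].

Definition simply_connected (R : realType) (D : set (plane R)) : Prop :=
  connected D /\
  forall gamma : R -> plane R,
    {within `[0, 1], continuous gamma} ->
    (forall t, t \in `[0, 1] -> D (gamma t)) ->
    gamma 0 = gamma 1 ->
    exists H : R * R -> plane R,
      {within `[0, 1]%classic `*` `[0, 1]%classic, continuous H} /\
      (forall s t, s \in `[0, 1] -> t \in `[0, 1] -> D (H (s, t))) /\
      (forall t, t \in `[0, 1] -> H (0, t) = gamma t) /\
      (forall t, t \in `[0, 1] -> H (1, t) = gamma 0) /\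
      (forall s, s \in `[0, 1] -> H (s, 0) = gamma 0 /\ H (s, 1) = gamma 0).

Definition sc_domain (R : realType) (D : set (plane R)) : Prop :=
  open D /\ D !=set0 /\ simply_connected D.

(* The edges are the pairs carrying a positive weight in at least one
   direction; both directions run along the same curve. [arc u v] is only
   meaningful when [u] and [v] are joined by an edge. *)
Record planar_graph (R : realType) := PlanarGraph {
  vtx : set (plane R);
  wt : plane R -> plane R -> R;
  arc : plane R -> plane R -> R -> plane R;
  edge := fun u v : plane R => 0 < wt u v \/ 0 < wt v u;
  arc_set := fun u v : plane R => arc u v @` `[0, 1];
  vtx_neq0 : vtx !=set0;
  wt_ge0 : forall u v, 0 <= wt u v;
  edge_vtx : forall u v, edge u v -> vtx u /\ vtx v;
  wt_out : forall u, vtx u -> exists v, 0 < wt u v;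
  arc_ends : forall u v, edge u v -> arc u v 0 = u /\ arc u v 1 = v;
  arc_cont : forall u v, edge u v -> {within `[0, 1], continuous (arc u v)};
  arc_rev : forall u v, edge u v -> arc_set v u = arc_set u v;
  (* injective, except that the curve of a self-edge is closed *)
  arc_simple : forall u v s t, edge u v -> s \in `[0, 1] -> t \in `[0, 1] ->
    s < t -> arc u v s = arc u v t -> s = 0 /\ t = 1;
  arc_vtx : forall u v t, edge u v -> t \in `]0, 1[ -> ~ vtx (arc u v t);
  arc_nocross : forall u v u' v' s t, edge u v -> edge u' v' ->
    s \in `]0, 1[ -> t \in `]0, 1[ -> arc u v s = arc u' v' t ->
    (u = u' /\ v = v') \/ (u = v' /\ v = u');
  graph_connected : forall u v, vtx u -> vtx v ->
    exists p, path (fun a b => `[< edge a b >]) u p /\ last u p = v;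
  (* properness: compact sets meet finitely many vertices and edges *)
  vtx_proper : forall K : set (plane R), compact K -> finite_set (vtx `&` K);
  edge_proper : forall K : set (plane R), compact K ->
    finite_set [set e | edge e.1 e.2 /\ (arc_set e.1 e.2 `&` K) !=set0]
}.

(* The sum has finite support: the graph is locally finite by [edge_proper]. *)
Definition trans_prob (R : realType) (G : planar_graph R) (u v : plane R) : R :=
  wt G u v / \sum_(w \in [set: plane R]) wt G u w.

(* Realisation of the walk: all the laws P_v live on a common sample space. *)
Record random_walk (R : realType) (G : planar_graph R) := RandomWalk {
  rw_disp : measure_display;
  rw_T : measurableType rw_disp;
  rw_P : plane R -> probability rw_T R;
  rw_X : nat -> rw_T -> plane R;
  rw_meas : forall n v, measurable [set w | rw_X n w = v];
  rw_vtx : forall n w, vtx G (rw_X n w);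
  rw_law : forall v n (s : nat -> plane R), vtx G v ->
    rw_P v [set w | forall i, (i <= n)%N -> rw_X i w = s i] =
    ((s 0%N == v)%:R * \prod_(i < n) trans_prob G (s i) (s i.+1))%:E
}.

Arguments rw_X {R G} r n w.

(* The trajectory of a walk includes the edges it traverses: it stays in U up
   to time n if its vertices and the edges joining them are contained in U. *)
Definition stays_in (R : realType) (G : planar_graph R) (U : set (plane R))
    (x : nat -> plane R) (n : nat) : Prop :=
  forall m, (m <= n)%N ->
    U (x m) /\ ((0 < m)%N -> arc_set G (x m.-1) (x m) `<=` U).

Definition leaves_at (R : realType) (G : planar_graph R) (D : set (plane R))
    (x : nat -> plane R) (n : nat) : Prop :=
  ~ stays_in G D x n /\ forall m, (m < n)%N -> stays_in G D x m.

Definition hits_before_exiting (R : realType) (G : planar_graph R)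
    (B U : set (plane R)) (x : nat -> plane R) : Prop :=
  exists n, B (x n) /\ stays_in G U x n.

Section crossing.
Variable R : realType.

Definition hrect : set (plane R) :=
  [set u | 0 <= u.1 <= 3%:R /\ 0 <= u.2 <= 1].
Definition vrect : set (plane R) :=
  [set u | 0 <= u.1 <= 1 /\ 0 <= u.2 <= 3%:R].
Definition hball1 := eball ((2%:R^-1, 2%:R^-1) : plane R) (4%:R^-1).
Definition hball2 := eball ((5%:R / 2%:R, 2%:R^-1) : plane R) (4%:R^-1).
Definition vball2 := eball ((2%:R^-1, 5%:R / 2%:R) : plane R) (4%:R^-1).

Definition crossing (G : R -> planar_graph R)
    (X : forall delta, random_walk (G delta)) (delta0 alpha0 : R)
    (rect start target : set (plane R)) : Prop :=
  forall (z : plane R) (delta l : R) (v : plane R),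
    0 < delta -> delta0^-1 <= l ->
    dilate (l * delta) 0 start v -> vtx (G delta) (v + z) ->
    (alpha0%:E < rw_P (X delta) (v + z)%R
       [set w | hits_before_exiting (G delta)
                  (dilate (l * delta)%R z target) (dilate (l * delta)%R z rect)
                  (fun n => rw_X (X delta) n w)])%E.

Definition uniform_crossing (G : R -> planar_graph R)
    (X : forall delta, random_walk (G delta)) (delta0 alpha0 : R) : Prop :=
  [/\ crossing X delta0 alpha0 hrect hball1 hball2,
      crossing X delta0 alpha0 hrect hball2 hball1,
      crossing X delta0 alpha0 vrect hball1 vball2
    & crossing X delta0 alpha0 vrect vball2 hball1].

End crossing.

Section loops.
Variables (R : realType) (G : planar_graph R).

(* The rooted loop (v_0, ..., v_n) with v_n = v_0 is the sequence
   [:: v_0; ...; v_(n-1)], whose size is its length n. *)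
Definition loop_q (s : seq (plane R)) : R :=
  \prod_(e <- zip s (rot 1 s)) trans_prob G e.1 e.2.

Definition rooted_loop (s : seq (plane R)) : Prop :=
  s <> [::] /\ 0 < loop_q s.

(* An unrooted loop is the set of all the re-rootings of a rooted loop. *)
Definition reroot (s : seq (plane R)) : set (seq (plane R)) :=
  [set t | exists k, t = rot k s].

Definition unrooted_loops : set (set (seq (plane R))) :=
  [set u | exists2 s, rooted_loop s & u = reroot s].

Definition rooted_mass (s : seq (plane R)) : R := loop_q s / (size s)%:R.

(* Image of the measure on rooted loops: when a loop is the k-fold repetition
   of a shorter one, it only has [size s / k] distinct re-rootings. *)
Definition loop_mass (u : set (seq (plane R))) : \bar R :=
  \esum_(s in u) (rooted_mass s)%:E.

Definition trace (u : set (seq (plane R))) : set (plane R) :=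
  [set z | exists s e, [/\ u s, e \in zip s (rot 1 s) & arc_set G e.1 e.2 z]].

Definition loops_in (D : set (plane R)) : set (set (seq (plane R))) :=
  [set u | unrooted_loops u /\ trace u `<=` D].

Definition Lambda (D : set (plane R)) (A : set (set (seq (plane R)))) : \bar R :=
  \esum_(u in A `&` loops_in D) loop_mass u.

Definition visits (g : seq (plane R)) (u : set (seq (plane R))) : Prop :=
  exists s v, [/\ u s, v \in s & v \in g].

Definition big_loops (A : set (set (seq (plane R)))) (x : plane R) (eps r : R) :
    set (set (seq (plane R))) :=
  [set u | [/\ A u, ((eps * r)%:E <= ediam (trace u))%E
             & (trace u `&` eball x r) !=set0]].

End loops.

(* Chronological loop-erasure: when the walk reaches a vertex of the current
   simple path, the loop closed at that moment is erased. *)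
Definition loop_erasure (T : eqType) (s : seq T) : seq T :=
  foldl (fun g v => rcons (take (index v g) g) v) [::] s.

(* [LE_is G D x g] : x leaves D, and g is the part inside D of the
   loop-erasure of x up to that time. The endpoint of the last step is left
   out: it plays the role of a boundary point, which no loop in D visits. *)
Definition LE_is (R : realType) (G : planar_graph R) (D : set (plane R))
    (x : nat -> plane R) (g : seq (plane R)) : Prop :=
  exists n, leaves_at G D x n /\ g = loop_erasure (mkseq x n).

Definition nb_loops (R : realType)
    (N : set (seq (plane R)) -> nat) (B : set (set (seq (plane R)))) : \bar R :=
  \esum_(u in B) ((N u)%:R)%:E.

(* The random multiset of erased loops, given by the multiplicity [el_N w u] of
   each unrooted loop [u]. Conditionally on the loop-erasure being [g], it is a
   Poisson point process with intensity the restriction of the loop measure to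
   the loops in D visiting g. *)
Record erased_loops (R : realType) (G : planar_graph R) (X : random_walk G)
    (D : set (plane R)) := ErasedLoops {
  el_N : rw_T X -> set (seq (plane R)) -> nat;
  el_meas : forall u k, measurable [set w | el_N w u = k];
  el_supp : forall w u, ~ unrooted_loops G u -> el_N w u = 0%N;
  el_law : forall (y : plane R) (g : seq (plane R)) (m : nat)
      (B : 'I_m -> set (set (seq (plane R)))) (k : 'I_m -> nat),
    vtx G y ->
    trivIset setT B ->
    (forall i, (Lambda G D (B i `&` visits g) < +oo)%E) ->
    let Yg := [set w | LE_is G D (fun n => rw_X X n w) g] in
    rw_P X y (Yg `&` [set w | forall i,
                        nb_loops (el_N w) (B i) = ((k i)%:R)%:E]) =
    (rw_P X y Yg *
     \prod_(i < m) poisson_prob (fine (Lambda G D (B i `&` visits g)))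
                     (k i) [set k i])%E
}.

Definition avoids (U : Type) (f : U -> nat) (A : set U) : Prop :=
  forall u, A u -> f u = 0%N.

(* Main.v *)
(* Put u = eps r / 100. The crossing estimates allow to steer the walk along
   axis-parallel segments at scale u, at a multiplicative cost per step. In
   particular the walk turns around a box with probability bounded below, and by
   planarity such a turn meets every path crossing the surrounding annulus. This
   gives Harnack inequalities at scale u, without any regularity of the graph.

   (1) If the walk avoids the loops with probability p, then by the Poisson law
   some possible loop-erasure g has Lambda (A; visits g) <= ln (4 / p). The mass
   of the big loops missing g is bounded for every such g: cut a loop between a
   box z of size u and its distant complement into excursions from the box. The
   mass is at most the trace of the Green function of the chain of returns to the
   box, killed on g. The return probability stays away from 1, since the walk may
   turn around and hit g, which leads to the boundary of D; by the Harnack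
   inequality the trace is then bounded independently of the number of vertices.

   (2) Around a vertex y near a box z, the loop-erasure meets any given path
   crossing an annulus centred at y with probability at least some c > 0.
   A finite set of big loops through z, of mass M, is therefore met with
   probability at least E[1 - exp (- Z)] >= E[Z] / (1 + M) >= c M / (1 + M),
   Z being the mass of the loops met by the loop-erasure. *)

From HB Require Import structures.
Require Import Defs.
From mathcomp Require Import all_boot all_order all_algebra.
From mathcomp Require Import finmap.
From mathcomp Require Import all_classical all_reals all_analysis.
From mathcomp Require Import lra ring.
Import Order.TTheory GRing.Theory Num.Theory.
Import numFieldNormedType.Exports.
Set Implicit Arguments.
Unset Strict Implicit.
Unset Printing Implicit Defensive.
Local Open Scope classical_set_scope.
Local Open Scope ring_scope.

(** The Markov property at random times is replaced by superharmonic functions. Hitting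
    probabilities are the recursions [val] and their suprema [vinf], and a strategy of the walk is a
    lower bound for any nonnegative function H of the trajectory that is superharmonic until the
    walk leaves a region: if H >= c after every trajectory that follows a segment, then H >= c * al
    ^+ N before it. Strategies compose by nesting these bounds. As H sees the whole past, it can
    record that a path has been met, or what the loop-erasure has become. The laws [rw_P] are
    compared with the recursions separately. A priori an edge may be long. Its arc would then cross
    two disjoint annuli around one of its ends, and turns in both would force the other end to lie
    in each of them; at scale u / 136 this keeps every edge within u / 8 of its ends. In (2), a
    piece of the loop-erasure that meets the path may be erased later, and the probability e of
    leaving D without coming back has no uniform lower bound. The loss and the gain of a round are
    therefore both measured in multiples of e, which cancels. *)

(** * Crossing paths in the plane *)

(* Sperner: otherwise every cell would have an even number of boundary edges
   between P and the second colour, contradicting the parity along the boundary. *)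
Lemma grid_three_colours (P Q : nat -> nat -> bool) (m n : nat) :
  (forall j, (j <= n)%N -> ~~ P 0%N j) -> (forall j, (j <= n)%N -> P m j) ->
  (forall i, (i <= m)%N -> P i 0%N || Q i 0%N) ->
  (forall i, (i <= m)%N -> P i n || ~~ Q i n) ->
  exists i j, [/\ (i < m)%N, (j < n)%N &
   exists a b c : bool * bool,
     [/\ P (i + a.1)%N (j + a.2)%N,
         ~~ P (i + b.1)%N (j + b.2)%N && Q (i + b.1)%N (j + b.2)%N
       & ~~ P (i + c.1)%N (j + c.2)%N && ~~ Q (i + c.1)%N (j + c.2)%N]].
Proof.
move=> lft rgt bot top; apply: contrapT => none.
pose E (a b c d : nat) := (P a b && (~~ P c d && Q c d)) ||
                          (P c d && (~~ P a b && Q a b)).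
pose Hs j := \big[addb/false]_(i < m) E i j i.+1 j.
have cell i j : (i < m)%N -> (j < n)%N ->
    E i j i.+1 j (+) E i j.+1 i.+1 j.+1 = E i j i j.+1 (+) E i.+1 j i.+1 j.+1.
  move=> im jn.
  have noc (a b c : bool * bool) : ~ [/\ P (i + a.1)%N (j + a.2)%N,
         ~~ P (i + b.1)%N (j + b.2)%N && Q (i + b.1)%N (j + b.2)%N
       & ~~ P (i + c.1)%N (j + c.2)%N && ~~ Q (i + c.1)%N (j + c.2)%N].
    by move=> h; apply: none; exists i, j; split => //; exists a, b, c.
  pose c1 := (false, false); pose c2 := (true, false).
  pose c3 := (false, true); pose c4 := (true, true).
  (* In boolean form, the absence of three colours lets the parity of a cell be decided by running
     through the eight values of P and Q at its corners. *)
  have noc' (a b c : bool * bool) :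
      [&& P (i + a.1)%N (j + a.2)%N,
          ~~ P (i + b.1)%N (j + b.2)%N, Q (i + b.1)%N (j + b.2)%N,
          ~~ P (i + c.1)%N (j + c.2)%N & ~~ Q (i + c.1)%N (j + c.2)%N] = false.
    apply/negP => /and5P[h1 h2 h3 h4 h5]; apply: (noc a b c).
    by rewrite h1 h2 h3 h4 h5.
  move: (noc' c1 c2 c3) (noc' c1 c3 c2) (noc' c1 c2 c4) (noc' c1 c4 c2)
    (noc' c1 c3 c4) (noc' c1 c4 c3) (noc' c2 c1 c3) (noc' c2 c3 c1)
    (noc' c2 c1 c4) (noc' c2 c4 c1) (noc' c2 c3 c4) (noc' c2 c4 c3).
  move: (noc' c3 c1 c2) (noc' c3 c2 c1) (noc' c3 c1 c4) (noc' c3 c4 c1)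
    (noc' c3 c2 c4) (noc' c3 c4 c2) (noc' c4 c1 c2) (noc' c4 c2 c1)
    (noc' c4 c1 c3) (noc' c4 c3 c1) (noc' c4 c2 c3) (noc' c4 c3 c2).
  rewrite /c1 /c2 /c3 /c4 /E /= !addn0 !addn1.
  by case: (P i j); case: (P i.+1 j); case: (P i j.+1); case: (P i.+1 j.+1);
     case: (Q i j); case: (Q i.+1 j); case: (Q i j.+1); case: (Q i.+1 j.+1).
have telesc (F : nat -> bool) k :
    \big[addb/false]_(i < k) (F i (+) F i.+1) = F 0%N (+) F k.
  elim: k => [|k IH]; first by rewrite big_ord0 addbb.
  by rewrite big_ord_recr /= IH -addbA (addbA (F k)) addbb.
have HsS j : (j < n)%N -> Hs j = Hs j.+1.
  move=> jn.
  have : Hs j (+) Hs j.+1 = E 0%N j 0%N j.+1 (+) E m j m j.+1.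
    rewrite -(telesc (fun i => E i j i j.+1)) /Hs -big_split /=.
    by apply: eq_bigr => i _; apply: cell.
  have -> : E 0%N j 0%N j.+1 = false.
    by rewrite /E (negbTE (lft j (ltnW jn))) (negbTE (lft j.+1 jn)).
  have -> : E m j m j.+1 = false by rewrite /E !rgt ?(ltnW jn).
  by case: (Hs j); case: (Hs j.+1).
have Hsc j : (j <= n)%N -> Hs 0%N = Hs j.
  by elim: j => // j IH jn; rewrite IH ?(ltnW jn) // HsS.
have h0 : Hs 0%N.
  have -> : Hs 0%N = \big[addb/false]_(i < m) (P i 0%N (+) P i.+1 0%N).
    apply: eq_bigr => i _; have := bot i (ltnW (ltn_ord i)).
    have := bot i.+1 (ltn_ord i); rewrite /E.
    by case: (P i 0%N); case: (P i.+1 0%N); case: (Q i 0%N); case: (Q i.+1 0%N).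
  by rewrite (telesc (fun i => P i 0%N)) (negbTE (lft 0%N _)) // (rgt 0%N).
have hn : Hs n = false.
  rewrite /Hs big1 // => i _; have := top i (ltnW (ltn_ord i)).
  have := top i.+1 (ltn_ord i); rewrite /E.
  by case: (P i n); case: (P i.+1 n); case: (Q i n); case: (Q i.+1 n).
by move: h0; rewrite (Hsc n) // hn.
Qed.

Section Topology.
Variable R : realType.
Implicit Types (a b c w : plane R) (A K W : set (plane R)).

Definition near_pts (e : R) : rel (plane R) :=
  fun a b => (`|a.1 - b.1| < e) && (`|a.2 - b.2| < e).

(** Colour the pair (i, j) by the signs of the two coordinate differences between the i-th point of
    f and the j-th point of g. A cell with all three colours contains a sign change of each
    difference, and a difference moves by less than 2 e across a cell. X and Y stay abstract in
    order to serve the four orientations of a side at once. *)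
Lemma chains_cross (X Y : plane R -> R) (f g : seq (plane R)) e :
  (forall a b, near_pts e a b -> `|X a - X b| < e /\ `|Y a - Y b| < e) ->
  forall f0 g0, path (near_pts e) f0 f -> path (near_pts e) g0 g ->
  (forall b, b \in g0 :: g -> X f0 < X b < X (last f0 f)) ->
  (forall a, a \in f0 :: f -> Y g0 < Y a < Y (last g0 g)) ->
  exists a b, [/\ a \in f0 :: f, b \in g0 :: g &
     `|X a - X b| <= 2%:R * e /\ `|Y a - Y b| <= 2%:R * e].
Proof.
move=> lip f0 g0 pf pg hX hY.
pose F i := nth f0 (f0 :: f) i; pose H j := nth g0 (g0 :: g) j.
have Fin i : (i <= size f)%N -> F i \in f0 :: f by move=> ?; apply: mem_nth.
have Hin i : (i <= size g)%N -> H i \in g0 :: g by move=> ?; apply: mem_nth.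
have Fs i : (i < size f)%N -> near_pts e (F i) (F i.+1).
  by move=> ?; move/(pathP f0): pf; apply.
have Hs i : (i < size g)%N -> near_pts e (H i) (H i.+1).
  by move=> ?; move/(pathP g0): pg; apply.
have Fl : F (size f) = last f0 f by rewrite /F (last_nth f0).
have Hl : H (size g) = last g0 g by rewrite /H (last_nth g0).
have [||||i [j [im jn [a [b [c [h1 /andP[h2 h3] /andP[h4 h5]]]]]]]] :=
  @grid_three_colours (fun i j => 0 < X (F i) - X (H j))
   (fun i j => 0 <= Y (F i) - Y (H j)) (size f) (size g).
- move=> j jg; rewrite subr_gt0 -leNgt ltW //.
  by have /andP[] := hX (H j) (Hin j jg).
- by move=> j jg; rewrite subr_gt0 Fl; have /andP[] := hX (H j) (Hin j jg).
- move=> i fi; apply/orP; right; rewrite subr_ge0 ltW //.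
  by have /andP[] := hY (F i) (Fin i fi).
- move=> i fi; apply/orP; right; rewrite subr_ge0 -ltNge Hl.
  by have /andP[] := hY (F i) (Fin i fi).
exists (F i), (H j); split; [exact: Fin (ltnW _)|exact: Hin (ltnW _)|].
have e0 : 0 < e by have /andP[h _] := Fs i im; exact: le_lt_trans h.
have fb (u : bool) : `|X (F (i + u)%N) - X (F i)| < e /\ `|Y (F (i + u)%N) - Y (F i)| < e.
  case: u; rewrite ?addn1 ?addn0 ?subrr ?normr0 //.
  by rewrite (distrC (X _)) (distrC (Y _)); apply: lip; exact: Fs.
have gb (u : bool) : `|X (H (j + u)%N) - X (H j)| < e /\ `|Y (H (j + u)%N) - Y (H j)| < e.
  case: u; rewrite ?addn1 ?addn0 ?subrr ?normr0 //.
  by rewrite (distrC (X _)) (distrC (Y _)); apply: lip; exact: Hs.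
have bnd (x x' y y' : R) : `|x - x'| < e -> `|y - y'| < e ->
    `|(x - y) - (x' - y')| < 2%:R * e.
  by rewrite !ltr_norml => /andP[? ?] /andP[? ?]; apply/andP; split; lra.
have dX (u : bool * bool) := bnd _ _ _ _ (fb u.1).1 (gb u.2).1.
have dY (u : bool * bool) := bnd _ _ _ _ (fb u.1).2 (gb u.2).2.
have fin (x y z : R) : 0 <= x -> z <= 0 -> `|x - y| < 2%:R * e ->
    `|z - y| < 2%:R * e -> `|y| <= 2%:R * e.
  rewrite !ltr_norml ler_norml => ? ? /andP[? ?] /andP[? ?].
  by apply/andP; split; lra.
split.
  apply: (fin _ _ _ _ _ (dX a) (dX b)); first exact: ltW.
  by move: h2; rewrite -leNgt.
apply: (fin _ _ _ _ _ (dY b) (dY c)) => //.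
by move: h5; rewrite -ltNge => /ltW.
Qed.

Lemma near_ptsE e a b : near_pts e a b <-> ball a e b.
Proof.
have E (x y : R) : ball x e y = (`|x - y| < e) :> Prop by rewrite -ball_normE.
split=> [/andP[h1 h2]|]; first by split; rewrite E.
by case; rewrite !E => h1 h2; apply/andP.
Qed.

Lemma near_ptsC e a b : near_pts e a b = near_pts e b a.
Proof. by rewrite /near_pts !(distrC a.1, distrC a.2). Qed.

(** The points of A reached by such chains form a set that is open and closed in A. *)
Lemma connected_chain A e a b : 0 < e -> connected A -> A a -> A b ->
  exists2 s, path (near_pts e) a s &
    last a s = b /\ (forall c, c \in a :: s -> A c).
Proof.
move=> e0 cA Aa Ab.
pose B := [set c | A c /\ exists2 s, path (near_pts e) a s &
   last a s = c /\ (forall d, d \in a :: s -> A d)].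
suff BA : B = A by have : B b by [rewrite BA]; case=> _ [s ? ?]; exists s.
have ext c d : B c -> A d -> near_pts e c d -> B d.
  move=> [Ac [s ps [ls sA]]] Ad cd; split => //; exists (rcons s d).
    by rewrite rcons_path ps ls.
  rewrite last_rcons; split => // x; rewrite -rcons_cons mem_rcons inE.
  by case/orP => [/eqP ->//|/sA].
apply: cA.
- by exists a; split => //; exists [::] => //; split => // c; rewrite inE => /eqP ->.
- exists (\bigcup_(c in B) (ball c e)^°).
    by apply: bigcup_open => c _; exact: open_interior.
  apply/seteqP; split => [c Bc|c [Ac [d Bd /interior_subset dc]]].
    split; first by case: Bc.
    by exists c => //; apply: nbhsx_ballx.
  by apply: (ext d) => //; apply/near_ptsE.
- exists (closure B); first exact: closed_closure.
  apply/seteqP; split => [c Bc|c [Ac clc]].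
    by split; [case: Bc|exact: subset_closure].
  have [d [Bd cd]] := clc _ (nbhsx_ballx c e e0).
  by apply: (ext d) => //; rewrite near_ptsC; apply/near_ptsE.
Qed.

Lemma compact_disjoint_dist W K : compact W -> compact K -> W `&` K = set0 ->
  exists2 d, 0 < d & forall w k, W w -> K k -> ~~ near_pts d w k.
Proof.
move=> cW cK WK0.
have [/eqP WK|/set0P WKn0] := boolP (W `*` K == set0).
  exists 1 => // w k Ww Kk.
  by have h : (W `*` K) (w, k) := conj Ww Kk; rewrite WK in h; case: h.
have cf : continuous (fun p : plane R * plane R => `|p.1 - p.2|).
  move=> p; apply: cvg_norm; apply: cvgB; [exact: cvg_fst|exact: cvg_snd].
have [[w0 k0] + mn] := compact_EVT_min WKn0 (compact_setX cW cK)
  (continuous_subspaceT cf).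
rewrite inE => -[/= Ww0 Kk0].
exists `|w0 - k0|.
  rewrite normr_gt0 subr_eq0; apply/eqP => e.
  by have h : (W `&` K) w0 := conj Ww0 (eq_ind_r K Kk0 e); rewrite WK0 in h; case: h.
move=> w k Ww Kk; apply/negP => /andP[h1 h2].
have := mn (w, k); rewrite inE => /(_ (conj Ww Kk)) /=.
by rewrite [X in _ <= X]prod_normE leNgt gt_max h1 h2.
Qed.

End Topology.

Lemma path_last_in (T : eqType) (e : rel T) (P : pred T) (s : seq T) x :
  path e x s -> P x -> exists y t, [/\ P y, all (predC P) t, path e y t,
    last y t = last x s & {subset y :: t <= x :: s}].
Proof.
elim/last_ind: s => [|s z IH] /= ps Px.
  by exists x, [::]; split => // ?; rewrite inE.
have [Pz|nPz] := boolP (P z).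
  exists z, [::]; split => //; first by rewrite last_rcons.
  by move=> u; rewrite inE => /eqP ->; rewrite inE mem_rcons mem_head orbT.
move: ps; rewrite rcons_path => /andP[ps ez].
have [y [t [Py nt pt lt sub]]] := IH ps Px.
exists y, (rcons t z); split => //.
- by rewrite all_rcons /= nPz.
- by rewrite rcons_path pt lt.
- by rewrite !last_rcons.
- move=> u; rewrite -!rcons_cons !mem_rcons !(inE, in_cons) => /orP[->//|].
  by move/sub; rewrite inE => /orP[] ->; rewrite ?orbT.
Qed.

Lemma path_first_in (T : eqType) (e : rel T) (P : pred T) (s : seq T) x :
  path e x s -> ~~ P x -> has P s -> exists t y s2, [/\ s = rcons t y ++ s2,
    P y, all (predC P) (x :: t) & path e x (rcons t y)].
Proof.
elim: s x => [|z s IH] x //= /andP[xz zs] nPx.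
have [Pz _|nPz /= hs] := boolP (P z).
  by exists [::], z, s; split => //=; rewrite ?nPx ?xz.
have [t [y [s2 [-> Py al pt]]]] := IH z zs nPz hs.
by exists (z :: t), y, s2; split => //=; rewrite ?nPx ?xz.
Qed.

(** One orientation per side of a square: the first boolean exchanges the axes, the second reverses
    the axis normal to the side. Then [cx] runs along the side and [cy] points outwards, and each
    statement about a side is proved once. *)
Definition ori := (bool * bool)%type.

Section Orientation.
Variable R : realType.
Implicit Types (a b : R) (c v w : plane R) (K W : set (plane R)) (k : ori).

Definition cx k w : R := if k.1 then w.2 else w.1.
Definition cy k w : R := if k.2 then - cx (~~ k.1, false) w else cx (~~ k.1, false) w.
Definition pt k a b : plane R :=
  if k.1 then (if k.2 then - b else b, a) else (a, if k.2 then - b else b).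

Definition box c a : set (plane R) :=
  [set w | `|w.1 - c.1| < a /\ `|w.2 - c.2| < a].

Lemma box_ori k c a w :
  box c a w <-> `|cx k w - cx k c| < a /\ `|cy k w - cy k c| < a.
Proof.
have E (x y : R) : `|- x - - y| = `|x - y| by rewrite opprK addrC distrC.
by case: k => [[] []]; rewrite /box /cy /cx /= ?E; split => -[? ?]; split.
Qed.

Lemma boxP c a w : box c a w <->
  [/\ c.1 - a < w.1, w.1 < c.1 + a, c.2 - a < w.2 & w.2 < c.2 + a].
Proof.
rewrite /box /= !ltr_norml; split => [[/andP[? ?] /andP[? ?]]|[? ? ? ?]].
  by split; lra.
by split; apply/andP; split; lra.
Qed.

Lemma sub_box c a b : a <= b -> box c a `<=` box c b.
Proof. by move=> ab w [h1 h2]; split; apply: lt_le_trans ab. Qed.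

Lemma box_sub c v a b r : box c r v -> r + a <= b -> box v a `<=` box c b.
Proof. by move=> /boxP[? ? ? ?] ? w /boxP[? ? ? ?]; apply/boxP; split; lra. Qed.

Lemma box_sym c v a : box c a v -> box v a c.
Proof. by rewrite /box /= !(distrC v.1, distrC v.2). Qed.

Lemma not_box c a w : ~ box c a w -> exists k, a <= cy k w - cy k c.
Proof.
move=> nb; apply: contrapT => none; apply: nb.
have nk k : cy k w - cy k c < a by rewrite ltNge; apply/negP => h; apply: none; exists k.
have := nk (false, false); have := nk (false, true).
have := nk (true, false); have := nk (true, true).
by rewrite /cy /cx /= => *; apply/boxP; split; lra.
Qed.

(** W runs lengthwise through the part of the annulus between the boxes of sizes a and b that lies
    along side k, and overshoots both corners. *)
Definition crosses_side k c a b W :=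
  [/\ connected W, compact W, (forall w, W w -> a < cy k w - cy k c < b)
    & exists w0 w1, [/\ W w0, W w1, cx k w0 - cx k c < - b
       & b < cx k w1 - cx k c]].

(* The curve K leaves the box of size b through one of its sides; after its
   last visit below height a it crosses the rectangle along that side. *)
Lemma exists_crossed_side c a b K q0 q1 : 0 <= a -> a < b ->
  connected K -> compact K -> K q0 -> box c b q0 ->
  (forall k, cy k q0 - cy k c <= a) -> K q1 -> ~ box c b q1 ->
  exists k, forall W, crosses_side k c a b W -> W `&` K !=set0.
Proof.
move=> a0 ab cnK cpK Kq0 q0b q0a Kq1 q1b; apply: contrapT => none.
have {none} bad k : exists W, crosses_side k c a b W /\ W `&` K = set0.
  apply: contrapT => h; apply: none; exists k => W cW.
  by apply/set0P/eqP => WK; apply: h; exists W.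
have [W hW] := choice bad.
have {bad} bad k : exists e, [/\ 0 < e,
    (forall w z, W k w -> K z -> ~~ near_pts (3%:R * e) w z) &
    (exists w0 w1, [/\ W k w0, W k w1, cx k w0 - cx k c < - b - e
       & b + e < cx k w1 - cx k c])].
  have [[cnW cpW _ [w0 [w1 [Ww0 Ww1 h0 h1]]]] WK] := hW k.
  have [d d0 hd] := compact_disjoint_dist cpW cpK WK.
  (* Two crossing chains of mesh e come within 2 e of each other, hence the third of the distance d;
     the other two terms keep the ends of W more than e beyond the corners. *)
  pose e := Num.min (d / 3%:R) (Num.min ((- b - (cx k w0 - cx k c)) / 2%:R)
    ((cx k w1 - cx k c - b) / 2%:R)).
  have e1 : e <= d / 3%:R by rewrite ge_min lexx.
  have e2 : e <= (- b - (cx k w0 - cx k c)) / 2%:R.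
    by rewrite !ge_min lexx /= orbT.
  have e3 : e <= (cx k w1 - cx k c - b) / 2%:R.
    by rewrite !ge_min lexx !orbT.
  exists e; split.
  - by rewrite !lt_min; apply/and3P; split; lra.
  - move=> w z Ww Kz; apply: contra (hd w z Ww Kz) => /andP[n1 n2].
    by apply/andP; split; lra.
  - by exists w0, w1; split => //; lra.
have [e he] := choice bad.
(* The side through which K leaves depends on the chain, and the chain on its mesh, so the mesh has
   to suit all four sides beforehand. *)
pose E := Num.min (Num.min (e (false, false)) (e (false, true)))
                  (Num.min (e (true, false)) (e (true, true))).
have Ele k : E <= e k.
  by case: k => [[] []]; rewrite !ge_min lexx ?orbT.
have epos k : 0 < e k by have [] := he k.
have E0 : 0 < E by rewrite !lt_min !epos.
have [s ps [ls sK]] := connected_chain E0 cnK Kq0 Kq1.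
pose out := fun w => ~~ `[< box c b w >].
have hs : has out s.
  apply/hasP; exists q1; last by apply/asboolPn.
  by move: (mem_last q0 s); rewrite ls inE => /orP[/eqP e1|//]; rewrite e1 in q1b.
have nq0 : ~~ out q0 by rewrite negbK; apply/asboolP.
(* The chain is stopped at its first point outside the box, which lies beyond some side k, and
   started again at its last point of height at most a for this k. In between it climbs through the
   strip, and only its end leaves the box, by less than E. *)
have [t [y [s2 [es oy nt pt]]]] := path_first_in ps nq0 hs.
have /not_box[k hy] : ~ box c b y by move/asboolPn: oy.
have Pq0 : cy k q0 - cy k c <= a by [].
have [z [t' [Pz nz pz lz sz]]] :=
  @path_last_in _ _ (fun w => cy k w - cy k c <= a) _ _ pt Pq0.
have [e0 hd [w0 [w1 [Ww0 Ww1 h0 h1]]]] := he k.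
have [[cnW _ strip _] _] := hW k.
have [f pf [lf fW]] := connected_chain E0 cnW Ww0 Ww1.
have lip p q : near_pts E p q ->
    `|cx k p - cx k q| < E /\ `|cy k p - cy k q| < E.
  move=> /andP[]; rewrite /cy /cx; case: (k) => [[] []] /= ? ?; split => //.
    by rewrite opprK addrC distrC.
  by rewrite opprK addrC distrC.
have inb w : w \in z :: t' -> w \in t ++ [:: q0] \/ w = y.
  move=> /sz; rewrite inE mem_rcons inE mem_cat inE => /or3P[->|/eqP ->|->].
  - by left; rewrite orbT.
  - by right.
  - by left.
have ynear : y = q0 \/ exists2 w, box c b w & near_pts E w y.
  right; exists (last q0 t).
    have := nt; rewrite all_predC; have := mem_last q0 t.
    by move=> lt /hasPn /(_ _ lt); rewrite negbK => /asboolP.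
  by move: pt; rewrite rcons_path => /andP[].
have Xrange w : w \in z :: t' -> `|cx k w - cx k c| < b + E.
  move=> /inb[wt|->].
    suff /(box_ori k)[? _] : box c b w by lra.
    have := nt; rewrite all_predC => /hasPn /(_ w); rewrite negbK => h.
    by apply/asboolP/h; rewrite inE; move: wt; rewrite mem_cat inE orbC.
  case: ynear => [->|[w' /(box_ori k)[w'1 _] /lip[w'2 _]]].
    by move/(box_ori k): q0b => [? _]; lra.
  move: w'1 w'2; rewrite !ltr_norml => /andP[? ?] /andP[? ?].
  by apply/andP; split; lra.
have Ek := Ele k.
have [||p [q [pin qin [pq1 pq2]]]] := chains_cross lip pf pz.
- move=> w /Xrange; rewrite lf ltr_norml => /andP[? ?].
  by apply/andP; split; lra.
- move=> w /fW /strip /andP[? ?]; rewrite lz last_rcons.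
  by apply/andP; split; lra.
have Kq : K q.
  apply: sK; rewrite es; move/sz: qin; rewrite !inE mem_cat => /orP[->//|->].
  by rewrite orbT.
apply: (negP (hd p q (fW _ pin) Kq)); rewrite /near_pts.
have : `|cx k p - cx k q| < 3%:R * e k /\ `|cy k p - cy k q| < 3%:R * e k by lra.
rewrite /cy /cx; case: (k) => [[] []] /= [? ?]; apply/andP; split => //.
  by rewrite -normrN opprB addrC -[X in _ + X]opprK.
by rewrite -normrN opprB addrC -[X in _ + X]opprK.
Qed.

End Orientation.

(** * Walks and their traces in a planar graph *)

Section Graph.
Variables (R : realType) (G : planar_graph R).
Implicit Types (a b c d u v w y z : plane R) (U D : set (plane R)) (t : seq (plane R)).

Local Notation q := (trans_prob G).

Lemma wt_edge u v : 0 < wt G u v -> edge G u v. Proof. by left. Qed.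

Lemma edgeC u v : edge G u v -> edge G v u.
Proof. by case; [right|left]. Qed.

Lemma arc_set_l u v : edge G u v -> arc_set G u v u.
Proof.
move=> e; exists 0; first by rewrite /= in_itv /= lexx ler01.
by case: (arc_ends e).
Qed.

Lemma arc_set_r u v : edge G u v -> arc_set G u v v.
Proof.
move=> e; exists 1; first by rewrite /= in_itv /= lexx ler01.
by case: (arc_ends e).
Qed.

Lemma arc_set_connected u v : edge G u v -> connected (arc_set G u v).
Proof.
move=> e; apply: connected_continuous_connected; last exact: arc_cont.
by apply/connected_intervalP; exact: interval_is_interval.
Qed.

Lemma arc_set_compact u v : edge G u v -> compact (arc_set G u v).
Proof.
move=> e; apply: continuous_compact; first exact: arc_cont.
exact: segment_compact.
Qed.

Lemma compact_set1 (x : plane R) : compact [set x].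
Proof.
have -> : [set x] = [set x.1] `*` [set x.2].
  by apply/seteqP; split => [y ->//|[y1 y2] /= [-> ->]]; case: x.
by apply: compact_setX; rewrite -set_itv1; exact: segment_compact.
Qed.

Definition out_nbrs v : set (plane R) := [set w | 0 < wt G v w].

Lemma finite_out_nbrs v : finite_set (out_nbrs v).
Proof.
apply: (sub_finite_set _ (finite_image snd (edge_proper G (compact_set1 (x := v))))).
move=> w vw; exists (v, w) => //; split; first exact: wt_edge.
by exists v; split => //; exact: arc_set_l (wt_edge vw).
Qed.

Definition nb v : seq (plane R) := finmap.enum_fset (fset_set (out_nbrs v)).

Lemma nbP v w : (w \in nb v) = (0 < wt G v w).
Proof.
rewrite -[LHS]/(w \in fset_set (out_nbrs v)) in_fset_set; last exact: finite_out_nbrs.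
by apply/idP/idP; rewrite inE.
Qed.

Lemma nb_uniq v : uniq (nb v). Proof. exact: finmap.fset_uniq. Qed.

Lemma wt_sum v : \sum_(w \in [set: plane R]) wt G v w = \sum_(w <- nb v) wt G v w.
Proof.
rewrite -(@fsbig_widen _ _ _ _ (out_nbrs v)) //.
  by rewrite fsbig_finite //; exact: finite_out_nbrs.
move=> w [_] /=; rewrite /out_nbrs /= => /negP; rewrite -leNgt => h.
by apply/eqP; rewrite eq_le h wt_ge0.
Qed.

Lemma q_ge0 v w : 0 <= q v w.
Proof.
rewrite /trans_prob divr_ge0 ?wt_ge0 // wt_sum sumr_ge0 // => *.
exact: wt_ge0.
Qed.

Lemma q_gt0 v w : (0 < q v w) = (0 < wt G v w).
Proof.
have [h|] := boolP (0 < wt G v w).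
  rewrite /trans_prob divr_gt0 // wt_sum.
  rewrite (bigD1_seq w) ?nb_uniq ?nbP //= ltr_wpDr // sumr_ge0 // => *.
  exact: wt_ge0.
rewrite -leNgt => h; rewrite /trans_prob.
have -> : wt G v w = 0 by apply/eqP; rewrite eq_le h wt_ge0.
by rewrite mul0r ltxx.
Qed.

Lemma q_sum1 v : vtx G v -> \sum_(w <- nb v) q v w = 1.
Proof.
move=> /wt_out[w vw]; rewrite /trans_prob -mulr_suml wt_sum divff // gt_eqF //.
rewrite (bigD1_seq w) ?nb_uniq ?nbP //= ltr_wpDr // sumr_ge0 // => *.
exact: wt_ge0.
Qed.

Lemma q_sum_le1 v : \sum_(w <- nb v) q v w <= 1.
Proof.
have [h|h] := pselect (vtx G v); first by rewrite q_sum1.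
rewrite big1_seq // => w /andP[_]; rewrite nbP => /wt_edge/edge_vtx[].
by move=> /h.
Qed.

Lemma nb_vtx v w : w \in nb v -> vtx G v /\ vtx G w.
Proof. by rewrite nbP => /wt_edge/edge_vtx. Qed.

Definition estep U : rel (plane R) :=
  fun a b => (0 < wt G a b) && `[< arc_set G a b `<=` U >].

Lemma estepP U a b : estep U a b <-> 0 < wt G a b /\ arc_set G a b `<=` U.
Proof. by split => [/andP[? /asboolP]|[? ?]] //; apply/andP; split => //; apply/asboolP. Qed.

Lemma sub_walk U V v t : U `<=` V -> path (estep U) v t -> path (estep V) v t.
Proof.
move=> UV; apply: sub_path => a b /estepP[? h]; apply/estepP; split => //.
exact: subset_trans UV.
Qed.

Lemma walk_vtx U v t w : path (estep U) v t -> vtx G v -> w \in v :: t -> vtx G w.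
Proof.
elim: t v => [|x t IH] v /=; first by rewrite inE => _ ? /eqP ->.
move=> /andP[/estepP[/wt_edge/edge_vtx[_ vx] _] p] vv; rewrite inE.
by case/orP => [/eqP ->//|]; exact: IH.
Qed.

Lemma walk_in U v t w : path (estep U) v t -> w \in t -> U w.
Proof.
elim: t v => [|x t IH] v //= /andP[/estepP[e xU] p]; rewrite inE.
case/orP => [/eqP ->|]; last exact: (IH _ p).
by apply: xU; apply: arc_set_r; exact: wt_edge.
Qed.

Fixpoint wtrace v t : set (plane R) :=
  if t is u :: t' then arc_set G v u `|` wtrace u t' else [set v].

Lemma wtrace_head v t : path (estep setT) v t -> wtrace v t v.
Proof.
case: t => [|u t] //= /andP[/estepP[e _] _]; left.
by apply: arc_set_l; exact: wt_edge.
Qed.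

Lemma wtrace_vtx v t w : path (estep setT) v t -> w \in v :: t -> wtrace v t w.
Proof.
elim: t v => [|x t IH] v /=; first by rewrite inE => _ /eqP ->.
move=> /andP[/estepP[e _] p]; rewrite inE => /orP[/eqP ->|h].
  by left; apply: arc_set_l; exact: wt_edge.
by right; exact: IH.
Qed.

Lemma wtrace_connected v t : path (estep setT) v t -> connected (wtrace v t).
Proof.
elim: t v => [|x t IH] v /=; first by move=> _; exact: connected1.
move=> /andP[/estepP[/wt_edge e _] p]; apply: connectedU; last exact: IH.
  by exists x; split; [exact: arc_set_r|exact: wtrace_head].
exact: arc_set_connected.
Qed.

Lemma wtrace_compact v t : path (estep setT) v t -> compact (wtrace v t).
Proof.
elim: t v => [|x t IH] v /=; first by move=> _; exact: compact_set1.
move=> /andP[/estepP[/wt_edge e _] p]; apply: compactU; last exact: IH.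
exact: arc_set_compact.
Qed.

Lemma wtrace_sub U v t : path (estep U) v t -> U v -> wtrace v t `<=` U.
Proof.
elim: t v => [|x t IH] v /=; first by move=> _ Uv w ->.
move=> /andP[/estepP[/wt_edge e xU] p] Uv w [/xU//|]; apply: IH => //.
by apply: xU; exact: arc_set_r.
Qed.

Lemma wtraceP U v t z : path (estep U) v t -> wtrace v t z ->
  z \in v :: t \/ exists a b, [/\ a \in v :: t, b \in v :: t, estep U a b & arc_set G a b z].
Proof.
elim: t v => [|x t IH] v /=; first by move=> _ ->; left; rewrite mem_head.
move=> /andP[e p] [h|/(IH _ p)[h|[a [b [ha hb ? ?]]]]].
- by right; exists v, x; rewrite !inE !eqxx orbT.
- by left; rewrite inE h orbT.
- by right; exists a, b; split => //; rewrite inE ?ha ?hb orbT.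
Qed.

Lemma itv01P (s : R) : s \in `[0, 1] -> [\/ s = 0, s = 1 | s \in `]0, 1[].
Proof.
rewrite !in_itv /= => /andP[]; rewrite le_eqVlt => /predU1P[<-|s0].
  by constructor 1.
rewrite le_eqVlt => /predU1P[->|s1]; first by constructor 2.
by constructor 3; rewrite s0 s1.
Qed.

Lemma vtx_on_arc a b w : edge G a b -> vtx G w -> arc_set G a b w -> w = a \/ w = b.
Proof.
move=> e vw [s /= s01 sw]; have [a0 a1] := arc_ends e.
case: (itv01P s01) => hs; [left|right|]; first by rewrite -sw hs.
  by rewrite -sw hs.
by have := arc_vtx e hs; rewrite sw.
Qed.

(** A common point is either a vertex, and then an end of both arcs, or interior to both, and then
    the arcs carry the same edge. *)
Lemma arcs_share a b c d z : edge G a b -> edge G c d ->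
  arc_set G a b z -> arc_set G c d z ->
  exists w, (w = a \/ w = b) /\ (w = c \/ w = d).
Proof.
move=> e e' zab zcd; have [va vb] := edge_vtx e; have [vc vd] := edge_vtx e'.
have [vz|nvz] := pselect (vtx G z).
  by exists z; split; apply: vtx_on_arc.
have notend x y (s : R) : edge G x y -> s \in `[0, 1] -> Defs.arc G x y s = z -> s \in `]0, 1[.
  move=> exy s01 sz; have [x0 y1] := arc_ends exy; have [vx vy] := edge_vtx exy.
  by case: (itv01P s01) => // hs; case: nvz; rewrite -sz hs ?x0 ?y1.
case: zab => s s01 sz; case: zcd => r r01 rz.
have := arc_nocross e e' (notend _ _ _ e s01 sz) (notend _ _ _ e' r01 rz).
rewrite sz rz => /(_ erefl)[[<- <-]|[<- <-]]; exists a; split; by [left|right].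
Qed.

(** Turns an intersection of curves into a common vertex, which is all that killing and loop-erasure
    can see. *)
Lemma walks_meet v t y g z : vtx G v -> vtx G y ->
  path (estep setT) v t -> path (estep setT) y g ->
  wtrace v t z -> wtrace y g z -> exists w, w \in v :: t /\ w \in y :: g.
Proof.
move=> vv vy pt pg zt zg.
case: (wtraceP pt zt) => [z1|[a [b [ha hb /estepP[/wt_edge e _] zab]]]];
  case: (wtraceP pg zg) => [z2|[c [d [hc hd /estepP[/wt_edge e' _] zcd]]]].
- by exists z.
- exists z; split => //.
  by case: (vtx_on_arc e' (walk_vtx pt vv z1) zcd) => ->.
- exists z; split => //.
  by case: (vtx_on_arc e (walk_vtx pg vy z2) zab) => ->.
- have [w [h1 h2]] := arcs_share e e' zab zcd; exists w; split.
    by case: h1 => ->.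
  by case: h2 => ->.
Qed.

(** The loop-erasure stops before the edge by which the walk leaves D, and may therefore end far
    from the complement of D. The curve is prolonged along that edge up to a point outside D. *)
Definition exit_trace y g b (s : R) : set (plane R) :=
  wtrace y g `|` (Defs.arc G (last y g) b @` `[0, s]).

Lemma exit_traceP y g b s : path (estep setT) y g -> edge G (last y g) b ->
  s \in `[0, 1] -> [/\ connected (exit_trace y g b s), compact (exit_trace y g b s),
   exit_trace y g b s y & exit_trace y g b s (Defs.arc G (last y g) b s)].
Proof.
move=> pg e; rewrite in_itv /= => /andP[s0 s1].
have sub : `[0, s] `<=` `[(0:R), 1].
  by move=> r /=; rewrite !in_itv /= => /andP[-> h] /=; exact: le_trans s1.
have cont : {within `[0, s], continuous (Defs.arc G (last y g) b)}.
  exact: continuous_subspaceW sub (arc_cont e).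
have m0 : 0 \in `[0, s] by rewrite in_itv /= lexx s0.
have ms : s \in `[0, s] by rewrite in_itv /= lexx s0.
split.
- apply: connectedU; last 1 first.
  + apply: connected_continuous_connected cont.
    by apply/connected_intervalP; exact: interval_is_interval.
  + exists (last y g); split.
      by apply: wtrace_vtx => //; exact: mem_last.
    by exists 0 => //; case: (arc_ends e).
  + exact: wtrace_connected.
- apply: compactU; first exact: wtrace_compact.
  by apply: continuous_compact cont _; exact: segment_compact.
- by left; exact: wtrace_head.
- by right; exists s.
Qed.

(** A walk inside D meets the added piece of arc at most at its initial vertex: an interior common
    point would make the walk use that very edge, which is not contained in D. *)
Lemma walk_meets_exit D v t y g b s z : vtx G v -> D v -> vtx G y ->
  path (estep D) v t -> path (estep setT) y g -> edge G (last y g) b ->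
  s \in `[0, 1] -> ~ D (Defs.arc G (last y g) b s) ->
  wtrace v t z -> exit_trace y g b s z ->
  exists w, w \in v :: t /\ w \in y :: g.
Proof.
move=> vv Dv vy pt pg e s01 nD zt zK.
have pt' := sub_walk (@subsetT _ D) pt.
case: zK => [zg|[r /= r0s rz]]; first exact: (walks_meet vv vy pt' pg zt zg).
have Dz : D z by exact: (wtrace_sub pt Dv).
move: r0s s01; rewrite !in_itv /= => /andP[r0 rs] /andP[s0 s1].
(* The point z lies in D and the point of parameter s does not, so r < s. *)
have r1 : r < 1.
  apply: lt_le_trans s1; rewrite lt_neqAle rs andbT; apply/eqP => ers.
  by apply: nD; rewrite -ers rz.
have [a0 _] := arc_ends e.
move: r0; rewrite le_eqVlt => /predU1P[r0|r0].
  have zl : z = last y g by rewrite -rz -r0 a0.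
  exists z; split; last by rewrite zl mem_last.
  case: (wtraceP pt zt) => [//|[c [d [hc hd /estepP[/wt_edge e' _] zcd]]]].
  have vz : vtx G z by rewrite zl; case: (edge_vtx e).
  by case: (vtx_on_arc e' vz zcd) => ->.
have r01 : r \in `]0, 1[ by rewrite in_itv /= r0 r1.
have nvz : ~ vtx G z by rewrite -rz; exact: arc_vtx.
case: (wtraceP pt zt) => [h|[c [d [hc hd /estepP[/wt_edge e' cdD] [r' r'01 rz']]]]].
  by case: nvz; exact: walk_vtx pt vv h.
have [c0 d1] := arc_ends e'; have [vc vd] := edge_vtx e'.
have r'i : r' \in `]0, 1[.
  by case: (itv01P r'01) => // hs; case: nvz; rewrite -rz' hs ?c0 ?d1.
have s01 : s \in `[0, 1] by rewrite in_itv /= s0 s1.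
have := arc_nocross e e' r01 r'i; rewrite rz rz' => /(_ erefl) ee.
have : arc_set G (last y g) b `<=` D.
  by case: ee => [[-> ->]|[-> ->]]; rewrite // (arc_rev e').
by move=> /(_ (Defs.arc G (last y g) b s)) h; case: nD; apply: h; exists s.
Qed.

End Graph.

(** * Steering the walk *)

Section Chain.
Variables (R : realType) (G : planar_graph R).
Local Notation q := (trans_prob G).
Local Notation nb := (nb G).
Variables (S : Type) (nxt : S -> plane R -> S) (cur : S -> plane R).
Variables (win lose : pred S).

(* The probability that the chain, whose state s lets the walk step from [cur s]
   and is updated by [nxt], reaches [win] before [lose] within n steps. *)
Fixpoint val n s : R :=
  if win s then 1 else if lose s then 0 else
  if n is m.+1 then \sum_(w <- nb (cur s)) q (cur s) w * val m (nxt s w) else 0.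

Lemma val01 n s : 0 <= val n s <= 1.
Proof.
elim: n s => [|n IH] s /=; case: ifP => _; rewrite ?lexx ?ler01 //; case: ifP => _;
  rewrite ?lexx ?ler01 //.
apply/andP; split.
  by apply: sumr_ge0 => w _; apply: mulr_ge0; [exact: q_ge0|case/andP: (IH (nxt s w))].
apply: le_trans (q_sum_le1 G (cur s)); apply: ler_sum => w _.
by apply: ler_piMr; [exact: q_ge0|case/andP: (IH (nxt s w))].
Qed.

Lemma val_ge0 n s : 0 <= val n s. Proof. by case/andP: (val01 n s). Qed.
Lemma val_le1 n s : val n s <= 1. Proof. by case/andP: (val01 n s). Qed.

Lemma valS n s : ~~ win s -> ~~ lose s ->
  val n.+1 s = \sum_(w <- nb (cur s)) q (cur s) w * val n (nxt s w).
Proof. by move=> /= /negbTE -> /negbTE ->. Qed.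

Lemma val_win n s : win s -> val n s = 1. Proof. by case: n => /= [|?] ->. Qed.

Lemma val_lose n s : ~~ win s -> lose s -> val n s = 0.
Proof. by case: n => /= [|?] /negbTE -> ->. Qed.

Lemma val_leS n s : val n s <= val n.+1 s.
Proof.
elim: n s => [|n IH] s.
  rewrite /=; case: ifP => _ //; case: ifP => _ //; apply: sumr_ge0 => w _.
  by apply: mulr_ge0; [exact: q_ge0|have := val_ge0 0 (nxt s w)].
rewrite [X in X <= _]/= [X in _ <= X]/=; case: ifP => _ //; case: ifP => _ //.
by apply: ler_sum => w _; apply: ler_wpM2l; [exact: q_ge0|exact: IH].
Qed.

Lemma val_mono m n s : (m <= n)%N -> val m s <= val n s.
Proof.
move=> /subnK <-; elim: (n - m)%N => // k IH; rewrite addSn.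
exact: le_trans IH (val_leS _ _).
Qed.

Definition vinf s : R := sup (range (fun n => val n s)).

Let has_sup_val s : has_sup (range (fun n => val n s)).
Proof.
split; first by exists (val 0 s), 0%N.
by exists 1 => _ [n _ <-]; exact: val_le1.
Qed.

Lemma val_vinf n s : val n s <= vinf s.
Proof. by apply: ub_le_sup; [case: (has_sup_val s)|exists n]. Qed.

Lemma vinf_le s b : (forall n, val n s <= b) -> vinf s <= b.
Proof. by move=> h; apply: ge_sup; [exists (val 0 s), 0%N|move=> _ [n _ <-]]. Qed.

Lemma vinf_ge0 s : 0 <= vinf s.
Proof. exact: le_trans (val_ge0 0 s) (val_vinf _ _). Qed.

Lemma vinf_le1 s : vinf s <= 1. Proof. by apply: vinf_le => n; exact: val_le1. Qed.

Lemma vinf_win s : win s -> vinf s = 1.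
Proof.
move=> h; apply/eqP; rewrite eq_le vinf_le1 /=.
by rewrite -(val_win 0 h) val_vinf.
Qed.

Lemma vinf_lose s : ~~ win s -> lose s -> vinf s = 0.
Proof.
move=> h h'; apply/eqP; rewrite eq_le vinf_ge0 andbT.
by apply: vinf_le => n; rewrite val_lose.
Qed.

Lemma vinf_approx (I : eqType) (r : seq I) (f : I -> S) e : 0 < e ->
  exists n, forall i, i \in r -> vinf (f i) - e <= val n (f i).
Proof.
move=> e0; elim: r => [|i r [n hn]]; first by exists 0%N.
have [_ [m _ <-] hm] := sup_adherent e0 (has_sup_val (f i)).
exists (maxn m n) => j; rewrite inE => /orP[/eqP ->|/hn h].
  by rewrite (le_trans (ltW hm)) // val_mono // leq_maxl.
by rewrite (le_trans h) // val_mono // leq_maxr.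
Qed.

(** The neighbours are finitely many, so one n approximates all their suprema up to e. *)
Lemma vinf_step s : ~~ win s -> ~~ lose s ->
  vinf s = \sum_(w <- nb (cur s)) q (cur s) w * vinf (nxt s w).
Proof.
move=> ws ls; apply/eqP; rewrite eq_le; apply/andP; split.
  apply: vinf_le => n; apply: le_trans (val_leS n s) _; rewrite valS //.
  by apply: ler_sum => w _; apply: ler_wpM2l; [exact: q_ge0|exact: val_vinf].
apply/ler_addgt0Pr => e e0.
have [n hn] := vinf_approx (nb (cur s)) (nxt s) e0.
apply: (@le_trans _ _ (\sum_(w <- nb (cur s)) q (cur s) w * (val n (nxt s w) + e))).
  rewrite big_seq [X in _ <= X]big_seq; apply: ler_sum => w wn.
  by apply: ler_wpM2l; [exact: q_ge0|rewrite -lerBlDr; exact: hn].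
under eq_bigr do rewrite mulrDr; rewrite big_split /= -valS // lerD ?val_vinf //.
rewrite -mulr_suml; apply: ler_piMl; [exact: ltW|exact: q_sum_le1].
Qed.

(* Some neighbour does at least as well as the average. *)
Lemma val_step_ge n s : ~~ win s -> 0 < val n.+1 s ->
  exists w, [/\ 0 < wt G (cur s) w & val n.+1 s <= val n (nxt s w)].
Proof.
move=> ws; have [ls|ls] := boolP (lose s); first by rewrite val_lose ?ltxx.
rewrite valS // => v0; apply: contrapT => none.
have h w : w \in nb (cur s) -> val n (nxt s w) < \sum_(w <- nb (cur s)) q (cur s) w * val n (nxt s w).
  by move=> wn; rewrite ltNge; apply/negP => ?; apply: none; exists w; split => //; rewrite -nbP.
set m := \sum_(w <- _) _ in v0 h none.
suff : m < m by rewrite ltxx.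
have [w wn w0] : exists2 w, w \in nb (cur s) & 0 < q (cur s) w.
  apply: contrapT => none'; move: v0; rewrite /m big1_seq ?ltxx // => w /andP[_ wn].
  suff -> : q (cur s) w = 0 by rewrite mul0r.
  apply/eqP; rewrite eq_le q_ge0 andbT leNgt; apply/negP => ?.
  by apply: none'; exists w.
apply: (@lt_le_trans _ _ (\sum_(w <- nb (cur s)) q (cur s) w * m)); last first.
  by rewrite -mulr_suml ler_piMl ?q_sum_le1 // ltW.
rewrite {1}/m !(bigD1_seq w) ?nb_uniq //= ltr_leD //.
  by rewrite ltr_pM2l // h.
rewrite big_seq_cond [X in _ <= X]big_seq_cond; apply: ler_sum => x /andP[xn _].
by apply: ler_wpM2l; [exact: q_ge0|exact: ltW (h _ xn)].
Qed.

End Chain.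

Section Steering.
Variables (R : realType) (G : planar_graph R) (u al : R).
Hypotheses (u0 : 0 < u) (al0 : 0 < al).
Local Notation q := (trans_prob G).
Local Notation nb := (nb G).
Implicit Types (p w v : plane R) (U T : set (plane R)) (t : seq (plane R)).

(* The state [None] is reached when the walk leaves U. *)
Definition kstep U (s : option (plane R)) w : option (plane R) :=
  if s is Some v then (if `[< arc_set G v w `<=` U >] then Some w else None) else None.

Definition kcur (s : option (plane R)) : plane R := odflt (0, 0) s.

Definition hit T U n v : R :=
  val G (kstep U) kcur (fun s => if s is Some v then `[< T v >] else false)
    (fun s => s == None) n (Some v).

Definition co (sw : bool) w : R := if sw then w.2 else w.1.
Definition sh (sw : bool) (a : R) : plane R := if sw then (0, a) else (a, 0).

Definition btw (a b c : R) : Prop := (a <= b /\ b <= c) \/ (c <= b /\ b <= a).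

(** When [|A| = u] this is exactly a 3 x 1 rectangle of scale u / 2: an axis of length u with
    margins u / 4 on all sides. *)
Definition tube sw p (A : R) : set (plane R) := [set w |
  exists s, [/\ btw 0 s A, `|co sw w - co sw p - s| <= u / 4%:R
     & `|co (~~ sw) w - co (~~ sw) p| <= u / 4%:R]].

Definition nearb p := eball p (u / 8%:R).

(* A crossing of a 3 x 1 rectangle of scale u/2, whose balls have radius u/8. *)
Definition steerable := forall sw p (A : R) v, `|A| = u -> vtx G v -> nearb p v ->
  exists n, al < hit (nearb (p + sh sw A)) (tube sw p A) n v.

Hypothesis st : steerable.

(* H is a function of the trajectory t, superharmonic for the walk killed when it
   leaves U. *)
Definition superh v0 U (H : seq (plane R) -> R) :=
  (forall t, path (estep G U) v0 t -> 0 <= H t) /\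
  (forall t, path (estep G U) v0 t ->
    \sum_(w <- nb (last v0 t)) q (last v0 t) w *
       (if `[< arc_set G (last v0 t) w `<=` U >] then H (rcons t w) else 0) <= H t).

(** Optional stopping, by induction on the number of steps: c times the probability of reaching the
    target ball inside the tube stays below H. When the walk leaves the tube the left side is 0 and
    H >= 0 suffices. *)
Lemma step_rule v0 U H sw (A : R) p t c : superh v0 U H -> `|A| = u -> 0 <= c ->
  vtx G v0 -> path (estep G U) v0 t -> nearb p (last v0 t) -> tube sw p A `<=` U ->
  (forall t', path (estep G (tube sw p A)) (last v0 t) t' ->
     nearb (p + sh sw A) (last v0 (t ++ t')) -> c <= H (t ++ t')) ->
  c * al <= H t.
Proof.
move=> [H0 HS] Au c0 vv pt np tU hc.
have vl : vtx G (last v0 t) := walk_vtx pt vv (mem_last _ _).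
have [n hn] := st sw Au vl np.
suff gen m t1 : path (estep G (tube sw p A)) (last v0 t) t1 ->
    c * hit (nearb (p + sh sw A)) (tube sw p A) m (last v0 (t ++ t1)) <= H (t ++ t1).
  have := gen n [::] isT; rewrite cats0; apply: le_trans.
  by rewrite ler_wpM2l // ltW.
elim: m t1 => [|m IH] t1 p1.
  rewrite /hit /=; case: asboolP => h; first by rewrite mulr1; exact: hc.
  by rewrite mulr0 H0 // cat_path pt; exact: sub_walk p1.
rewrite /hit /=; case: asboolP => h; first by rewrite mulr1; exact: hc.
have pc : path (estep G U) v0 (t ++ t1) by rewrite cat_path pt; exact: sub_walk p1.
apply: le_trans (HS _ pc); rewrite mulr_sumr big_seq [X in _ <= X]big_seq.
apply: ler_sum => w; rewrite nbP => wn; rewrite mulrCA; apply: ler_wpM2l.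
  exact: q_ge0.
case: (asboolP (arc_set G (last v0 (t ++ t1)) w `<=` tube sw p A)) => aT; last first.
  have -> : val G (kstep (tube sw p A)) kcur (fun s : option (plane R) =>
     match s with Some v => `[< nearb (p + sh sw A) v >] | None => false end)
     (fun s => s == None) m None = 0 by case: (m).
  rewrite mulr0; case: asboolP => // aU; apply: H0.
  by rewrite rcons_path pc; apply/estepP.
rewrite (_ : `[< _ >]); last by apply/asboolP; exact: subset_trans tU.
have := IH (rcons t1 w); rewrite -rcons_cat last_rcons; apply.
by rewrite rcons_path p1; apply/estepP; rewrite -last_cat.
Qed.

Lemma co_sh sw a : co sw (sh sw a) = a. Proof. by case: sw. Qed.
Lemma co_shN sw a : co (~~ sw) (sh sw a) = 0. Proof. by case: sw. Qed.
Lemma coD sw p w : co sw (p + w) = co sw p + co sw w. Proof. by case: sw. Qed.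

Lemma shD sw a b : sh sw (a + b) = sh sw a + sh sw b.
Proof. by case: sw; rewrite /sh; congr pair; rewrite /= ?addr0. Qed.

Lemma btw0D (a b s : R) : 0 <= a * b -> btw 0 s a -> btw 0 s (a + b).
Proof.
move=> ab [[s0 sa]|[sa s0]].
  have [a0|a0] := ltP 0 a.
    by left; split => //; move: ab; rewrite pmulr_rge0 // => ?; lra.
  have -> : s = 0 by lra.
  by case: (leP 0 (a + b)) => h; [left|right]; split => //; lra.
have [a0|a0] := ltP a 0.
  by right; split => //; move: ab; rewrite nmulr_rge0 // => ?; lra.
have -> : s = 0 by lra.
by case: (leP 0 (a + b)) => h; [left|right]; split => //; lra.
Qed.

Lemma btw0_trans (s a b : R) : btw 0 s a -> btw 0 a b -> btw 0 s b.
Proof.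
by move=> [[? ?]|[? ?]] [[? ?]|[? ?]]; [left|right|left|right]; split; lra.
Qed.

Lemma run_rule v0 U H sw (A : R) m : superh v0 U H -> `|A| = u -> vtx G v0 ->
  forall p t c, 0 <= c ->
  path (estep G U) v0 t -> nearb p (last v0 t) -> tube sw p (A *+ m) `<=` U ->
  (forall t', path (estep G (tube sw p (A *+ m))) (last v0 t) t' ->
     nearb (p + sh sw (A *+ m)) (last v0 (t ++ t')) -> c <= H (t ++ t')) ->
  c * al ^+ m <= H t.
Proof.
move=> sH Au vv; elim: m => [|m IH] p t c c0 pt np tU hc.
  rewrite expr0 mulr1 -[t]cats0; apply: hc => //.
  by rewrite cats0 mulr0n (_ : sh sw 0 = 0) ?addr0 //; case: (sw).
have AA : 0 <= A * (A *+ m) by rewrite mulrnAr mulrn_wge0 // -expr2 sqr_ge0.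
have sub1 : tube sw p A `<=` tube sw p (A *+ m.+1).
  by move=> w [s [b h1 h2]]; exists s; split => //; rewrite mulrS; exact: btw0D.
have sub2 : tube sw (p + sh sw A) (A *+ m) `<=` tube sw p (A *+ m.+1).
  move=> w [s [b]]; rewrite !coD co_sh co_shN addr0 => h1 h2.
  exists (s + A); split => //; last first.
    by rewrite (_ : _ - (s + A) = co sw w - (co sw p + A) - s) //; ring.
  rewrite mulrS; have [Ap|/ltW An] := leP 0 A.
    by have := mulrn_wge0 m Ap; case: b => -[? ?] ?; left; split; lra.
  have : A *+ m <= 0 by rewrite mulrn_wle0.
  by case: b => -[? ?] ?; right; split; lra.
rewrite exprSr mulrA; apply: (step_rule sH Au _ vv pt np) => //.
- by apply: mulr_ge0 => //; apply: exprn_ge0; exact: ltW.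
- exact: (subset_trans sub1 tU).
move=> t1 p1 n1; apply: (IH (p + sh sw A)) => //.
- by rewrite cat_path pt; apply: sub_walk p1; exact: (subset_trans sub1 tU).
- exact: (subset_trans sub2 tU).
move=> t2 p2 n2; rewrite -catA; apply: hc.
  rewrite cat_path (sub_walk sub1 p1) /= -last_cat; exact: sub_walk p2.
by rewrite catA mulrS shD addrA.
Qed.

Lemma go_rule v0 U H sw (B : R) N p t c : superh v0 U H -> vtx G v0 -> 0 <= c -> al <= 1 ->
  path (estep G U) v0 t -> nearb p (last v0 t) -> `|B| <= N%:R * u ->
  tube sw p B `<=` U ->
  (forall B' t', btw 0 B' B -> `|B - B'| < u ->
     path (estep G (tube sw p B')) (last v0 t) t' ->
     nearb (p + sh sw B') (last v0 (t ++ t')) -> c <= H (t ++ t')) ->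
  c * al ^+ N <= H t.
Proof.
move=> sH vv c0 al1 pt np BN tU hc.
pose m := Num.truncn (`|B| / u).
have hB0 : 0 <= `|B| / u by rewrite divr_ge0 // ltW.
have /andP[m1 m2] : m%:R <= `|B| / u < m.+1%:R by exact: Num.Theory.truncn_itv.
have mN : (m <= N)%N.
  rewrite -(ler_nat R); apply: le_trans m1 _.
  by rewrite ler_pdivrMr.
rewrite ler_pdivlMr // in m1; rewrite ltr_pdivrMr // -natr1 mulrDl mul1r in m2.
pose A := if 0 <= B then u else - u.
have Au : `|A| = u by rewrite /A; case: ifP => _; rewrite ?normrN gtr0_norm.
have Am : btw 0 (A *+ m) B /\ `|B - A *+ m| < u.
  rewrite /A -mulr_natl; move: m1 m2; have [B0|B0] := leP 0 B.
    rewrite ger0_norm // => m1 m2; split; first by left; split => //; rewrite mulr_ge0 ?(ltW u0).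
    by rewrite ger0_norm; lra.
  rewrite ltr0_norm // => m1 m2; rewrite mulrN; split.
    by right; split; [lra|rewrite oppr_le0 mulr_ge0 ?(ltW u0)].
  by rewrite ler0_norm; lra.
apply: (@le_trans _ _ (c * al ^+ m)).
  by rewrite ler_wpM2l // ler_wiXn2l // ltW.
apply: (run_rule (m := m) sH Au vv c0 pt np).
  move=> w [s [bs h1 h2]]; apply: tU; exists s; split; [|exact: h1|exact: h2].
  by apply: btw0_trans bs _; case: Am.
by move=> t' p' n'; apply: (hc (A *+ m)) => //; case: Am.
Qed.

End Steering.

(** * Segments and turns around a box *)

Section Turn.
Variables (R : realType) (G : planar_graph R) (u al : R).
Hypotheses (u0 : 0 < u) (al0 : 0 < al) (al1 : al <= 1).
Hypothesis st : steerable G u al.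
Implicit Types (c p w v : plane R) (U : set (plane R)) (t : seq (plane R)) (k : ori).

Local Notation nearb := (nearb u).

Lemma edist_lt c v r : Defs.edist c v < r -> `|v.1 - c.1| < r /\ `|v.2 - c.2| < r.
Proof.
have aux (a b : R) : `|a| <= Num.sqrt (a ^+ 2 + b ^+ 2).
  by rewrite -[X in X <= _]sqrtr_sqr ler_wsqrtr // lerDl sqr_ge0.
rewrite /Defs.edist => h; split; apply: le_lt_trans h; rewrite distrC; first exact: aux.
by rewrite [X in Num.sqrt X]addrC; exact: aux.
Qed.

Lemma nearb_ori k p v : nearb p v ->
  `|cx k v - cx k p| < u / 8%:R /\ `|cy k v - cy k p| < u / 8%:R.
Proof. by move=> /edist_lt h; apply/box_ori. Qed.

Definition hseg k p (X : R) : set (plane R) := [set w |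
  (exists s, btw (cx k p) s X /\ `|cx k w - s| <= u / 4%:R) /\
  `|cy k w - cy k p| <= u / 4%:R].

Definition vseg k p (Y : R) : set (plane R) := [set w |
  (exists s, btw (cy k p) s Y /\ `|cy k w - s| <= u / 4%:R) /\
  `|cx k w - cx k p| <= u / 4%:R].

Lemma btw_trans (a b s X : R) : btw a s b -> btw a b X -> btw a s X.
Proof. by move=> [[? ?]|[? ?]] [[? ?]|[? ?]]; [left|right|left|right]; split; lra. Qed.

Lemma btwN (a b s : R) : btw a s b <-> btw (- a) (- s) (- b).
Proof. by split=> -[[? ?]|[? ?]]; [right|left|right|left]; split; lra. Qed.

Lemma cxE k w : cx k w = co k.1 w. Proof. by []. Qed.
Lemma cyE k w : cy k w = if k.2 then - co (~~ k.1) w else co (~~ k.1) w.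
Proof. by []. Qed.

Lemma tube_hseg k p (B : R) : tube u k.1 p B = hseg k p (cx k p + B).
Proof.
have E (a b : R) : `|- a - - b| = `|a - b| by rewrite opprK addrC distrC.
apply/seteqP; split => w.
  move=> [s [b h1 h2]]; split.
    exists (cx k p + s); split; last by rewrite opprD addrA.
    by case: b => [[? ?]|[? ?]]; [left|right]; split; lra.
  by rewrite !cyE; case: k.2; rewrite ?E.
move=> [[s [b h1]] h2]; exists (s - cx k p); split.
- by case: b => [[? ?]|[? ?]]; [left|right]; split; lra.
- by rewrite opprB addrA subrK.
- by move: h2; rewrite !cyE; case: k.2; rewrite ?E.
Qed.

(** What is passed on is the reference point p', not the vertex, which is only known within u / 8 of
    it: errors do not accumulate along a sequence of segments. *)
Lemma goX v0 U H N k p (X : R) t (m : R) : superh G v0 U H -> vtx G v0 -> 0 <= m ->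
  path (estep G U) v0 t -> nearb p (last v0 t) -> `|X - cx k p| <= N%:R * u ->
  hseg k p X `<=` U ->
  (forall p' t', cy k p' = cy k p -> btw (cx k p) (cx k p') X -> `|X - cx k p'| < u ->
     path (estep G (hseg k p (cx k p'))) (last v0 t) t' ->
     path (estep G U) v0 (t ++ t') ->
     nearb p' (last v0 (t ++ t')) -> m <= H (t ++ t')) ->
  m * al ^+ N <= H t.
Proof.
move=> sH vv c0 pt np XN hU hc.
have XE : X = cx k p + (X - cx k p) by rewrite addrC subrK.
apply: (go_rule u0 al0 st sH vv c0 al1 pt np XN (sw := k.1)).
  by rewrite tube_hseg -XE.
move=> B t' bB XB p' n'; have e1 : cx k (p + sh k.1 B) = cx k p + B.
  by rewrite !cxE coD co_sh.
have bt : btw (cx k p) (cx k (p + sh k.1 B)) X.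
  by rewrite e1; case: bB => [[? ?]|[? ?]]; [left|right]; split; lra.
rewrite tube_hseg -e1 in p'.
apply: (hc (p + sh k.1 B)) => //.
- by rewrite !cyE coD co_shN addr0.
- by rewrite e1 (_ : X - _ = X - cx k p - B) //; ring.
rewrite cat_path pt; apply: sub_walk p' => w [[s [bs h1]] h2]; apply: hU; split => //.
exists s; split => //.
exact: btw_trans bs bt.
Qed.

Lemma goY v0 U H N k p (Y : R) t (m : R) : superh G v0 U H -> vtx G v0 -> 0 <= m ->
  path (estep G U) v0 t -> nearb p (last v0 t) -> `|Y - cy k p| <= N%:R * u ->
  vseg k p Y `<=` U ->
  (forall p' t', cx k p' = cx k p -> btw (cy k p) (cy k p') Y -> `|Y - cy k p'| < u ->
     path (estep G (vseg k p (cy k p'))) (last v0 t) t' ->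
     path (estep G U) v0 (t ++ t') ->
     nearb p' (last v0 (t ++ t')) -> m <= H (t ++ t')) ->
  m * al ^+ N <= H t.
Proof.
move=> sH vv c0 pt np YN vU hc.
(* After exchanging the axes, and up to a sign, a vertical segment for k is a horizontal one for
   k'. *)
pose k' : ori := (~~ k.1, false).
have ey w : cy k w = if k.2 then - cx k' w else cx k' w by [].
have ex w : cy k' w = cx k w by rewrite /cy /cx /= negbK.
have E (a b : R) : `|- a - - b| = `|a - b| by rewrite opprK addrC distrC.
have hv w Y' : vseg k p Y' w <-> hseg k' p (if k.2 then - Y' else Y') w.
  rewrite /vseg /hseg /= !ex !ey; case: k.2 => //; split=> -[[s [b h1]] h2]; split => //.
    exists (- s); split; last by rewrite -E opprK.
    by apply/btwN; rewrite !opprK.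
  exists (- s); split; last by rewrite -E !opprK.
  by move/btwN: b; rewrite opprK.
apply: (goX (k := k') (X := if k.2 then - Y else Y) sH vv c0 pt np).
- by move: YN; rewrite ey; case: k.2 => //; rewrite -E opprK.
- by move=> w /hv; exact: vU.
move=> p' t'; rewrite !ex => e1 b1 d1 w1 w2 n1; apply: (hc p') => //.
- by move: b1; rewrite !ey; case: k.2 => // /btwN; rewrite opprK.
- by move: d1; rewrite ey; case: k.2 => //; rewrite -E opprK.
- apply: sub_walk w1 => w hw; apply/hv; move: hw; rewrite ey.
  by case: k.2; rewrite ?opprK.
Qed.

Definition ring c a b : set (plane R) := [set w | ~ box c a w /\ box c b w].

Lemma hseg_ring k c p X h : h - u <= `|cy k p - cy k c| <= h + 4%:R * u ->
  `|cx k p - cx k c| <= h + 4%:R * u -> `|X - cx k c| <= h + 4%:R * u ->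
  hseg k p X `<=` ring c (h - 2%:R * u) (h + 5%:R * u).
Proof.
move=> /andP[h1 h2] h3 h4 w [[s [b b1]] b2].
have h5 : `|s - cx k c| <= h + 4%:R * u.
  move: h3 h4; rewrite !ler_norml => /andP[? ?] /andP[? ?].
  by case: b => -[? ?]; apply/andP; split; lra.
have t1 := ler_distD (cy k w) (cy k p) (cy k c).
have t2 := ler_distD (cy k p) (cy k w) (cy k c).
have t3 := ler_distD s (cx k w) (cx k c).
rewrite (distrC (cy k p) (cy k w)) in t1; have := u0 => ?; split.
  by move=> /(box_ori k)[_ ?]; lra.
by apply/(box_ori k); split; lra.
Qed.

Lemma vseg_ring k c p Y h : h - u <= `|cx k p - cx k c| <= h + 4%:R * u ->
  `|cy k p - cy k c| <= h + 4%:R * u -> `|Y - cy k c| <= h + 4%:R * u ->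
  vseg k p Y `<=` ring c (h - 2%:R * u) (h + 5%:R * u).
Proof.
move=> /andP[h1 h2] h3 h4 w [[s [b b1]] b2].
have h5 : `|s - cy k c| <= h + 4%:R * u.
  move: h3 h4; rewrite !ler_norml => /andP[? ?] /andP[? ?].
  by case: b => -[? ?]; apply/andP; split; lra.
have t1 := ler_distD (cx k w) (cx k p) (cx k c).
have t2 := ler_distD (cx k p) (cx k w) (cx k c).
have t3 := ler_distD s (cy k w) (cy k c).
rewrite (distrC (cx k p) (cx k w)) in t1; have := u0 => ?; split.
  by move=> /(box_ori k)[? _]; lra.
by apply/(box_ori k); split; lra.
Qed.

(** A segment inside one column of the annulus: the sign condition places p and X on the same side
    of c, so the segment does not cross the inner box. *)
Lemma hseg_ringx k c p X h : h - u <= `|cx k p - cx k c| <= h + 4%:R * u ->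
  `|cy k p - cy k c| <= h + 4%:R * u ->
  h - u <= `|X - cx k c| <= h + 4%:R * u -> 0 <= (cx k p - cx k c) * (X - cx k c) ->
  u < h ->
  hseg k p X `<=` ring c (h - 2%:R * u) (h + 5%:R * u).
Proof.
move=> /andP[h1 h2] h3 /andP[h4 h4'] sg uh w [[s [b b1]] b2].
have h5 : h - u <= `|s - cx k c| <= h + 4%:R * u.
  have hs : (0 <= cx k p - cx k c /\ 0 <= X - cx k c) \/ (cx k p - cx k c <= 0 /\ X - cx k c <= 0).
    have [x0|x0] := ltP 0 (cx k p - cx k c).
      by left; move: sg; rewrite pmulr_rge0 // => ?; split => //; exact: ltW.
    move: x0; rewrite le_eqVlt => /predU1P[e|x0].
      by move: h1; rewrite e normr0; have := u0 => *; lra.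
    by right; move: sg; rewrite nmulr_rge0 // => ?; split => //; exact: ltW.
  case: hs => -[s1 s2].
    move: h1 h2 h4 h4'; rewrite !(ger0_norm s1) !(ger0_norm s2) => *.
    by rewrite ger0_norm; case: b => -[? ?]; try (apply/andP; split); lra.
  move: h1 h2 h4 h4'; rewrite !(ler0_norm s1) !(ler0_norm s2) => *.
  by rewrite ler0_norm; case: b => -[? ?]; try (apply/andP; split); lra.
case/andP: h5 => h5 h6.
have t1 := ler_distD (cx k w) s (cx k c).
have t2 := ler_distD s (cx k w) (cx k c).
have t3 := ler_distD (cy k p) (cy k w) (cy k c).
rewrite (distrC s (cx k w)) in t1; have := u0 => ?; split.
  by move=> /(box_ori k)[? _]; lra.
by apply/(box_ori k); split; lra.
Qed.

(** Only the vertices of the ambient trajectory are retained in vs, so the property persists when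
    the trajectory is extended. *)
Definition side_walk V k c a b (vs : seq (plane R)) := exists v t,
  [/\ {subset v :: t <= vs}, vtx G v, V v, path (estep G V) v t
    & crosses_side k c a b (wtrace G v t)].

Lemma side_walk_sub V k c a b vs vs' : {subset vs <= vs'} ->
  side_walk V k c a b vs -> side_walk V k c a b vs'.
Proof. by move=> s [v [t [h1 h2 h3 h4 h5]]]; exists v, t; split => // x /h1/s. Qed.

Lemma hseg_side V k c a b p X v t : hseg k p X `<=` V -> vtx G v -> path (estep G (hseg k p X)) v t ->
  hseg k p X v ->
  (forall w, hseg k p X w -> a < cy k w - cy k c < b) ->
  (cx k v - cx k c < - b /\ b < cx k (last v t) - cx k c) \/
  (b < cx k v - cx k c /\ cx k (last v t) - cx k c < - b) ->
  side_walk V k c a b (v :: t).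
Proof.
move=> hV vv pt hv strip ends; have pt' := sub_walk (@subsetT _ _) pt.
exists v, t; split => //; [exact: hV|exact: sub_walk pt|split].
- exact: wtrace_connected.
- exact: wtrace_compact.
- by move=> w /(wtrace_sub pt hv); exact: strip.
have h0 := wtrace_vtx pt' (mem_head v t); have h1 := wtrace_vtx pt' (mem_last v t).
by case: ends => -[? ?]; [exists v, (last v t)|exists (last v t), v].
Qed.

Lemma hseg_start k p X v : nearb p v -> hseg k p X v.
Proof.
have := u0; move=> ? /(nearb_ori k)[h1 h2]; split; last by lra.
exists (cx k p); split; last by lra.
by case: (lerP (cx k p) X) => h; [left|right]; split; lra.
Qed.

End Turn.

(** Three segments from the left or right column of the annulus: outwards, up to height h, then
    across side k to the opposite column. The final position satisfies the initial hypotheses for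
    the exchanged axes, which lets sides be chained. *)
Lemma side_rule (R : realType) (G : planar_graph R) (u al : R) (u0 : 0 < u) (al0 : 0 < al)
  (al1 : al <= 1) (st : steerable G u al) (v0 : plane R) (U : set (plane R))
  (H : seq (plane R) -> R) N k (c : plane R) (h : R) (p : plane R) (t : seq (plane R)) (m : R) :
  superh G v0 U H -> vtx G v0 -> 0 <= m ->
  path (estep G U) v0 t -> nearb u p (last v0 t) ->
  3%:R * u < h -> 2%:R * h + 8%:R * u <= N%:R * u ->
  h - u <= `|cx k p - cx k c| <= h + 4%:R * u -> `|cy k p - cy k c| <= h + 4%:R * u ->
  ring c (h - 2%:R * u) (h + 5%:R * u) `<=` U ->
  (forall p' t', h - u <= `|cy k p' - cy k c| <= h + 4%:R * u ->
     `|cx k p' - cx k c| <= h + 4%:R * u ->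
     path (estep G (ring c (h - 2%:R * u) (h + 5%:R * u))) (last v0 t) t' ->
     path (estep G U) v0 (t ++ t') ->
     nearb u p' (last v0 (t ++ t')) ->
     side_walk G (ring c (h - 2%:R * u) (h + 5%:R * u)) k c (h - 2%:R * u) (h + 2%:R * u) (last v0 t :: t') ->
     m <= H (t ++ t')) ->
  m * al ^+ (3 * N) <= H t.
Proof.
move=> sH vv m0 pt np uh hN hx hy rU hm; have := u0 => u0'.
pose e : R := if 0 <= cx k p - cx k c then 1 else -1.
have e1 : e = 1 \/ e = -1 by rewrite /e; case: ifP; [left|right].
have ex : e * (cx k p - cx k c) = `|cx k p - cx k c|.
  rewrite /e; case: (lerP 0 (cx k p - cx k c)) => z; first by rewrite mul1r ger0_norm.
  by rewrite mulN1r ltr0_norm.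
clearbody e.
have nrm x : `|x| = `|e * x| by rewrite normrM; case: e1 => ->; rewrite ?normrN normr1 mul1r.
have ee x : e * (e * x) = x by case: e1 => ->; rewrite ?mul1r // !mulN1r opprK.
pose X1 := cx k c + e * (h + 4%:R * u); pose X3 := cx k c - e * (h + 4%:R * u).
have alN : 0 <= al ^+ N by apply: exprn_ge0; exact: ltW.
have hN0 : 0 <= h + 4%:R * u by lra.
have nX1 : `|X1 - cx k c| = h + 4%:R * u.
  by rewrite nrm /X1 addrC addKr ee ger0_norm.
have nX3 : `|X3 - cx k c| = h + 4%:R * u.
  by rewrite nrm /X3 addrC addKr mulrN ee normrN ger0_norm.
have N1 : `|X1 - cx k p| <= N%:R * u.
  have E : e * (X1 - cx k p) = h + 4%:R * u - `|cx k p - cx k c|.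
    by rewrite -ex /X1; case: e1 => ->; ring.
  by case/andP: hx => z1 z2; rewrite nrm E ger0_norm; clear -z1 z2 hN uh u0'; lra.
have bE (a b d : R) : btw a b d -> btw (e * (a - cx k c)) (e * (b - cx k c)) (e * (d - cx k c)).
  by clear -e1; case: e1 => -> -[[? ?]|[? ?]]; rewrite ?mul1r ?mulN1r; [left|right|right|left]; split; lra.
rewrite (_ : (3 * N = N + (N + N))%N); last by rewrite !mulSn mul0n addn0.
rewrite addnC !exprD !mulrA.
(* Backing off to abscissa h + 4 u makes the traverse begin beyond h + 2 u, in spite of the losses
   of u in [goX] and of u / 8 in [nearb]. Here e is the sign of the column, and X3 is symmetric to
   X1. *)
apply: (goX u0 al0 al1 st (k := k) (X := X1) sH vv _ pt np N1); first by rewrite !mulr_ge0.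
  apply: subset_trans rU; apply: hseg_ringx => //; [rewrite nX1; clear -u0'| |clear -uh u0']; try lra.
  by rewrite /X1 addrAC subrr add0r mulrA [X in X * _]mulrC ex mulr_ge0.
move=> p1 t1 q1 b1 d1 w1 v1 n1.
have [f1 f2] : h + 3%:R * u < e * (cx k p1 - cx k c) /\ e * (cx k p1 - cx k c) <= h + 4%:R * u.
  move: d1 (bE _ _ _ b1); rewrite nrm ex (_ : e * (X1 - _) = h + 4%:R * u - e * (cx k p1 - cx k c)); last first.
    by rewrite /X1; case: e1 => ->; ring.
  rewrite (_ : e * (X1 - _) = h + 4%:R * u); last by rewrite /X1 addrAC subrr add0r ee.
  rewrite ltr_norml => /andP[z1 z2]; case/andP: hx => z3 z4 z5.
  by clear -z1 z2 z3 z4 z5 u0'; case: z5 => -[? ?]; split; lra.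
have nx1 : `|cx k p1 - cx k c| = e * (cx k p1 - cx k c).
  by rewrite nrm ger0_norm; clear -f1 uh u0'; lra.
have s1 : hseg u k p (cx k p1) `<=` ring c (h - 2%:R * u) (h + 5%:R * u).
  apply: hseg_ringx => //; [rewrite nx1; apply/andP; split; clear -f1 f2 u0'| |clear -uh u0']; try lra.
  have -> : (cx k p - cx k c) * (cx k p1 - cx k c) =
     (e * (cx k p - cx k c)) * (e * (cx k p1 - cx k c)).
    by rewrite mulrACA; case: e1 => ->; ring.
  by rewrite ex mulr_ge0 //; clear -f1 uh u0'; lra.
have N2 : `|cy k c + h - cy k p1| <= N%:R * u.
  move: hy; rewrite -q1 !ler_norml => /andP[z1 z2].
  by apply/andP; split; clear -z1 z2 hN uh u0'; lra.
have hh : `|cy k c + h - cy k c| <= h + 4%:R * u.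
  by rewrite addrC addKr ger0_norm; clear -uh u0'; lra.
apply: (goY u0 al0 al1 st (k := k) (Y := cy k c + h) sH vv _ v1 n1 N2); first by rewrite !mulr_ge0.
  by apply: subset_trans rU; apply: vseg_ring; rewrite ?q1 // nx1; apply/andP; split; clear -f1 f2 u0'; lra.
move=> p2 t2 q2 b2 d2 w2 v2 n2.
have [g1 [g2 g3]] : h - u < cy k p2 - cy k c /\ cy k p2 - cy k c < h + u /\ `|cy k p2 - cy k c| <= h + 4%:R * u.
  move: d2; rewrite ltr_norml => /andP[z1 z2].
  by clear -z1 z2 uh u0'; split; [lra|split; [lra|rewrite ger0_norm; lra]].
have s2 : vseg u k p1 (cy k p2) `<=` ring c (h - 2%:R * u) (h + 5%:R * u).
  by apply: vseg_ring; rewrite ?q1 // nx1; apply/andP; split; clear -f1 f2 u0'; lra.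
have g4 : h - u <= `|cy k p2 - cy k c| <= h + 4%:R * u.
  by rewrite ger0_norm; try apply/andP; try split; clear -g1 g2 uh u0'; lra.
have N3 : `|X3 - cx k p2| <= N%:R * u.
  have E : e * (X3 - cx k p2) = - (h + 4%:R * u) - e * (cx k p1 - cx k c).
    by rewrite q2 /X3; case: e1 => ->; ring.
  by rewrite nrm E ler0_norm; clear -f1 f2 hN uh u0'; lra.
apply: (goX u0 al0 al1 st (k := k) (X := X3) sH vv _ v2 n2 N3) => //.
  by apply: subset_trans rU; apply: hseg_ring; rewrite ?nX3 // q2 nx1.
move=> p3 t3 q3 b3 d3 w3 v3 n3.
have [i1 i2] : e * (cx k p3 - cx k c) < - (h + 3%:R * u) /\ - (h + 4%:R * u) <= e * (cx k p3 - cx k c).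
  move: d3 (bE _ _ _ b3); rewrite nrm q2 (_ : e * (X3 - cx k p3) = - (h + 4%:R * u) - e * (cx k p3 - cx k c)); last first.
    by rewrite /X3; case: e1 => ->; ring.
  rewrite (_ : e * (X3 - _) = - (h + 4%:R * u)); last by rewrite /X3 addrAC subrr add0r mulrN ee.
  rewrite ltr_norml => /andP[z1 z2] z5.
  by clear -z1 z2 z5 f1 f2 uh u0'; case: z5 => -[? ?]; split; lra.
have nx3 : `|cx k p3 - cx k c| <= h + 4%:R * u.
  by rewrite nrm ler0_norm; clear -i1 i2 uh u0'; lra.
have s3 : hseg u k p2 (cx k p3) `<=` ring c (h - 2%:R * u) (h + 5%:R * u).
  by apply: hseg_ring => //; rewrite q2 nx1.
rewrite -!catA; apply: (hm p3); rewrite ?q3 ?catA //.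
- by rewrite !cat_path -!last_cat catA (sub_walk s1 w1) (sub_walk s2 w2) (sub_walk s3 w3).
have sd : side_walk G (ring c (h - 2%:R * u) (h + 5%:R * u)) k c (h - 2%:R * u) (h + 2%:R * u) (last v0 ((t ++ t1) ++ t2) :: t3).
  apply: (hseg_side (u := u) (k := k) (p := p2) (X := cx k p3)) => //.
  - by apply: (walk_vtx v2 vv); exact: mem_last.
  - by apply: hseg_start => //.
  - by move=> w [_]; rewrite ler_norml => /andP[z1 z2]; apply/andP; split; clear -z1 z2 g1 g2 u0'; lra.
  have [j1 _] := nearb_ori k n2; have [j2 _] := nearb_ori k n3.
  rewrite last_cat in j2; move: j1 j2 f1 i1; rewrite q2 !ltr_norml => /andP[z1 z2] /andP[z3 z4].
  by clear -z1 z2 z3 z4 u0' e1; case: e1 => ->; rewrite ?mul1r ?mulN1r => ? ?; [right|left]; split; lra.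
apply: side_walk_sub sd => x; rewrite -catA last_cat inE => /orP[/eqP ->|h'].
  have := mem_last (last v0 t) (t1 ++ t2).
  by rewrite !inE !mem_cat => /orP[->//|/orP[]->]; rewrite ?orbT.
by rewrite inE !mem_cat h' !orbT.
Qed.

(** Four sides with three segments each, hence 12 * N. The axes alternate, and [side_rule] starts
    from either column, so this order of the sides works for every initial k. *)
Lemma turn_rule (R : realType) (G : planar_graph R) (u al : R) (u0 : 0 < u) (al0 : 0 < al)
  (al1 : al <= 1) (st : steerable G u al) (v0 : plane R) (U : set (plane R))
  (H : seq (plane R) -> R) N k (c : plane R) (h : R) (p : plane R) (t : seq (plane R)) (m : R) :
  superh G v0 U H -> vtx G v0 -> 0 <= m ->
  path (estep G U) v0 t -> nearb u p (last v0 t) ->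
  3%:R * u < h -> 2%:R * h + 8%:R * u <= N%:R * u ->
  h - u <= `|cx k p - cx k c| <= h + 4%:R * u -> `|cy k p - cy k c| <= h + 4%:R * u ->
  ring c (h - 2%:R * u) (h + 5%:R * u) `<=` U ->
  (forall p' t', `|cy k p' - cy k c| <= h + 4%:R * u ->
     `|cx k p' - cx k c| <= h + 4%:R * u ->
     path (estep G (ring c (h - 2%:R * u) (h + 5%:R * u))) (last v0 t) t' ->
     path (estep G U) v0 (t ++ t') ->
     nearb u p' (last v0 (t ++ t')) ->
     (forall k, side_walk G (ring c (h - 2%:R * u) (h + 5%:R * u)) k c (h - 2%:R * u) (h + 2%:R * u) (last v0 t :: t')) ->
     m <= H (t ++ t')) ->
  m * al ^+ (12 * N) <= H t.
Proof.
move=> sH vv m0 pt np uh hN hx hy rU hm.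
have alN : 0 <= al ^+ (3 * N) by apply: exprn_ge0; exact: ltW.
have swc (k1 k2 : ori) w : k2.1 = ~~ k1.1 ->
    `|cx k2 w - cx k2 c| = `|cy k1 w - cy k1 c| /\ `|cy k2 w - cy k2 c| = `|cx k1 w - cx k1 c|.
  have E (a b : R) : `|- a - - b| = `|a - b| by rewrite opprK addrC distrC.
  by case: k1 k2 => [[] []] [[] []] //= _; rewrite /cy /cx /= ?E.
have -> : al ^+ (12 * N) = al ^+ (3 * N) * al ^+ (3 * N) * al ^+ (3 * N) * al ^+ (3 * N).
  by rewrite -!exprD -!mulnDl.
rewrite !mulrA.
apply: (side_rule u0 al0 al1 st (k := k) (c := c) (N := N) sH vv _ pt np uh hN) => //; first by rewrite !mulr_ge0.
move=> p1 t1 y1 x1 w1 v1 n1 sd1.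
pose k2 : ori := (~~ k.1, true).
have [X1 Y1] := swc k k2 p1 erefl.
rewrite -X1 in y1; rewrite -Y1 in x1.
apply: (side_rule u0 al0 al1 st (k := k2) (c := c) (N := N) sH vv _ v1 n1 uh hN) => //; first by rewrite !mulr_ge0.
move=> p2 t2 y2 x2 w2 v2 n2 sd2.
pose k3 : ori := (k.1, ~~ k.2).
have [|X2 Y2] := swc k2 k3 p2; first by rewrite /= negbK.
rewrite -X2 in y2; rewrite -Y2 in x2.
apply: (side_rule u0 al0 al1 st (k := k3) (c := c) (N := N) sH vv _ v2 n2 uh hN) => //; first by rewrite !mulr_ge0.
move=> p3 t3 y3 x3 w3 v3 n3 sd3.
pose k4 : ori := (~~ k.1, false).
have [X3 Y3] := swc k3 k4 p3 erefl.
rewrite -X3 in y3; rewrite -Y3 in x3.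
apply: (side_rule u0 al0 al1 st (k := k4) (c := c) (N := N) sH vv _ v3 n3 uh hN) => //.
move=> p4 t4 y4 x4 w4 v4 n4 sd4.
have [|X4 Y4] := swc k4 k p4; first by rewrite /= negbK.
rewrite -!catA; rewrite -!catA in v4 n4; apply: (hm p4) => //.
- by rewrite Y4.
- by rewrite X4; case/andP: y4.
- by rewrite !catA !cat_path -!last_cat !catA w1 w2 w3 w4.
have sub (s1 s2 : seq (plane R)) : {subset (last v0 (t ++ s1)) :: s2 <= last v0 t :: s1 ++ s2}.
  move=> x; rewrite last_cat inE => /orP[/eqP ->|h'].
    by have := mem_last (last v0 t) s1; rewrite !inE mem_cat => /orP[->|->//]; rewrite ?orbT.
  by rewrite inE mem_cat h' !orbT.
have subr (s1 s2 : seq (plane R)) : {subset last v0 t :: s1 <= last v0 t :: s1 ++ s2}.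
  by move=> x; rewrite !inE mem_cat => /orP[->//|->]; rewrite orbT.
have S1 := side_walk_sub (@subr t1 (t2 ++ t3 ++ t4)) sd1.
have S2 : side_walk G (ring c (h - 2%:R * u) (h + 5%:R * u)) k2 c (h - 2%:R * u) (h + 2%:R * u) (last v0 t :: t1 ++ t2 ++ t3 ++ t4).
  by rewrite catA; apply: (side_walk_sub (@subr (t1 ++ t2) _)); exact: (side_walk_sub (@sub t1 t2) sd2).
have S3 : side_walk G (ring c (h - 2%:R * u) (h + 5%:R * u)) k3 c (h - 2%:R * u) (h + 2%:R * u) (last v0 t :: t1 ++ t2 ++ t3 ++ t4).
  rewrite (catA t1) catA; apply: (side_walk_sub (@subr ((t1 ++ t2) ++ t3) _)).
  by apply: (side_walk_sub (@sub (t1 ++ t2) t3)); rewrite catA.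
have S4 : side_walk G (ring c (h - 2%:R * u) (h + 5%:R * u)) k4 c (h - 2%:R * u) (h + 2%:R * u) (last v0 t :: t1 ++ t2 ++ t3 ++ t4).
  rewrite (catA t1) catA; apply: (side_walk_sub (@sub ((t1 ++ t2) ++ t3) t4)).
  by rewrite !catA.
have fin (P : ori -> Prop) (a : ori) : P a -> P (~~ a.1, true) -> P (a.1, ~~ a.2) ->
    P (~~ a.1, false) -> forall b, P b.
  by case: a => [[] []] ? ? ? ? [[] []].
exact: (fin (fun k => side_walk G (ring c (h - 2%:R * u) (h + 5%:R * u)) k c _ _ _) k S1 S2 S3 S4).
Qed.

(** * A turn meets every path across the annulus *)

Section Crossing.
Variables (R : realType) (G : planar_graph R).
Implicit Types (a b : R) (c v w y z : plane R) (V D : set (plane R)) (g t vs : seq (plane R)).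

Lemma cy_le_box c y a b : a < b -> (forall k, cy k y - cy k c <= a) -> box c b y.
Proof.
move=> ab h; apply/boxP.
have := h (false, false); have := h (false, true).
have := h (true, false); have := h (true, true).
by rewrite /cy /cx /= => h1 h2 h3 h4; clear -h1 h2 h3 h4 ab; split; lra.
Qed.

Lemma box_cy_le c y a k : box c a y -> cy k y - cy k c <= a.
Proof. by move=> /(box_ori k)[_]; rewrite ltr_norml => /andP[_ /ltW]. Qed.

(** The side k is determined by the path alone, before the walk V: a complete turn crosses every
    side, but a walk steered along this single side already meets the path. *)
Lemma crossed_by_walk a b c y0 z y g : 0 <= a -> a < b -> vtx G y ->
  path (estep G setT) y g -> wtrace G y g y0 -> (forall k, cy k y0 - cy k c <= a) ->
  wtrace G y g z -> ~ box c b z ->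
  exists k, forall V vs, side_walk G V k c a b vs ->
    exists w, [/\ w \in vs, V w & w \in y :: g].
Proof.
move=> a0 ab vy pg hy0 ya hz zb.
have [k hk] := exists_crossed_side a0 ab (wtrace_connected pg) (wtrace_compact pg)
  hy0 (cy_le_box ab ya) ya hz zb.
exists k => V vs [v [t [sub vv Vv pt cs]]].
have [x [xt xg]] := hk _ cs.
have [w [wt wg]] := walks_meet vv vy (sub_walk (@subsetT _ V) pt) pg xt xg.
exists w; split => //; first exact: sub.
by move: wt; rewrite inE => /orP[/eqP ->//|]; exact: walk_in pt.
Qed.

(** The path reaches the outside of the box only through its prolongation out of D, hence the walks
    are restricted to D. *)
Lemma crossed_by_exit a b c y0 y g x : 0 <= a -> a < b -> vtx G y -> forall D,
  path (estep G setT) y g -> wtrace G y g y0 -> (forall k, cy k y0 - cy k c <= a) ->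
  edge G (last y g) x -> ~ arc_set G (last y g) x `<=` D -> box c b `<=` D ->
  exists k, forall V vs, V `<=` D -> side_walk G V k c a b vs ->
    exists w, [/\ w \in vs, V w & w \in y :: g].
Proof.
move=> a0 ab vy D pg hy0 ya e nD bD.
have [s s01 Ds] : exists2 s, s \in `[0, 1] & ~ D (Defs.arc G (last y g) x s).
  apply: contrapT => none; apply: nD => _ [s /= s01 <-].
  by apply: contrapT => h; apply: none; exists s.
have [K1 K2 K3 K4] := exit_traceP pg e s01.
have K5 : exit_trace G y g x s y0 by left.
have [k hk] := exists_crossed_side a0 ab K1 K2 K5 (cy_le_box ab ya) ya K4
  (fun h => Ds (bD _ h)).
exists k => V vs VD [v [t [sub vv Vv pt cs]]].
have [z [zt zg]] := hk _ cs.
have [w [wt wg]] := walk_meets_exit vv (VD _ Vv) vy (sub_walk VD pt) pg e s01 Ds zt zg.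
exists w; split => //; first exact: sub.
by move: wt; rewrite inE => /orP[/eqP ->//|]; exact: walk_in pt.
Qed.

Definition turned u c h vs := forall k,
  side_walk G (ring c (h - 2%:R * u) (h + 5%:R * u)) k c (h - 2%:R * u) (h + 2%:R * u) vs.

End Crossing.

Section Turns.
Variables (R : realType) (G : planar_graph R) (u al : R).
Hypotheses (u0 : 0 < u) (al0 : 0 < al) (al1 : al <= 1).
Hypothesis st : steerable G u al.
Implicit Types (c p w v : plane R) (U : set (plane R)) (t : seq (plane R)) (k : ori).

Lemma nearb_refl p : nearb u p p.
Proof. by rewrite /nearb /eball /= /Defs.edist !subrr expr0n /= addr0 sqrtr0 divr_gt0. Qed.

Lemma superh0 v0 U : superh G v0 U (fun=> 0).
Proof. by split => // t _; rewrite big1 // => w _; case: ifP; rewrite mulr0. Qed.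

Lemma hseg_box k c p X a : `|cx k p - cx k c| + u / 4%:R < a ->
  `|X - cx k c| + u / 4%:R < a -> `|cy k p - cy k c| + u / 4%:R < a ->
  hseg u k p X `<=` box c a.
Proof.
move=> h1 h2 h3 w [[s [b b1]] b2]; apply/(box_ori k).
have t1 := ler_distD (cy k p) (cy k w) (cy k c).
have t2 := ler_distD s (cx k w) (cx k c).
have h4 : `|s - cx k c| + u / 4%:R < a.
  move: h1 h2; rewrite -!ltrBrDr !ltr_norml => /andP[z1 z2] /andP[z3 z4].
  by case: b => -[? ?]; apply/andP; split; lra.
by split; lra.
Qed.

Lemma turn_center v0 U H N h (m : R) : superh G v0 U H -> vtx G v0 -> 0 <= m ->
  3%:R * u < h -> 2%:R * h + 8%:R * u <= N%:R * u -> box v0 (h + 5%:R * u) `<=` U ->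
  (forall t, path (estep G U) v0 t -> path (estep G (box v0 (h + 5%:R * u))) v0 t ->
     turned G u v0 h (v0 :: t) -> m <= H t) ->
  m * al ^+ (13 * N) <= H [::].
Proof.
move=> sH vv m0 uh hN bU hm; have := u0 => u0'.
pose k : ori := (false, false).
have N1 : `|cx k v0 + h - cx k v0| <= N%:R * u.
  by rewrite addrAC subrr add0r ger0_norm; lra.
have alN : 0 <= al ^+ (12 * N) by apply: exprn_ge0; exact: ltW.
rewrite mulSn addnC exprD mulrA.
have hb X : `|X - cx k v0| <= h -> hseg u k v0 X `<=` box v0 (h + 5%:R * u).
  by move=> hX; apply: hseg_box; rewrite ?subrr ?normr0; lra.
apply: (goX u0 al0 al1 st (k := k) (X := cx k v0 + h) (t := [::]) (p := v0) (v0 := v0) (U := U) sH vv _ isT (nearb_refl v0) N1).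
- by rewrite mulr_ge0.
- by apply: subset_trans bU; apply: hb; rewrite addrAC subrr add0r ger0_norm //; lra.
move=> p1 t1 /= y1 b1 d1 w1 v1 n1.
have [f1 f2] : h - u <= `|cx k p1 - cx k v0| /\ `|cx k p1 - cx k v0| <= h.
  by case: b1 => -[z1 z2]; move: d1; rewrite ltr_norml => /andP[z3 z4];
    rewrite ger0_norm; try split; lra.
have rb : ring v0 (h - 2%:R * u) (h + 5%:R * u) `<=` box v0 (h + 5%:R * u) by move=> ? [].
apply: (turn_rule u0 al0 al1 st (k := k) (c := v0) (h := h) sH vv m0 v1 n1 uh hN).
- by apply/andP; split; lra.
- by rewrite y1 subrr normr0; lra.
- exact: subset_trans bU.
move=> p2 t2 x2 y2 w2 v2 n2 sd; apply: hm => //.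
  rewrite cat_path; apply/andP; split; last exact: sub_walk w2.
  by apply: sub_walk w1; exact: hb.
move=> k'; apply: side_walk_sub (sd k') => x.
rewrite !inE mem_cat => /orP[/eqP ->|->]; last by rewrite !orbT.
by have := mem_last v0 t1; rewrite inE => /orP[->//|->]; rewrite orbT.
Qed.

(** Positive probability gives existence: for H = 0, the absence of turns would make the last
    hypothesis of [turn_center] vacuous with m = 1, and bound a positive power of al by 0. *)
Lemma exists_turn v0 h : vtx G v0 -> 3%:R * u < h -> exists vs, turned G u v0 h vs.
Proof.
move=> vv uh; apply: contrapT => none.
have [N hN] : exists N, 2%:R * h + 8%:R * u <= N%:R * u.
  exists (Num.truncn ((2%:R * h + 8%:R * u) / u)).+1.
  rewrite -ler_pdivrMr // ltW //; exact: truncnS_gt.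
have := @turn_center v0 setT (fun=> 0) N h 1 (superh0 _ _) vv ler01 uh hN (@subsetT _ _).
have : 0 < 1 * al ^+ (13 * N) by rewrite mul1r exprn_gt0.
move=> z1 z2; have : 1 * al ^+ (13 * N) <= 0.
  by apply: z2 => t _ _ hs; case: none; exists (v0 :: t).
by rewrite leNgt z1.
Qed.

(** If the arc leaves the box of size 17 u, then turns around a with h = 5 u and with h = 15 u both
    meet the two-vertex path a, b. They cannot meet it at a, so b lies in the rings from 3 u to 10 u
    and from 13 u to 20 u, which are disjoint. The number 17 is h + 2 u for the larger turn. *)
Lemma short_edge a b : edge G a b -> arc_set G a b `<=` box a (17%:R * u).
Proof.
move=> e z hz; apply: contrapT => nz; have := u0 => u0'.
have [va vb] := edge_vtx e.
have [y [g [pg gy ys hs]]] : exists y g, [/\ path (estep G setT) y g,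
    (forall w, w \in y :: g -> w = a \/ w = b), a \in y :: g & arc_set G a b `<=` wtrace G y g].
  case: e => e.
    exists a, [:: b]; split => /=.
    - by rewrite andbT; apply/estepP.
    - by move=> w; rewrite !inE => /orP[] /eqP ->; [left|right].
    - by rewrite mem_head.
    - by move=> w; left.
  exists b, [:: a]; split => /=.
  - by rewrite andbT; apply/estepP.
  - by move=> w; rewrite !inE => /orP[] /eqP ->; [right|left].
  - by rewrite !inE eqxx orbT.
  - by move=> w; rewrite -(arc_rev (wt_edge e)); left.
have vy : vtx G y by case: (gy y (mem_head _ _)) => ->.
have inring h : 3%:R * u < h -> h <= 15%:R * u -> ring a (h - 2%:R * u) (h + 5%:R * u) b.
  move=> h1 h2; have [vs hvs] := exists_turn va h1.
  have [||||k hk] := crossed_by_walk (a := h - 2%:R * u) (b := h + 2%:R * u) (c := a) _ _ vy pg (wtrace_vtx pg ys) _ (hs _ hz) _.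
  - by clear -u0 al0 al1 st h1 u0'; lra.
  - by clear -u0 al0 al1 st h1 u0'; lra.
  - by move=> k; rewrite subrr; clear -u0 al0 al1 st h1 u0'; lra.
  - by move=> hb; apply: nz; apply: sub_box hb; clear -u0 al0 al1 st h1 h2 u0'; lra.
  have [w [_ rw wg]] := hk _ _ (hvs k).
  case: (gy w wg) rw => -> rw; last exact: rw.
  case: rw => h3 _; case: h3.
  by split; rewrite subrr normr0; clear -u0 al0 al1 st h1 u0'; lra.
have B (x : R) : 3%:R * u < x /\ x <= 15%:R * u -> ring a (x - 2%:R * u) (x + 5%:R * u) b.
  by case=> x1 x2; exact: (inring x x1 x2).
have [|_ B1] := B (5%:R * u); first by clear -u0 al0 al1 st u0'; split; lra.
have [|B2 _] := B (15%:R * u); first by clear -u0 al0 al1 st u0'; split; lra.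
by apply: B2; apply: sub_box B1; clear -u0 al0 al1 st u0'; lra.
Qed.

(** A walk steered from any vertex towards w ends nearby with positive probability; as in
    [exists_turn], H = 0 extracts such a trajectory. *)
Lemma dense_vtx w : exists2 v, vtx G v & box w (2%:R * u) v.
Proof.
have [v0 vv] := vtx_neq0 G; apply: contrapT => none; have := u0 => u0'.
pose k : ori := (false, false).
have [N [hN1 hN2]] : exists N, `|cx k w - cx k v0| <= N%:R * u /\ `|cy k w - cy k v0| <= N%:R * u.
  pose z := Num.max `|cx k w - cx k v0| `|cy k w - cy k v0|.
  exists (Num.truncn (z / u)).+1.
  have : z <= (Num.truncn (z / u)).+1%:R * u.
    by rewrite -ler_pdivrMr // ltW //; exact: truncnS_gt.
  by rewrite ge_max => /andP[].
have : 1 * al ^+ N * al ^+ N <= 0.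
  have alN : 0 <= al ^+ N by apply: exprn_ge0; exact: ltW.
  apply: (goX u0 al0 al1 st (k := k) (X := cx k w) (t := [::]) (p := v0) (superh0 v0 setT) vv _ isT (nearb_refl v0) hN1).
  - by rewrite mul1r.
  - exact: subsetT.
  move=> p1 t1 /= y1 b1 d1 w1 v1 n1.
  apply: (goY u0 al0 al1 st (k := k) (Y := cy k w) (superh0 v0 setT) vv _ v1 n1).
  - by [].
  - by rewrite y1.
  - exact: subsetT.
  move=> p2 t2 /= x2 b2 d2 w2 v2 n2; case: none.
  exists (last v0 (t1 ++ t2)); first by apply: (walk_vtx v2 vv); exact: mem_last.
  have [f1 f2] := nearb_ori k n2.
  apply/(box_ori k); move: d1 d2 f1 f2; rewrite x2 !ltr_norml.
  move=> /andP[? ?] /andP[? ?] /andP[? ?] /andP[? ?].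
  by split; apply/andP; split; lra.
by rewrite mul1r -exprD leNgt exprn_gt0.
Qed.

End Turns.

Lemma vinf_approx_win (R : realType) (G : planar_graph R) (S : Type) (nxt : S -> plane R -> S)
    (cur : S -> plane R) (lose : pred S) (I : eqType) (win : I -> pred S) (s : S)
    (r : seq I) (e : R) : 0 < e ->
  exists n, forall i, i \in r ->
    vinf G nxt cur (win i) lose s - e <= val G nxt cur (win i) lose n s.
Proof.
move=> e0; elim: r => [|i r [n hn]]; first by exists 0%N.
have [m hm] := @vinf_approx R G S nxt cur (win i) lose unit [:: tt] (fun=> s) e e0.
exists (maxn m n) => j; rewrite inE => /orP[/eqP ->|/hn h].
  by rewrite (le_trans (hm tt _)) // val_mono // leq_maxl.
by rewrite (le_trans h) // val_mono // leq_maxr.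
Qed.

Lemma sum_vinf_le (R : realType) (G : planar_graph R) (S : Type) (nxt : S -> plane R -> S)
    (cur : S -> plane R) (lose : pred S) (I : eqType) (win : I -> pred S) (s : S)
    (r : seq I) (b : R) :
  (forall n, \sum_(i <- r) val G nxt cur (win i) lose n s <= b) ->
  \sum_(i <- r) vinf G nxt cur (win i) lose s <= b.
Proof.
move=> h; apply/ler_addgt0Pr => e e0.
have e'0 : 0 < e / (size r).+1%:R by rewrite divr_gt0.
have [n hn] := vinf_approx_win G nxt cur lose win s r e'0.
apply: (@le_trans _ _ (\sum_(i <- r) (val G nxt cur (win i) lose n s + e / (size r).+1%:R))).
  rewrite big_seq [X in _ <= X]big_seq; apply: ler_sum => i ir.
  by rewrite -lerBlDr hn.
rewrite big_split /= lerD // big_const_seq count_predT iter_addr_0 -[_ *+ _]mulr_natr.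
by rewrite -mulrA ler_piMr ?(ltW e0) // mulrC ler_pdivrMr // mul1r ler_nat.
Qed.

Lemma sum_eq_le1 (R : numDomainType) (T : eqType) (v : T) (r : seq T) : uniq r ->
  \sum_(w <- r) (if v == w then 1 else 0 : R) <= 1.
Proof.
move=> ur; rewrite -big_mkcond /= big_const_seq iter_addr_0 lern1.
by rewrite (eq_count (a2 := pred1 v)) ?count_uniq_mem ?leq_b1 // => x; rewrite /= eq_sym.
Qed.

(** * Loops as excursions *)

Section Stopped.
Variables (R : realType) (G : planar_graph R).
Local Notation q := (trans_prob G).
Local Notation nb := (nb G).

(** The mechanism of the Harnack inequalities: H equals m once P has been visited and h at the
    current vertex before, so forcing the walk to visit P bounds h at the start from below. *)
Lemma stopped_superh (v0 : plane R) (U : set (plane R)) (P : pred (plane R)) (m : R)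
    (h : plane R -> R) : 0 <= m -> (forall v, 0 <= h v) -> (forall v, P v -> m <= h v) ->
  (forall t, path (estep G U) v0 t ->
     \sum_(w <- nb (last v0 t)) q (last v0 t) w *
       (if `[< arc_set G (last v0 t) w `<=` U >] then h w else 0) <= h (last v0 t)) ->
  superh G v0 U (fun t => if has P (v0 :: t) then m else h (last v0 t)).
Proof.
move=> m0 h0 hP hs; split => [t _|t pt]; first by case: ifP.
have hr w : has P (v0 :: rcons t w) = P w || has P (v0 :: t).
  by rewrite -rcons_cons has_rcons.
case: ifP => ht.
  apply: (@le_trans _ _ (\sum_(w <- nb (last v0 t)) q (last v0 t) w * m)).
    apply: ler_sum => w _; apply: ler_wpM2l; first exact: q_ge0.
    by rewrite hr ht orbT; case: ifP.
  by rewrite -mulr_suml ler_piMl ?q_sum_le1.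
apply: le_trans (hs t pt); apply: ler_sum => w _; apply: ler_wpM2l; first exact: q_ge0.
rewrite hr ht orbF last_rcons; case: ifP => // _; case: ifP => // Pw; exact: hP.
Qed.

End Stopped.

Section Excursions.
Variables (R : realType) (G : planar_graph R) (u al : R).
Hypotheses (u0 : 0 < u) (al0 : 0 < al) (al1 : al <= 1).
Hypothesis st : steerable G u al.
Variables (z : plane R) (D : set (plane R)) (g : seq (plane R)).
Implicit Types (v w : plane R) (t : seq (plane R)).
Local Notation q := (trans_prob G).
Local Notation nb := (nb G).

Definition core : set (plane R) := box z u.
(** Size 20 leaves room inside for a turn with h = 5 u about a vertex of the core, and for the box
    of size 18 u about a vertex within 2 u of z. *)
Definition far : set (plane R) := ~` box z (20%:R * u).

Definition killed v w : bool := ~~ `[< arc_set G v w `<=` D >] || (w \in g).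

(* [Live ph v]: the walk is at v, and ph tells whether it has been far since it
   last was in the core. [Ret w]: it has just come back to the core, at w. *)
Inductive exc_state := Live of bool & plane R | Ret of plane R | Dead.

(* When b is false, the walk can only be killed on its way back to the core. *)
Definition exc_step (b : bool) (s : exc_state) w : exc_state :=
  if s is Live ph v then
    if (b || ph) && killed v w then Dead
    else if ph then (if `[< core w >] then Ret w else Live true w)
    else Live `[< far w >] w
  else s.

Definition exc_cur (s : exc_state) : plane R :=
  match s with Live _ v => v | Ret v => v | Dead => (0, 0) end.

Definition not_live (s : exc_state) := if s is Live _ _ then false else true.
Definition ret_at w (s : exc_state) := if s is Ret w' then w' == w else false.
Definition is_ret (s : exc_state) := if s is Ret _ then true else false.

Definition exc b w n s : R := val G (exc_step b) exc_cur (ret_at w) not_live n s.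
Definition exc_inf b w s : R := vinf G (exc_step b) exc_cur (ret_at w) not_live s.
Definition row n s : R := val G (exc_step true) exc_cur is_ret not_live n s.

Lemma exc_le w n s : exc true w n s <= exc false w n s.
Proof.
elim: n s => [|n IH] [ph v|v|] //; rewrite /exc /= ler_sum // => x _.
apply: ler_wpM2l; first exact: q_ge0.
rewrite -!/(exc _ _ _ _); case: (killed v x); case: ph => //=; rewrite ?IH //.
by rewrite [X in X <= _](_ : _ = 0) ?val_ge0 //; case: (n).
Qed.

Lemma exc_row n s (r : seq (plane R)) : uniq r ->
  \sum_(w <- r) exc true w n s <= row n s.
Proof.
move=> ur; have base v := sum_eq_le1 R v ur.
elim: n s => [|n IH] [ph v|v|] /=.
- by rewrite /exc /row /= big1.
- by rewrite /exc /row /=; apply: le_trans (base v); apply: ler_sum => w _; case: ifP.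
- by rewrite /exc /row /= big1.
- rewrite /exc /row /= exchange_big /= ler_sum // => x _.
  by rewrite -mulr_sumr ler_wpM2l ?q_ge0 // IH.
- by rewrite /exc /row /=; apply: le_trans (base v); apply: ler_sum => w _; case: ifP.
- by rewrite /exc /row /= big1.
Qed.

Lemma exc_sum1 n s (r : seq (plane R)) : uniq r -> \sum_(w <- r) exc false w n s <= 1.
Proof.
move=> ur; have base v := sum_eq_le1 R v ur.
elim: n s => [|n IH] [ph v|v|] /=.
- by rewrite /exc /= big1.
- by rewrite /exc /=; apply: le_trans (base v); apply: ler_sum => w _; case: ifP.
- by rewrite /exc /= big1.
- rewrite /exc /= exchange_big /=; apply: le_trans (q_sum_le1 G v); apply: ler_sum => x _.
  by rewrite -mulr_sumr ler_piMr ?q_ge0 // IH.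
- by rewrite /exc /=; apply: le_trans (base v); apply: ler_sum => w _; case: ifP.
- by rewrite /exc /= big1.
Qed.

(* Following the best neighbour leads from the core to the far region along
   vertices at which the return probability does not decrease. *)
Lemma exc_path w n v m : 0 < m -> m <= exc false w n (Live false v) ->
  exists t, [/\ path (estep G setT) v t, far (last v t), t <> [::] &
    forall x, x \in belast v t -> m <= exc_inf false w (Live false x)].
Proof.
move=> m0; elim: n v => [|n IH] v hm.
  by move: hm; rewrite /exc /= leNgt m0.
have [x [vx hx]] : exists x, 0 < wt G v x /\
    exc false w n.+1 (Live false v) <= exc false w n (exc_step false (Live false v) x).
  have [//||x [h1 h2]] := @val_step_ge _ G _ (exc_step false) exc_cur (ret_at w) not_live n (Live false v).
    exact: lt_le_trans hm.
  by exists x.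
have hv : m <= exc_inf false w (Live false v).
  by apply: le_trans hm _; exact: val_vinf.
rewrite /exc_step /= in hx; case: (asboolP (far x)) hx => fx hx.
  exists [:: x]; split => //=; first by rewrite andbT; apply/estepP.
  by move=> y; rewrite inE => /eqP ->.
have [t [pt ft tn ht]] := IH x (le_trans hm hx).
exists (x :: t); split => //=; first by rewrite pt andbT; apply/estepP.
by move=> y; rewrite inE => /orP[/eqP ->//|/ht].
Qed.

(** Cost 13 * N of a turn with h = 5 u started at its centre, where 2 h + 8 u = 18 u gives N =
    18. *)
Definition harnack : R := al ^+ (13 * 18).

Lemma harnack_gt0 : 0 < harnack. Proof. exact: exprn_gt0. Qed.

(** Since g may run through the core, only the version without killing on the way out is harmonic
    near the core. From v, a path of vertices with value at least m leads to the far region; the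
    walk turning around v0 meets it before being far. *)
Lemma exc_harnack w n v v0 : vtx G v -> vtx G v0 -> core v -> core v0 ->
  exc false w n (Live false v) * harnack <= exc_inf false w (Live false v0).
Proof.
move=> vv vv0 cv cv0; have := u0 => u0'.
have [e0|n0] := eqVneq (exc false w n (Live false v)) 0.
  by rewrite e0 mul0r; exact: vinf_ge0.
set m := exc false w n (Live false v) in n0 *.
have m0 : 0 < m by rewrite lt_neqAle eq_sym n0 val_ge0.
have [t [pt ft tn ht]] := exc_path m0 (lexx m).
pose P := mem (belast v t); pose h x := exc_inf false w (Live false x).
have subU : box v0 (5%:R * u + 5%:R * u) `<=` box z (20%:R * u).
  by apply: (box_sub cv0); clear -u0 al0 al1 st z D g u0'; lra.
pose U := box v0 (5%:R * u + 5%:R * u).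
have sH : superh G v0 U (fun t => if has P (v0 :: t) then m else h (last v0 t)).
  apply: stopped_superh => //.
  - exact: ltW.
  - by move=> x; exact: vinf_ge0.
  (* Inside U the walk is never far, so its phase remains false and h is averaged exactly. *)
  - move=> t' _; rewrite [X in _ <= X]/h /exc_inf vinf_step //=.
    rewrite big_seq [X in _ <= X]big_seq ler_sum // => x; rewrite nbP => xn.
    rewrite ler_wpM2l ?q_ge0 //; case: asboolP => [aU|_]; last exact: vinf_ge0.
    case: asboolP => // fx; case: fx; apply: subU; apply: aU.
    by apply: arc_set_r; exact: wt_edge.
have -> : harnack = al ^+ (13 * 18) by [].
have H0 : (if has P (v0 :: [::]) then m else h v0) <= exc_inf false w (Live false v0).
  by case: ifP => //=; rewrite orbF => /ht.
apply: le_trans H0.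
apply: (turn_center u0 al0 al1 st sH vv0 (ltW m0) _ _ (@subset_refl _ _)).
- by clear -u0 al0 al1 st z D g u0'; lra.
- by clear -u0 al0 al1 st z D g u0'; lra.
move=> t' _ _ td; suff -> : has P (v0 :: t') by [].
have [||||k hk] := crossed_by_walk (a := 5%:R * u - 2%:R * u) (b := 5%:R * u + 2%:R * u)
   (c := v0) _ _ vv pt (wtrace_head pt) _ (wtrace_vtx pt (mem_last v t)) _.
- by clear -u0 al0 al1 st z D g u0'; lra.
- by clear -u0 al0 al1 st z D g u0'; lra.
- move=> k; apply: box_cy_le; apply: (box_sub (box_sym cv0) _ cv).
  by clear -u0 al0 al1 st z D g u0'; lra.
- move=> hb; apply: ft; apply: (box_sub cv0 _ hb).
  by clear -u0 al0 al1 st z D g u0'; lra.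
have [x [xt [_ xb] xv]] := hk _ _ (td k).
apply/hasP; exists x => //; move: xv; rewrite lastI mem_rcons inE => /orP[/eqP e|//].
by case: ft; rewrite -e; exact: subU.
Qed.

(** Truncated Green function: the expected number of returns to the core occurring at w within n
    steps, each return starting a new excursion. *)
Fixpoint green w n s : R :=
  if n is m.+1 then
    if s is Live ph v then
      \sum_(x <- nb v) q v x *
        match exc_step true s x with
        | Ret x' => (x' == w)%:R + green w m (Live false x')
        | s' => green w m s'
        end
    else 0
  else 0.

Lemma green_ge0 w n s : 0 <= green w n s.
Proof.
elim: n s => // n IH [ph v|v|] //=; apply: sumr_ge0 => x _; apply: mulr_ge0.
  exact: q_ge0.
by case: ifP => _; [exact: IH|case: ph; [case: ifP => _|]; rewrite ?addr_ge0].
Qed.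

Lemma green_leS w n s : green w n s <= green w n.+1 s.
Proof.
elim: n s => [|n IH] [ph v|v|]; try by rewrite /= ?green_ge0.
  exact: green_ge0.
rewrite [X in X <= _]/= [X in _ <= X]/= ler_sum // => x _; rewrite ler_wpM2l ?q_ge0 //.
case: ifP => _; first exact: IH.
by case: ph; [case: ifP => _; rewrite ?lerD2l; exact: IH|exact: IH].
Qed.

Variable s1 : seq (plane R).
Hypothesis s1u : uniq s1.
Hypothesis s1P : forall v, v \in s1 <-> vtx G v /\ core v.

(** Decomposition at the first return, G <= E + E G; an inequality, since the time spent before this
    return is not deducted from n. *)
Lemma green_dec w n s : green w n s <=
  exc true w n s + \sum_(v <- s1) exc true v n s * green w n (Live false v).
Proof.
elim: n s => [|n IH] s.
  by rewrite [X in X <= _]/= addr_ge0 ?val_ge0 // sumr_ge0 // => v _; rewrite mulr0.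
case: s => [ph v|v|]; last 2 first.
- by rewrite [X in X <= _]/= addr_ge0 ?val_ge0 // sumr_ge0 // => x _; rewrite mulr_ge0 ?val_ge0 ?green_ge0.
- by rewrite [X in X <= _]/= addr_ge0 ?val_ge0 // sumr_ge0 // => x _; rewrite mulr_ge0 ?val_ge0 ?green_ge0.
have exS x : exc true x n.+1 (Live ph v) =
    \sum_(y <- nb v) q v y * exc true x n (exc_step true (Live ph v) y) by [].
rewrite exS; under [X in _ <= _ + X]eq_bigr do rewrite exS mulr_suml.
rewrite exchange_big -big_split /= big_seq [X in _ <= X]big_seq ler_sum // => y yn.
under [X in _ <= _ + X]eq_bigr do rewrite -mulrA.
rewrite -mulr_sumr -mulrDr ler_wpM2l ?q_ge0 //.
have rec s : green w n s <= exc true w n s +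
    \sum_(i <- s1) exc true i n s * green w n.+1 (Live false i).
  apply: le_trans (IH s) _; rewrite lerD2l ler_sum // => i _.
  by rewrite ler_wpM2l ?val_ge0 // green_leS.
case: ifP => _; first exact: rec.
case: ph {exS}; last exact: rec.
case: asboolP => cy; last exact: rec.
have ys : y \in s1 by apply/s1P; split => //; case: (nb_vtx yn).
have excR x : exc true x n (Ret y) = (y == x)%:R.
  by rewrite /exc; case: (n) => [|?] /=; case: eqP.
rewrite excR lerD2l (bigD1_seq y) //= excR eqxx mul1r.
apply: le_trans (green_leS w n (Live false y)) _; rewrite lerDl sumr_ge0 // => x _.
apply: mulr_ge0; first exact: val_ge0.
exact: (green_ge0 w n.+1 (Live false x)).
Qed.

Variable theta : R.
Hypothesis theta1 : theta < 1.
Hypothesis row_le : forall n v, vtx G v -> core v -> row n (Live false v) <= theta.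

(** For fixed w, let M be the maximum over the core of the column of w in G. The rows of E sum to at
    most theta and Harnack bounds the column of w in E by its entry at one vertex v0 divided by
    [harnack], so M is at most this quotient over 1 - theta. Summing over w leaves the row of v0 for
    the walk not killed on its way out, whose sum is at most 1. *)
Lemma green_trace n : \sum_(w <- s1) green w n (Live false w) <= (harnack * (1 - theta))^-1.
Proof.
have t1 : 0 < 1 - theta by rewrite subr_gt0.
have h0 := harnack_gt0.
have K0 : 0 <= (harnack * (1 - theta))^-1.
  by rewrite invr_ge0 ltW // mulr_gt0.
case E : s1 => [|v0 s']; first by rewrite big_nil.
have [vv0 cv0] : vtx G v0 /\ core v0 by apply/s1P; rewrite E mem_head.
rewrite -E.
have bnd w v : v \in s1 -> green w n (Live false v) <=
    exc_inf false w (Live false v0) * (harnack * (1 - theta))^-1.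
  pose M := \big[Num.max/0]_(v <- s1) green w n (Live false v).
  have Mge x : x \in s1 -> green w n (Live false x) <= M.
    rewrite /M; elim: (s1) => // y r IH; rewrite inE big_cons.
    by case/orP => [/eqP ->|/IH h]; rewrite le_max ?lexx // h orbT.
  have M0 : 0 <= M by rewrite /M; elim: (s1) => [|x r IH]; rewrite ?big_nil // big_cons le_max IH orbT.
  pose K := exc_inf false w (Live false v0) / harnack.
  have K0' : 0 <= K by rewrite divr_ge0 ?vinf_ge0 // ltW.
  have th0 : 0 <= theta.
    by apply: le_trans (row_le 0 vv0 cv0); exact: val_ge0.
  have step x : x \in s1 -> green w n (Live false x) <= K + theta * M.
    move=> xs; have [vx cx] := (s1P x).1 xs.
    apply: le_trans (green_dec w n (Live false x)) _; apply: lerD.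
      rewrite ler_pdivlMr //; apply: le_trans (exc_harnack w n vx vv0 cx cv0).
      by rewrite ler_wpM2r ?exc_le // ltW.
    apply: (@le_trans _ _ (\sum_(v <- s1) exc true v n (Live false x) * M)).
      rewrite big_seq [X in _ <= X]big_seq ler_sum // => y ys.
      by rewrite ler_wpM2l ?val_ge0 // Mge.
    rewrite -mulr_suml ler_wpM2r // (le_trans (exc_row n _ s1u)) //.
    exact: row_le.
  have MK : M <= K + theta * M.
    rewrite {1}/M big_seq; elim/big_ind : _ => //.
      by rewrite addr_ge0 // mulr_ge0.
    by move=> x y hx hy; rewrite ge_max hx hy.
  move=> vs; apply: le_trans (Mge _ vs) _.
  rewrite invfM mulrA -/K ler_pdivlMr // mulrBr mulr1 lerBlDr [M * _]mulrC.
  exact: MK.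
apply: (@le_trans _ _ (\sum_(w <- s1) exc_inf false w (Live false v0) * (harnack * (1 - theta))^-1)).
  by rewrite big_seq [X in _ <= X]big_seq ler_sum // => w ws; exact: bnd.
rewrite -mulr_suml ler_piMl //; apply: sum_vinf_le => k; exact: exc_sum1.
Qed.

End Excursions.

Lemma esum_disjoint_bigcup (R : realType) (I T : choiceType) (P : set I) (J : I -> set T)
    (a : T -> \bar R) : (forall x, (0 <= a x)%E) ->
  (forall i j x, P i -> P j -> J i x -> J j x -> i = j) ->
  \esum_(i in P) \esum_(x in J i) a x = \esum_(x in \bigcup_(i in P) J i) a x.
Proof.
move=> a0 dis; rewrite esum_esum //; apply/esym; apply: reindex_esum; split.
- by move=> [i x] [/= Pi Jx]; exists i.
- move=> [i x] [j y]; rewrite !inE => -[/= Pi Ji] [/= Pj Jj] xy.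
  by rewrite -xy in Jj *; rewrite (dis i j x).
- by move=> x [i Pi Jix]; exists (i, x).
Qed.

Lemma sum_seq_le (R : numDomainType) (T : eqType) (r r' : seq T) (f : T -> R) :
  uniq r -> (forall x, 0 <= f x) -> (forall x, x \in r -> f x != 0 -> x \in r') ->
  \sum_(x <- r) f x <= \sum_(x <- r') f x.
Proof.
move=> + f0; elim: r r' => [|x r IH] r' /=.
  by move=> _ _; rewrite big_nil sumr_ge0.
move=> /andP[xr ur] sub; rewrite big_cons.
have [fx0|fx] := eqVneq (f x) 0.
  by rewrite fx0 add0r; apply: IH => // y yr fy; apply: sub => //; rewrite inE yr orbT.
have xr' : x \in r' by apply: sub => //; rewrite mem_head.
rewrite (big_rem x xr') /= lerD2l; apply: IH => // y yr fy.
have : y \in r' by apply: sub => //; rewrite inE yr orbT.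
rewrite (perm_mem (perm_to_rem xr')) inE => /orP[/eqP e|//].
by move: xr; rewrite -e yr.
Qed.

Section Words.
Variable (T : eqType).

Fixpoint words (V : seq T) n : seq (seq T) :=
  if n is m.+1 then [seq x :: p | x <- V, p <- words V m] else [:: [::]].

Lemma mem_words V p : {subset p <= V} -> p \in words V (size p).
Proof.
elim: p => [|x p IH] /= h; first by rewrite inE.
apply/allpairsP; exists (x, p); split => //=; first by apply: h; rewrite mem_head.
by apply: IH => y yp; apply: h; rewrite inE yp orbT.
Qed.

End Words.

(** * The mass of loops and the trace of the Green function *)

Section LoopSums.
Variables (R : realType) (G : planar_graph R) (u : R).
Hypothesis u0 : 0 < u.
Variables (z : plane R) (D : set (plane R)) (g : seq (plane R)).
Implicit Types (v w : plane R) (t p s : seq (plane R)).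
Local Notation q := (trans_prob G).
Local Notation nb := (nb G).
Local Notation core := (core u z).
Local Notation far := (far u z).
Local Notation killed := (killed G D g).
Local Notation step := (exc_step G u z D g true).
Local Notation green := (green G u z D g).

Fixpoint pw v p : R := if p is x :: p' then q v x * pw x p' else 1.

Lemma pw_ge0 v p : 0 <= pw v p.
Proof. by elim: p v => //= x p IH v; rewrite mulr_ge0 ?q_ge0. Qed.

Definition restart (s : exc_state R) := if s is Ret x then Live false x else s.

(** Recognises the words whose last letter is a return at w, earlier returns being allowed through
    [restart]. *)
Fixpoint acc w (s : exc_state R) p : bool :=
  if p is x :: p' then (nilp p' && ret_at w (step s x)) || acc w (restart (step s x)) p'
  else false.

Lemma acc_dead w p : acc w (Dead R) p = false.
Proof. by elim: p => //= x p ->; rewrite andbF. Qed.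

Lemma cur_step ph v x : ~~ killed v x ->
  exists ph', restart (step (Live ph v) x) = Live ph' x.
Proof.
move=> /negbTE h; rewrite /exc_step /= h; case: ph => /=; last by exists `[< far x >].
by case: asboolP => _; [exists false|exists true].
Qed.

(** Path expansion of the Green function: its terms are the weights of the words that end with a
    return at w. Words over V using a missing edge have weight 0. *)
Lemma acc_sum V n w ph v : uniq V ->
  \sum_(k < n) \sum_(p <- words V k.+1) (acc w (Live ph v) p)%:R * pw v p
    <= green w n (Live ph v).
Proof.
move=> uV; elim: n ph v => [|n IH] ph v; first by rewrite big_ord0.
have gS : green w n.+1 (Live ph v) = \sum_(x <- nb v) q v x *
     ((ret_at w (step (Live ph v) x))%:R + green w n (restart (step (Live ph v) x))).
  rewrite -[LHS]/(\sum_(x <- nb v) q v x * match step (Live ph v) x with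
     | Ret x' => (x' == w)%:R + green w n (Live false x') | s' => green w n s' end).
  apply: eq_bigr => x _; congr (_ * _).
  by case: (step (Live ph v) x) => [? ?|?|] /=; rewrite ?add0r.
rewrite gS; under eq_bigr do rewrite big_allpairs_dep /=.
rewrite exchange_big /=.
apply: (@le_trans _ _ (\sum_(x <- V) q v x *
     ((ret_at w (step (Live ph v) x))%:R + green w n (restart (step (Live ph v) x))))); last first.
  apply: sum_seq_le => //.
    move=> x; rewrite mulr_ge0 ?q_ge0 // addr_ge0 ?ler0n //; exact: green_ge0.
  move=> x _ nz; rewrite nbP -q_gt0 lt_neqAle q_ge0 andbT eq_sym.
  by apply: contraNneq nz => ->; rewrite mul0r.
apply: ler_sum => x _.
have [s' es'] : exists s' : exc_state R, s' = step (Live ph v) x by exists (step (Live ph v) x).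
have hs' : s' = Dead R \/ exists ph', restart s' = Live ph' x.
  rewrite es' /exc_step; case: ifP => _; first by left.
  by right; case: (ph); [case: ifP => _; [exists false|exists true]|exists `[< far x >]].
have es2 : s' = (if killed v x then Dead R else if ph then (if `[< core x >] then Ret x
    else Live true x) else Live `[< far x >] x) := es'.
rewrite -es' big_ord_recl /= big_seq1 /= -?es2 orbF mulr1 mulrDr [_%:R * _]mulrC lerD2l.
under eq_bigr => k _.
  rewrite (_ : \sum_(p <- _) _ =
     q v x * \sum_(p <- words V k.+1) (acc w (restart s') p)%:R * pw x p); last first.
    rewrite big_distrr /=; apply: eq_big_seq => p /allpairsP[[y p'] [_ _ ->]].
    by rewrite /= -?es2 mulrCA.
  over.
rewrite -mulr_sumr ler_wpM2l ?q_ge0 //.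
case: hs' => [->|[ph' ->]]; last exact: IH.
rewrite big1 ?green_ge0 // => k _; rewrite big1 // => p _.
by rewrite acc_dead mul0r.
Qed.

(** The root is a core vertex at which an excursion ends: after f, the return to a that closes the
    loop is the first visit to the core. *)
Definition good s := exists a b f c,
  [/\ s = a :: b ++ f :: c, core a, far f & forall x, x \in c -> ~ core x].

Definition unkilled s := forall e, e \in zip s (rot 1 s) -> ~~ killed e.1 e.2.

Lemma zip_pathP (e : rel (plane R)) a s b :
  (forall x, x \in zip (a :: s) (rcons s b) -> e x.1 x.2) <-> path e a (rcons s b).
Proof.
elim: s a => [|x s IH] a /=.
  rewrite andbT; split; first by move=> h; apply: (h (a, b)); rewrite mem_head.
  by move=> h y; rewrite inE => /eqP ->.
split.
  move=> h; apply/andP; split; first by apply: (h (a, x)); rewrite mem_head.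
  by apply/IH => y hy; apply: h; rewrite inE hy orbT.
by move=> /andP[ax /IH h] y; rewrite inE => /orP[/eqP ->//|/h].
Qed.

Lemma loop_qE a s b :
  \prod_(e <- zip (a :: s) (rcons s b)) q e.1 e.2 = pw a (rcons s b).
Proof.
by elim: s a => [|x s IH] a /=; rewrite big_cons ?big_nil //= IH.
Qed.

Lemma core_far x : core x -> ~ far x.
Proof. by move=> c; apply; apply: sub_box c; have := u0 => ?; lra. Qed.

Lemma good_acc a b f c : core a -> far f -> (forall x, x \in c -> ~ core x) ->
  path (fun x y => ~~ killed x y) a (rcons (b ++ f :: c) a) ->
  acc a (Live false a) (rcons (b ++ f :: c) a).
Proof.
move=> ca ff nc; rewrite rcons_cat rcons_cons.
have tail v p : path (fun x y => ~~ killed x y) v (rcons p a) ->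
    (forall x, x \in p -> ~ core x) -> acc a (Live true v) (rcons p a).
  elim: p v => [|x p IH] v /= /andP[kx px] np.
    by rewrite (negbTE kx) /= asboolT //= eqxx.
  have nx : ~ core x by apply: np; rewrite mem_head.
  rewrite (negbTE kx) /= asboolF //=; apply/orP; right; apply: IH => // y yp.
  by apply: np; rewrite inE yp orbT.
suff gen ph v : path (fun x y => ~~ killed x y) v (b ++ f :: rcons c a) ->
    acc a (Live ph v) (b ++ f :: rcons c a) by exact: gen.
elim: b ph v => [|x b IH] ph v /= /andP[kx px].
  apply/orP; right; rewrite (negbTE kx).
  have -> : restart (if ph then if `[< core f >] then Ret f else Live true f
     else Live `[< far f >] f) = Live true f.
    case: ph => /=; last by rewrite asboolT.
    by rewrite asboolF // => /core_far.
  exact: tail.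
apply/orP; right; have [ph' e] := cur_step ph kx.
by rewrite -[restart _]/(restart (step (Live ph v) x)) e; exact: IH.
Qed.

Variable s1 : seq (plane R).
Hypothesis s1P : forall v, v \in s1 <-> vtx G v /\ core v.

(** Read from its root a, a good loop is a word accepted for the diagonal entry at a, which is why a
    trace appears. *)
Lemma good_loops_sum (L : seq (seq (plane R))) : uniq L ->
  (forall s, s \in L -> [/\ good s, unkilled s & forall v, v \in s -> vtx G v]) ->
  exists N, \sum_(s <- L) loop_q G s <= \sum_(w <- s1) green w N (Live false w).
Proof.
move=> uL hL.
pose V := undup (flatten L); pose N := \max_(s <- L) size s; exists N.
pose f w s := (acc w (Live false w) (rot 1 s))%:R * pw w (rot 1 s).
have f0 w s : 0 <= f w s by rewrite mulr_ge0 ?ler0n ?pw_ge0.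
apply: (@le_trans _ _ (\sum_(s <- L) \sum_(w <- s1) f w s)).
  rewrite big_seq [X in _ <= X]big_seq ler_sum // => s /hL[[a [b [x [c [es ca fx nc]]]]] us vs].
  have as1 : a \in s1 by apply/s1P; split => //; apply: vs; rewrite es mem_head.
  have r1 : rot 1 s = rcons (b ++ x :: c) a by rewrite es rot1_cons.
  have -> : loop_q G s = f a s.
    rewrite /f /loop_q r1 {1}es loop_qE good_acc ?mul1r //.
    by apply/zip_pathP => e; rewrite -r1 -es; exact: us.
  by rewrite (big_rem a) //= lerDl sumr_ge0.
rewrite exchange_big ler_sum // => w _.
apply: le_trans (acc_sum N w false w (undup_uniq (flatten L))).
rewrite -/V /f -(big_map (rot 1) xpredT (fun p => (acc w (Live false w) p)%:R * pw w p)).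
rewrite -(big_mkord xpredT (fun k => \sum_(p <- words V k.+1) (acc w (Live false w) p)%:R * pw w p)).
rewrite -(big_map (fun k => words V k.+1) xpredT (fun r => \sum_(p <- r) (acc w (Live false w) p)%:R * pw w p)).
rewrite -big_flatten; apply: sum_seq_le.
- by rewrite map_inj_uniq //; exact: rot_inj.
- by move=> p; rewrite mulr_ge0 ?ler0n ?pw_ge0.
move=> _ /mapP[s sL ->] _; have sz : (0 < size s)%N by have [[? [? [? [? [-> _ _ _]]]]] _ _] := hL s sL.
apply/flattenP; exists (words V (size s)).
  apply/mapP; exists (size s).-1; last by rewrite prednK.
  by rewrite mem_index_iota leq0n /= prednK // /N (big_rem s) //= leq_max leqnn.
rewrite -(size_rot 1); apply: mem_words => x; rewrite mem_rot => xs.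
by rewrite mem_undup; apply/flattenP; exists s.
Qed.

Lemma zip_rot k s : zip (rot k s) (rot 1 (rot k s)) = rot k (zip s (rot 1 s)).
Proof.
rewrite rot_rot; have : size s = size (rot 1 s) by rewrite size_rot.
move: (rot 1 s) => t st.
have [sk|ks] := leqP (size s) k.
  by rewrite !rot_oversize // ?size1_zip -?st.
rewrite /rot zip_cat ?size_drop ?st //; congr (_ ++ _).
  by elim: k s t st ks => [|k IH] [|x s] [|y t] //= [st] ks; rewrite IH.
by elim: k s t st ks => [|k IH] [|x s] [|y t] //= [st] ks; rewrite ?IH // !take0.
Qed.

Lemma loop_q_rot k s : loop_q G (rot k s) = loop_q G s.
Proof. by rewrite /loop_q zip_rot; apply: perm_big; rewrite perm_rot. Qed.

Lemma loop_q_ge0 s : 0 <= loop_q G s.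
Proof. by apply: prodr_ge0 => e _; exact: q_ge0. Qed.

(** Rotate the loop to start at the far vertex; the first core vertex after it is the root. *)
Lemma exists_good_rot s x y : x \in s -> y \in s -> core x -> far y ->
  exists2 k, (k < size s)%N & good (rot k s).
Proof.
move=> xs ys cx fy; have [i r er] := rot_to ys.
have xr : x \in r.
  have : x \in rot i s by rewrite mem_rot.
  by rewrite er inE => /orP[/eqP e|//]; case: (core_far cx); rewrite e.
pose P w := `[< core w >].
have hp : has P r by apply/hasP; exists x => //; apply/asboolP.
have gd : good (rot (find P r).+1 (rot i s)).
  set j := find P r; have jr : (j < size r)%N by rewrite -has_find.
  exists (nth y r j), (drop j.+1 r), y, (take j r); split => //.
  - by rewrite er /rot /= (drop_nth y jr).
  - by have := nth_find y hp; rewrite /P => /asboolP.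
  - move=> w /(nthP y)[k]; rewrite size_take jr => kj <-; rewrite nth_take //.
    by move=> cw; have := before_find y kj; rewrite /P asboolT.
have [k ek] : exists k, rot (find P r).+1 (rot i s) = rot k s.
  by exists (rot_add s i (find P r).+1); rewrite rot_rot_add.
rewrite ek in gd; have [ks|ks] := ltnP k (size s); first by exists k.
exists 0%N; last by rewrite rot0 -(rot_oversize ks).
by rewrite -has_predT; apply/hasP; exists x.
Qed.

End LoopSums.

Section Rerooting.
Variables (R : realType) (G : planar_graph R).
Implicit Types (s t : seq (plane R)) (D : set (plane R)).

Lemma reroot_rot k s : reroot (rot k s) = reroot s.
Proof.
have sub (m : nat) t : reroot (rot m t) `<=` reroot t.
  by move=> _ [j ->]; rewrite rot_rot_add; exists (rot_add t m j).
apply/seteqP; split; first exact: sub.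
have [sk|ks] := leqP (size s) k; first by rewrite rot_oversize.
have es : s = rot (size s - k) (rot k s).
  have -> : (size s - k)%N = (size (rot k s) - k)%N by rewrite size_rot.
  by rewrite -[LHS](rotK k s).
by rewrite {1}es; exact: sub.
Qed.

Lemma unrooted_reroot u s : unrooted_loops G u -> u s -> u = reroot s /\ rooted_loop G s.
Proof.
move=> [t [tn tq] ->] [k ->]; rewrite reroot_rot; split => //; split.
  by move/(congr1 size); rewrite size_rot => /size0nil.
by rewrite loop_q_rot.
Qed.

Lemma loop_q_step s e : 0 < loop_q G s -> e \in zip s (rot 1 s) -> 0 < wt G e.1 e.2.
Proof.
move=> q0 es; rewrite -q_gt0 lt_neqAle q_ge0 andbT; apply/eqP => e0.
by move: q0; rewrite /loop_q (big_rem e) //= -e0 mul0r ltxx.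
Qed.

Lemma zip_fst s x : x \in s -> exists y, (x, y) \in zip s (rot 1 s).
Proof.
move=> xs; have : x \in unzip1 (zip s (rot 1 s)) by rewrite unzip1_zip ?size_rot.
by move=> /mapP[[a b] h /= ->]; exists b.
Qed.

Lemma zip_mem s t (x y : plane R) : (x, y) \in zip s t -> x \in s /\ y \in t.
Proof.
elim: s t => [|a s IH] [|b t] //=; rewrite !inE => /orP[/eqP[-> ->]|/IH[-> ->]].
  by rewrite !eqxx.
by rewrite !orbT.
Qed.

Lemma loop_vtx s x : 0 < loop_q G s -> x \in s -> vtx G x.
Proof.
by move=> q0 /zip_fst[y /(loop_q_step q0) /wt_edge/edge_vtx[]].
Qed.

End Rerooting.

Section LambdaBound.
Variables (R : realType) (G : planar_graph R) (u : R).
Hypothesis u0 : 0 < u.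
Variables (z : plane R) (D : set (plane R)) (g : seq (plane R)).
Implicit Types (s t : seq (plane R)).
Local Notation core := (core u z).
Local Notation far := (far u z).
Variable s1 : seq (plane R).
Hypothesis s1P : forall v, v \in s1 <-> vtx G v /\ core v.

(** The weight 1 / n of a loop of length n averages over its n re-rootings. At least one of them is
    good, and summed over all loops of length n each rotation contributes the same amount, so the
    mass is at most the sum of [loop_q] over good rooted loops. *)
Lemma Lambda_excursions (B : set (set (seq (plane R)))) (C : R) :
  (forall l, B l -> loops_in G D l -> ~ visits g l /\
     exists s x y, [/\ l s, x \in s, y \in s, core x & far y]) ->
  (forall n, \sum_(w <- s1) green G u z D g w n (Live false w) <= C) ->
  (Lambda G D B <= C%:E)%E.
Proof.
move=> hB hC.
pose T := \bigcup_(l in B `&` loops_in G D) l.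
have Tprop s : T s -> [/\ 0 < loop_q G s, (0 < size s)%N, unkilled G D g s &
    exists2 k, (k < size s)%N & good u z (rot k s)].
  move=> [l [Bl lD] ls]; have [nv [t [x [y [lt xt yt cx fy]]]]] := hB l Bl lD.
  have [el [sn q0]] := unrooted_reroot lD.1 ls.
  split => //; first by rewrite lt0n size_eq0; apply/eqP.
    move=> e es; apply/negP => /orP[/negP h|eg].
      apply: h; apply/asboolP => w hw; apply: lD.2.
      by exists s, e.
    apply: nv; exists s, e.2; split => //.
    by have := es; rewrite [e]surjective_pairing => /zip_mem[_]; rewrite mem_rot.
  move: lt; rewrite el => -[k et]; rewrite et !mem_rot in xt yt.
  exact: exists_good_rot xt yt cx fy.
have Trot s k : T s -> T (rot k s).
  move=> [l Bl ls]; exists l => //.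
  by have [-> _] := unrooted_reroot Bl.2.1 ls; exists k.
have mass0 s : (0 <= (rooted_mass G s)%:E)%E.
  by rewrite lee_fin divr_ge0 ?loop_q_ge0.
have -> : Lambda G D B = \esum_(s in T) (rooted_mass G s)%:E.
  apply: esum_disjoint_bigcup => // l l' s [_ [hl _]] [_ [hl' _]] ls l's.
  by rewrite (unrooted_reroot hl ls).1 (unrooted_reroot hl' l's).1.
pose Tn (n : nat) := T `&` [set s | size s = n].
have TE : T = \bigcup_(n in setT) Tn n.
  by apply/seteqP; split => [s Ts|s [n _ []]//]; exists (size s).
pose gd s : R := (`[< good u z s >])%:R.
have gd0 s : 0 <= loop_q G s * gd s by rewrite mulr_ge0 ?loop_q_ge0 ?ler0n.
apply: (@le_trans _ _ (\esum_(s in T) (loop_q G s * gd s)%:E)%E).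
  have dis i j s : setT i -> setT j -> Tn i s -> Tn j s -> i = j.
    by move=> _ _ [_ <-] [_ <-].
  have gdE0 s : (0 <= (loop_q G s * gd s)%:E)%E by rewrite lee_fin.
  rewrite TE -(esum_disjoint_bigcup mass0 dis) -(esum_disjoint_bigcup gdE0 dis).
  apply: le_esum => n _.
  pose h s : \bar R := (loop_q G s * gd s / n%:R)%:E.
  have h0 s : (0 <= h s)%E by rewrite lee_fin divr_ge0.
  apply: (@le_trans _ _ (\esum_(s in Tn n) \sum_(i <- index_enum 'I_n) h (rot i s))).
    apply: le_esum => s [Ts /= sn]; rewrite sumEFin lee_fin -mulr_suml.
    rewrite /rooted_mass sn ler_wpM2r ?invr_ge0 //.
    have [_ _ _ [k kn gk]] := Tprop s Ts; rewrite sn in kn.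
    rewrite (bigD1 (Ordinal kn)) //= loop_q_rot /gd asboolT // mulr1 lerDl.
    by rewrite sumr_ge0.
  rewrite esum_sum //.
  have -> : (\sum_(i <- index_enum 'I_n) \esum_(s in Tn n) h (rot i s) =
             \sum_(i <- index_enum 'I_n) \esum_(s in Tn n) h s)%E.
    apply: eq_bigr => i _; apply/esym; apply: reindex_esum; split.
    - by move=> s [Ts /= sn]; split; [exact: Trot|rewrite /= size_rot].
    - by move=> s t _ _; exact: rot_inj.
    - move=> s [Ts /= sn]; exists (rotr i s); last by rewrite rotrK.
      by split; [exact: Trot|rewrite /= size_rotr].
  rewrite -esum_sum //; apply: le_esum => s [Ts /= sn].
  have n0 : n%:R != 0 :> R by rewrite pnatr_eq0 -sn -lt0n; case: (Tprop s Ts).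
  rewrite sumEFin lee_fin sumr_const card_ord -[_ *+ _]mulr_natr divfK //.
rewrite /esum ge_ereal_sup // => _ [F [finF FT] <-].
rewrite fsbig_finite //= sumEFin lee_fin.
pose L := [seq s <- finmap.enum_fset (fset_set F) | `[< good u z s >]].
have LT s : s \in L -> T s /\ good u z s.
  rewrite mem_filter => /andP[/asboolP gs sF]; split => //; apply: FT.
  by move: sF; rewrite -[_ \in finmap.enum_fset _]/(s \in fset_set F) in_fset_set // inE.
have uL : uniq L by rewrite filter_uniq // finmap.fset_uniq.
have [|N hN] := good_loops_sum u0 s1P uL (D := D) (g := g).
  move=> s /LT[Ts gs]; have [q0 _ us _] := Tprop s Ts; split => // v.
  exact: loop_vtx.
apply: le_trans (hC N); apply: le_trans hN.
rewrite /L big_filter [X in _ <= X]big_mkcond /= ler_sum // => s _.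
by rewrite /gd; case: ifP => _; rewrite ?mulr1 ?mulr0.
Qed.

End LambdaBound.

(** * Excursions are killed by the loop-erasure *)

Section Run.
Variables (R : realType) (G : planar_graph R) (u : R) (z : plane R) (D : set (plane R)).
Variable g : seq (plane R).
Implicit Types (v w : plane R) (t : seq (plane R)).
Local Notation step := (exc_step G u z D g true).
Local Notation core := (core u z).
Local Notation far := (far u z).

Definition run v t : exc_state R := foldl step (Live false v) t.

Lemma run_rcons v t w : run v (rcons t w) = step (run v t) w.
Proof. by rewrite /run -cats1 foldl_cat. Qed.

Lemma run_cur v t ph v' : run v t = Live ph v' -> v' = last v t.
Proof.
elim/last_ind: t ph v' => [|t w IH] ph v'; first by rewrite /run /= => -[].
rewrite run_rcons last_rcons; case: (run v t) => [ph1 v1|?|] //=.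
by case: ifP => _ //; case: ph1 => [|[_ ->] //]; case: ifP => _ // [_ ->].
Qed.

Lemma run_hit v t w : w \in t -> w \in g -> not_live (run v t).
Proof.
elim/last_ind: t => [|t x IH] //; rewrite mem_rcons inE run_rcons => /orP[/eqP <-|wt] wg.
  case: (run v t) => [ph v'|?|] //; by rewrite /exc_step /killed wg orbT.
by have := IH wt wg; case: (run v t).
Qed.

Lemma run_near v t : (forall w, w \in t -> ~ far w) ->
  run v t = Dead R \/ run v t = Live false (last v t).
Proof.
elim/last_ind: t => [|t x IH] h; first by right.
have hx : ~ far x by apply: h; rewrite mem_rcons mem_head.
rewrite run_rcons last_rcons; case: IH => [w wt|->|->]; first by apply: h; rewrite mem_rcons inE wt orbT.
  by left.
by rewrite /exc_step; case: ifP => _; [left|right; rewrite asboolF].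
Qed.

Lemma run_noret v t t' : (forall w, w \in t -> ~ far w) ->
  (forall w, w \in t' -> ~ core w) -> ~~ is_ret (run v (t ++ t')).
Proof.
move=> h h'; elim/last_ind: t' h' => [|t' x IH] h'.
  by rewrite cats0; case: (run_near v h) => ->.
have hx : ~ core x by apply: h'; rewrite mem_rcons mem_head.
rewrite -rcons_cat run_rcons.
have : ~~ is_ret (run v (t ++ t')).
  by apply: IH => w wt; apply: h'; rewrite mem_rcons inE wt orbT.
case: (run v (t ++ t')) => [ph v'|?|] //= _; case: ifP => _ //.
by case: ph => //; rewrite asboolF.
Qed.

(** Steering gives lower bounds, so the return probability is handled through its complement, which
    is 1 once the walk is killed and 0 once it has returned. *)
Lemma run_superh n v U : vtx G v ->
  superh G v U (fun t => 1 - row G u z D g n (run v t)).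
Proof.
move=> vv; split=> t pt; first by rewrite subr_ge0; exact: val_le1.
have le1 (F : plane R -> R) : (forall w, 0 <= F w <= 1) ->
    \sum_(w <- nb G (last v t)) trans_prob G (last v t) w * F w <= 1.
  move=> F01; apply: le_trans (q_sum_le1 G (last v t)); apply: ler_sum => w _.
  by have /andP[? ?] := F01 w; rewrite ler_piMr ?q_ge0.
case E : (run v t) => [ph v'|x|].
- have Ev := run_cur E; rewrite Ev in E *.
  apply: (@le_trans _ _ (1 - row G u z D g n.+1 (Live ph (last v t)))); last first.
    by rewrite lerD2l lerN2; exact: val_leS.
  rewrite -[row G u z D g n.+1 _]/(\sum_(w <- nb G (last v t)) trans_prob G (last v t) w *
     row G u z D g n (step (Live ph (last v t)) w)).
  rewrite lerBrDr -big_split /=.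
  apply: le_trans (q_sum_le1 G (last v t)); apply: ler_sum => w _.
  rewrite -mulrDr run_rcons E ler_piMr ?q_ge0 //.
  by case: ifP => _; rewrite ?subrK // add0r; exact: val_le1.
- rewrite big1 => [|w _]; first by rewrite subr_ge0; exact: val_le1.
  by rewrite run_rcons E /row val_win // subrr; case: ifP; rewrite mulr0.
- rewrite [row _ _ _ _ _ n (Dead R)]val_lose // subr0; apply: le1 => w.
  case: ifP => _; last by rewrite lexx ler01.
  by rewrite subr_ge0 lerBlDr lerDl val_ge0 val_le1.
Qed.

End Run.

(** Because 2 sqrt 2 < 3. *)
Lemma edist_box (R : realType) (x y : plane R) (r : R) : 0 < r ->
  box x (2%:R * r) y -> eball x (3%:R * r) y.
Proof.
move=> r0 [h1 h2]; rewrite /eball /= /Defs.edist.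
rewrite -(ltr_pXn2r (ltn0Sn 1)) ?nnegrE ?sqrtr_ge0 //; last by rewrite mulr_ge0 // ltW.
rewrite sqr_sqrtr ?addr_ge0 ?sqr_ge0 //.
have sq (a b : R) : `|b - a| < 2%:R * r -> (a - b) ^+ 2 < 4%:R * r ^+ 2.
  rewrite distrC => h; rewrite -real_normK ?num_real //.
  have -> : 4%:R * r ^+ 2 = (2%:R * r) ^+ 2 by ring.
  by rewrite ltr_pXn2r ?nnegrE //; apply: ltW; exact: le_lt_trans h.
have s1 := sq _ _ h1; have s2 := sq _ _ h2; have s3 : 0 < r ^+ 2 by rewrite exprn_gt0.
have -> : (3%:R * r) ^+ 2 = 9%:R * r ^+ 2 by ring.
by clear -s1 s2 s3; lra.
Qed.

Lemma hseg_bounds (R : realType) (u : R) (p w : plane R) (X : R) :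
  hseg u (false, false) p X w -> exists s, [/\ btw p.1 s X, s - u / 4%:R <= w.1,
    w.1 <= s + u / 4%:R, p.2 - u / 4%:R <= w.2 & w.2 <= p.2 + u / 4%:R].
Proof.
move=> [[s [b h1]] h2]; move: h1 h2; rewrite /cx /cy /= !ler_norml.
move=> /andP[z1 z2] /andP[z3 z4]; exists s.
by split => //; clear -z1 z2 z3 z4; lra.
Qed.

(** Leave the core, go to the right of the box of size r around x, then turn around x with h = r +
    103 u: two segments and a turn, hence 14 * N. The turn stays in D, and the loop-erasure starts
    inside and leads out of D, so the turn meets it. The required length is 2 h + 8 u = 2 r + 214
    u. *)
Lemma row_bound (R : realType) (G : planar_graph R) (u al : R) (u0 : 0 < u) (al0 : 0 < al)
  (al1 : al <= 1) (st : steerable G u al) (x z : plane R) (r : R) (D : set (plane R))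
  (y : plane R) g b N n v : 0 < r -> 1000%:R * u <= r -> box x (2%:R * r) `<=` D ->
  box x (r + 6%:R * u) z -> vtx G y -> box x (r + 100%:R * u) y ->
  path (estep G setT) y g -> edge G (last y g) b -> ~ arc_set G (last y g) b `<=` D ->
  2%:R * r + 214%:R * u <= N%:R * u -> vtx G v -> core u z v ->
  row G u z D (y :: g) n (Live false v) <= 1 - al ^+ (14 * N).
Proof.
move=> r0 ur xD xz vy xy pg e nD hN vv cv.
pose h : R := r + 103%:R * u; pose k : ori := (false, false).
have hh : h = r + 103%:R * u by [].
have [zv1 zv2 zv3 zv4] := (boxP _ _ _).1 cv.
have [xz1 xz2 xz3 xz4] := (boxP _ _ _).1 xz.
have alN m : 0 <= al ^+ m by apply: exprn_ge0; exact: ltW.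
clearbody h.
have sH := run_superh u z D (y :: g) n (box x (2%:R * r)) vv.
suff : al ^+ (14 * N) <= 1 - row G u z D (y :: g) n (run G u z D (y :: g) v [::]).
  by rewrite /run /= => q1; rewrite lerBrDr addrC -lerBrDr.
have -> : al ^+ (14 * N) = 1 * al ^+ (12 * N) * al ^+ N * al ^+ N.
  by rewrite mul1r -exprD -exprD; congr (_ ^+ _); rewrite -[14%N]/(12 + 1 + 1)%N !mulnDl !mul1n.
have N1 : `|(v.1 + 6%:R * u) - cx k v| <= N%:R * u.
  rewrite /cx /= addrAC subrr add0r ger0_norm; clear -u0 hN r0; lra.
apply: (goX u0 al0 al1 st (k := k) (X := v.1 + 6%:R * u) (t := [::]) (p := v) sH vv _ isT (nearb_refl u0 v) N1).
- by rewrite !mulr_ge0.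
- move=> w /hseg_bounds[s [bs z1 z2 z3 z4]].
  apply/boxP; clear -bs z1 z2 z3 z4 zv1 zv2 zv3 zv4 xz1 xz2 xz3 xz4 u0 r0 ur.
  by case: bs => -[? ?]; split; lra.
move=> p1 t1 y1 b1 d1 w1 v1 n1.
have [f1 f2] : v.1 + 5%:R * u < cx k p1 /\ cx k p1 <= v.1 + 6%:R * u.
  move: d1 b1; rewrite ltr_norml {1}/cx /= => /andP[z1 z2] b1.
  by clear -z1 z2 b1 u0; case: b1 => -[? ?]; split; lra.
have y1' : p1.2 = v.2 := y1.
have N2 : `|(x.1 + h + 2%:R * u) - cx k p1| <= N%:R * u.
  rewrite ger0_norm; clear -f1 f2 hh hN u0 zv1 zv2 xz1 xz2 ur; lra.
apply: (goX u0 al0 al1 st (k := k) (X := x.1 + h + 2%:R * u) sH vv _ v1 n1 N2).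
- by rewrite !mulr_ge0.
- move=> w /hseg_bounds[s [bs z1 z2 z3 z4]]; rewrite y1' in z3 z4.
  rewrite /cx /= in f1 f2.
  apply/boxP; clear -z1 z2 z3 z4 bs f1 f2 hh zv1 zv2 zv3 zv4 xz1 xz2 xz3 xz4 u0 ur r0.
  by case: bs => -[? ?]; split; lra.
move=> p2 t2 y2 b2 d2 w2 v2 n2.
have y2' : p2.2 = p1.2 := y2.
have [g1 g2] : x.1 + h + u < cx k p2 /\ cx k p2 <= x.1 + h + 2%:R * u.
  move: d2 b2; rewrite ltr_norml => /andP[z1 z2] b2.
  by clear -z1 z2 b2 f1 f2 hh u0 zv1 zv2 xz1 xz2 ur; case: b2 => -[? ?]; split; lra.
have rD : ring x (h - 2%:R * u) (h + 5%:R * u) `<=` box x (2%:R * r).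
  by move=> w [_]; apply: sub_box; clear -hh ur u0; lra.
apply: (turn_rule u0 al0 al1 st (k := k) (c := x) (h := h) (N := N) sH vv ler01 v2 n2).
- by clear -hh ur u0; lra.
- by clear -hh hN u0; lra.
- have -> : cx k x = x.1 by [].
  by rewrite ger0_norm; try (apply/andP; split); clear -g1 g2 hh ur u0; lra.
- have -> : cy k p2 - cy k x = v.2 - x.2 by rewrite -y1' -y2'.
  rewrite ler_norml; apply/andP; split;
  clear -zv3 zv4 xz3 xz4 hh ur u0; lra.
- exact: rD.
move=> p3 t3 x3 y3 w3 v3 n3 td.
set T := ((t1 ++ t2) ++ t3) in v3 n3 *.
suff : run G u z D (y :: g) v T = Dead R.
  by move=> ->; rewrite /row val_lose // subr0.
(* No return is counted on the way: the first segment is never far, and from its end on the walk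
   avoids the core. *)
have nr : ~~ is_ret (run G u z D (y :: g) v T).
  rewrite /T -catA; apply: run_noret => w wt.
    apply; have /hseg_bounds[s [bs z1 z2 z3 z4]] := walk_in w1 wt.
    rewrite /cx /= in f1 f2 bs.
    apply/boxP; clear -z1 z2 z3 z4 bs f1 f2 zv1 zv2 zv3 zv4 u0.
    by case: bs => -[? ?]; split; lra.
  move: wt; rewrite mem_cat => /orP[wt|wt].
    have /hseg_bounds[s [bs z1 z2 _ _]] := walk_in w2 wt => /boxP[c1 c2 _ _].
    rewrite /cx /= in f1 f2 g1 g2 bs.
    by clear -z1 z2 bs f1 f2 g1 g2 c1 c2 zv1 zv2 hh xz1 xz2 u0 ur; case: bs => -[? ?]; lra.
  have [nb _] := walk_in w3 wt => cw; apply: nb.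
  by apply: (box_sub xz _ cw); clear -hh u0; lra.
suff : not_live (run G u z D (y :: g) v T) by move: nr; case: (run _ _ _ _ _ _ _).
have [||||k' hk] := crossed_by_exit (a := h - 2%:R * u) (b := h + 2%:R * u) (c := x) _ _ vy pg
  (wtrace_head pg) _ e nD _.
- by clear -hh u0 r0; lra.
- by clear -u0; lra.
- by move=> k'; apply: box_cy_le; apply: sub_box xy; clear -hh u0; lra.
- by apply: subset_trans xD; apply: sub_box; clear -hh ur u0; lra.
have [w [wt [nb _] wg]] := hk _ _ (subset_trans rD xD) (td k').
suff wT : w \in T by apply: run_hit wT wg.
(* [run] does not test its initial vertex v, but v lies inside the inner box of the ring and cannot
   be the vertex met. *)
have : w \in v :: T.
  move: wt; rewrite inE => /orP[/eqP ->|wt]; last by rewrite inE mem_cat wt !orbT.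
  have := mem_last v (t1 ++ t2); rewrite inE => /orP[/eqP ->|h']; first by rewrite mem_head.
  by rewrite inE mem_cat h' orbT.
rewrite inE => /orP[/eqP ev|//]; case: nb; rewrite ev.
by apply: (box_sub xz _ cv); clear -hh u0; lra.
Qed.

(** * The loop-erasure meets a crossing path *)

Section LoopErasure.
Variable (T : eqType).
Implicit Types (x v w : T) (g s t : seq T) (P : pred T).

Definition lestep g v := rcons (take (index v g) g) v.
Definition les g t := foldl lestep g t.

Lemma loop_erasureE x t : loop_erasure (x :: t) = les [:: x] t.
Proof. by []. Qed.

Lemma les_cat g s t : les g (s ++ t) = les (les g s) t.
Proof. exact: foldl_cat. Qed.

Lemma les_rcons g t v : les g (rcons t v) = lestep (les g t) v.
Proof. by rewrite -cats1 les_cat. Qed.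

Lemma lestep_uniq g v : uniq g -> uniq (lestep g v).
Proof.
move=> ug; rewrite /lestep rcons_uniq take_uniq // andbT.
by apply/negP => /index_ltn; rewrite ltnn.
Qed.

Lemma les_uniq g t : uniq g -> uniq (les g t).
Proof. by elim: t g => //= v t IH g ug; apply: IH; exact: lestep_uniq. Qed.

Lemma last_les x g t : last x (les g t) = last (last x g) t.
Proof. by elim: t g => //= v t IH g; rewrite IH /lestep last_rcons. Qed.

Lemma all_take P n s : all P s -> all P (take n s).
Proof. by rewrite -{1}(cat_take_drop n s) all_cat => /andP[]. Qed.

Lemma all_lestep P g v : all P g -> P v -> all P (lestep g v).
Proof. by move=> ag Pv; rewrite /lestep all_rcons Pv all_take. Qed.

Lemma all_les P g t : all P g -> all P t -> all P (les g t).
Proof.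
elim: t g => //= v t IH g ag /andP[Pv at']; apply: IH => //; exact: all_lestep.
Qed.

(** Only a visit to g0 can erase a part of it. *)
Lemma les_prefix g0 g1 t : {in t, forall v, v \notin g0} ->
  exists g2, les (g0 ++ g1) t = g0 ++ g2.
Proof.
elim: t g1 => [|v t IH] g1 h; first by exists g1.
have vg : v \notin g0 by apply: h; rewrite mem_head.
rewrite /= /lestep index_cat (negbTE vg) take_cat ltnNge leq_addr /= addKn rcons_cat.
by apply: IH => w wt; apply: h; rewrite inE wt orbT.
Qed.

Lemma les_path (e : rel T) x t : path e x t ->
  exists2 p, les [:: x] t = x :: p & path e x p.
Proof.
elim/last_ind: t => [|t v IH]; first by exists [::].
rewrite rcons_path => /andP[pt ev]; have [p ep pp] := IH pt.
rewrite les_rcons ep /lestep.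
have lp : last x p = last x t.
  by have := last_les x [:: x] t; rewrite ep.
rewrite /=; case: eqP => [<-|_]; first by exists [::].
exists (rcons (take (index v p) p) v) => //.
have [vp|vp] := boolP (v \in p).
  have := pp; rewrite -{1}(cat_take_drop (index v p).+1 p) cat_path => /andP[+ _].
  by rewrite (take_nth v) ?index_mem // nth_index.
by rewrite memNindex // take_size rcons_path pp lp.
Qed.

(* Once the walk, confined to P', meets the part g0 of the loop-erasure lying in
   the smaller region P, the loop-erasure is entirely contained in P'. *)
Lemma les_clean P P' g0 g1 s t : {subset P <= P'} -> all P g0 ->
  all (predC P) s -> all P' t -> has (mem g0) (s ++ t) -> all P' (les (g0 ++ g1) (s ++ t)).
Proof.
move=> PP a0 as' at' hm; rewrite les_cat.
have [g2 ->] : exists g2, les (g0 ++ g1) s = g0 ++ g2.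
  apply: les_prefix => v vs; apply/negP => vg.
  by have := allP as' v vs; rewrite /= (allP a0 v vg).
have ht : has (mem g0) t.
  have /hasP[v] := hm; rewrite mem_cat => /orP[vs|vt] vg; last by apply/hasP; exists v.
  by have := allP as' v vs; rewrite /= (allP a0 v vg).
have [t1 [w [t2 [et wg nt]]]] : exists t1 w t2, [/\ t = t1 ++ w :: t2, w \in g0 &
    {in t1, forall v, v \notin g0}].
  elim: t {at' hm} ht => //= v t IH; have [vg _|vg /= /IH[t1 [w [t2 [-> wg n1]]]]] := boolP (v \in g0).
    by exists [::], v, t.
  exists (v :: t1), w, t2; split => // x; rewrite inE => /orP[/eqP ->//|]; exact: n1.
rewrite et les_cat; have [g3 ->] := les_prefix g2 nt.
move: at'; rewrite et all_cat /= => /and3P[_ Pw a2]; apply: all_les => //.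
rewrite /lestep index_cat wg take_cat index_mem wg all_rcons Pw /=.
by apply: all_take; apply: sub_all a0 => x; exact: PP.
Qed.

End LoopErasure.

Lemma wtrace_right (R : realType) (G : planar_graph R) (v : plane R) (t : seq (plane R)) z : path (estep G setT) v t -> t <> [::] -> wtrace G v t z ->
  exists a b, [/\ b \in t, edge G a b & arc_set G a b z].
Proof.
elim: t v => [|x t IH] v //= /andP[/estepP[/wt_edge e _] p] _ [zx|zt].
  by exists v, x; rewrite mem_head.
case: t IH p zt => [|x' t] IH p zt.
  by exists v, x; rewrite mem_head; split => //; rewrite zt; exact: arc_set_r.
have [//|a [b [bt e' ab]]] := IH x p _ zt.
by exists a, b; split => //; rewrite inE bt orbT.
Qed.

(* The loop-erasure, which starts in the box of size 13u and ends beyond 20u,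
   crosses the strip 15u < cy < 18u from left to right; this happens before it
   first reaches abscissa 20u, hence inside the box of size 26u. *)
Lemma le_crosses (R : realType) (G : planar_graph R) (u : R) (u0 : 0 < u)
  (shortE : forall a b, edge G a b -> arc_set G a b `<=` box a (u / 8%:R))
  k (y : plane R) (l t p : seq (plane R)) : vtx G y ->
  (forall V vs, side_walk G V k y (15%:R * u) (18%:R * u) vs ->
     exists w, [/\ w \in vs, V w & w \in l]) ->
  path (estep G setT) y p -> 20%:R * u <= cx k (last y p) - cx k y ->
  (forall w, w \in y :: p -> box y (13%:R * u) w \/ w \in t) ->
  (forall w, w \in t -> [\/ cy k w - cy k y <= 14%:R * u /\ cx k w - cx k y < 20%:R * u, cx k w - cx k y <= - (20%:R * u) |
      63%:R / 4%:R * u <= cy k w - cy k y <= 69%:R / 4%:R * u]) ->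
  (forall w, w \in t -> cx k w - cx k y < 20%:R * u -> box y (25%:R * u) w) ->
  exists g0 g1 w, [/\ y :: p = g0 ++ g1, w \in g0, w \in l &
    forall x, x \in g0 -> box y (26%:R * u) x].
Proof.
move=> vy hl pp lp hp ht1 ht2.
pose Zr w := 20%:R * u <= cx k w - cx k y.
pose Zl w := (cy k w - cy k y <= 14%:R * u) || (cx k w - cx k y <= - (20%:R * u)).
have bx w a : box y a w -> [/\ - a < cx k w - cx k y, cx k w - cx k y < a,
    - a < cy k w - cy k y & cy k w - cy k y < a].
  by move=> /(box_ori k)[]; rewrite !ltr_norml => /andP[? ?] /andP[? ?].
have bx' w a : [/\ - a < cx k w - cx k y, cx k w - cx k y < a,
    - a < cy k w - cy k y & cy k w - cy k y < a] -> box y a w.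
  by move=> [h1 h2 h3 h4]; apply/(box_ori k); rewrite !ltr_norml h1 h2 h3 h4.
have nZr : ~~ Zr y by rewrite /Zr subrr -ltNge mulr_gt0.
have ly : Zl y by rewrite /Zl subrr; apply/orP; left; rewrite mulr_ge0 // ltW.
have hasZ : has Zr p.
  apply/hasP; exists (last y p) => //.
  have := mem_last y p; rewrite inE => /orP[/eqP e|//].
  by move: lp nZr; rewrite /Zr e => ->.
have [t1 [x [s2 [ep Zx nt pt]]]] := path_first_in pp nZr hasZ.
have [y' [t' [Zy' nt' pt' lt' sub]]] := path_last_in pt ly.
rewrite last_rcons in lt'.
have mem_p w : w \in y :: rcons t1 x -> w \in y :: p.
  by rewrite ep !inE mem_cat => /orP[->//|->]; rewrite orbT.
(* Tubes of margin u / 4 around heights between 16 u and 17 u; the u / 8 of an arc keeps the traces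
   between 15 u and 18 u. *)
have mid w : w \in y :: rcons t1 x -> ~~ Zl w ->
    63%:R / 4%:R * u <= cy k w - cy k y <= 69%:R / 4%:R * u.
  move=> /mem_p/hp hw; rewrite /Zl negb_or -!ltNge => /andP[z1 z2].
  case: hw => [/bx[_ _ _ h4]|/ht1[[h _]|h|//]].
  - by exfalso; clear -z1 h4 u0; lra.
  - by exfalso; clear -z1 h u0; lra.
  - by exfalso; clear -z2 h u0; lra.
have step_close a b w : edge G a b -> arc_set G a b w ->
    `|cx k w - cx k b| < u / 8%:R /\ `|cy k w - cy k b| < u / 8%:R.
  by move=> e; rewrite -(arc_rev e) => /(shortE _ _ (edgeC e))/(box_ori k).
have nx : ~~ Zl x.
  have hx : x \in y :: rcons t1 x by rewrite inE mem_rcons mem_head orbT.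
  rewrite /Zl negb_or -!ltNge; rewrite /Zr in Zx; apply/andP; split; last by clear -Zx u0; lra.
  have [/bx[_ h2 _ _]|xt] := hp x (mem_p x hx); first by exfalso; clear -Zx h2 u0; lra.
  case: (ht1 x xt) => [[_ h]|h|/andP[h _]].
  - by exfalso; clear -Zx h u0; lra.
  - by exfalso; clear -Zx h u0; lra.
  - by clear -h u0; lra.
have tn : t' <> [::] by move=> e; move: lt' nx; rewrite e /= => <-; rewrite Zy'.
have mid' w : w \in t' -> 63%:R / 4%:R * u <= cy k w - cy k y <= 69%:R / 4%:R * u.
  move=> wt; apply: mid; first by apply: sub; rewrite inE wt orbT.
  exact: (allP nt' w wt).
(* The vertex after y' is at height at least 63 u / 4 and an edge moves by less than u / 8, so y' is
   not below 14 u and is on the left. *)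
have cy' : cx k y' - cx k y <= - (20%:R * u).
  move: pt' mid' Zy'; rewrite /Zl; case: (t') tn => // w1 t2 _ /= /andP[/estepP[/wt_edge e _] _] md.
  have /andP[m1 _] := md w1 (mem_head _ _).
  have [_] := step_close _ _ _ e (arc_set_l e); rewrite ltr_norml => /andP[z1 z2].
  by case/orP => // h; exfalso; clear -z1 z2 m1 h u0; lra.
have sw : side_walk G setT k y (15%:R * u) (18%:R * u) (y :: rcons t1 x).
  exists y', t'; split => //.
    have py : path (estep G setT) y (rcons t1 x) := pt.
    by apply: (walk_vtx py vy); apply: sub; exact: mem_head.
  split; [exact: wtrace_connected|exact: wtrace_compact| |].
    move=> w /(wtrace_right pt' tn)[a [b [bt e ab]]].
    have /andP[m1 m2] := mid' b bt; have [_] := step_close _ _ _ e ab.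
    by rewrite ltr_norml => /andP[z1 z2]; apply/andP; clear -m1 m2 z1 z2 u0; split; lra.
  exists y', x; split.
  - exact: wtrace_head.
  - by apply: wtrace_vtx => //; rewrite -lt'; exact: mem_last.
  - by clear -cy' u0; lra.
  - by move: Zx; rewrite /Zr => h; clear -h u0; lra.
have [w [wv _ wl]] := hl _ _ sw.
exists (y :: rcons t1 x), s2, w; split => //; first by rewrite ep.
move=> w' hw'; have [hb|hZ] := boolP (Zr w'); last first.
  have [b13|wt] := hp w' (mem_p w' hw').
    by apply: sub_box b13; clear -u0; lra.
  apply: (@sub_box _ y (25%:R * u)); first by clear -u0; lra.
  by apply: ht2 => //; rewrite ltNge.
have ew : w' = x.
  move: hw'; rewrite -rcons_cons mem_rcons inE => /orP[/eqP //|h].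
  by have := allP nt w' h; rewrite /= hb.
rewrite ew; have /andP[m1 m2] : 63%:R / 4%:R * u <= cy k x - cy k y <= 69%:R / 4%:R * u.
  by apply: mid => //; rewrite inE mem_rcons mem_head orbT.
move: pt; rewrite rcons_path => /andP[_ /estepP[/wt_edge e _]].
have [] := step_close _ _ _ e (arc_set_l e); rewrite !ltr_norml => /andP[z1 z2] _.
have := allP nt (last y t1) (mem_last y t1); rewrite /= /Zr -ltNge => z3.
move: Zx; rewrite /Zr => z4.
by apply: bx'; clear -m1 m2 z1 z2 z3 z4 u0; split; lra.
Qed.

Lemma hsegP (R : realType) (u : R) k (p w : plane R) (X : R) : hseg u k p X w ->
  exists s, [/\ btw (cx k p) s X, s - u / 4%:R <= cx k w, cx k w <= s + u / 4%:R,
    cy k p - u / 4%:R <= cy k w & cy k w <= cy k p + u / 4%:R].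
Proof.
move=> [[s [b h1]] h2]; move: h1 h2; rewrite !ler_norml.
move=> /andP[z1 z2] /andP[z3 z4]; exists s.
by split => //; clear -z1 z2 z3 z4; lra.
Qed.

Lemma vsegP (R : realType) (u : R) k (p w : plane R) (Y : R) : vseg u k p Y w ->
  exists s, [/\ btw (cy k p) s Y, s - u / 4%:R <= cy k w, cy k w <= s + u / 4%:R,
    cx k p - u / 4%:R <= cx k w & cx k w <= cx k p + u / 4%:R].
Proof.
move=> [[s [b h1]] h2]; move: h1 h2; rewrite !ler_norml.
move=> /andP[z1 z2] /andP[z3 z4]; exists s.
by split => //; clear -z1 z2 z3 z4; lra.
Qed.

Lemma box_oriP (R : realType) k (c w : plane R) (a : R) : box c a w <->
  [/\ cx k c - a < cx k w, cx k w < cx k c + a, cy k c - a < cy k w & cy k w < cy k c + a].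
Proof.
split=> [/(box_ori k)[]|[z1 z2 z3 z4]].
  rewrite !ltr_norml => /andP[z1 z2] /andP[z3 z4].
  by clear -z1 z2 z3 z4; split; lra.
by apply/(box_ori k); rewrite !ltr_norml; clear -z1 z2 z3 z4; split; apply/andP; split; lra.
Qed.

Lemma hseg_sub_box (R : realType) (u : R) k (c p : plane R) (X a : R) :
  cx k c - a < cx k p - u / 4%:R -> cx k p + u / 4%:R < cx k c + a ->
  cx k c - a < X - u / 4%:R -> X + u / 4%:R < cx k c + a ->
  cy k c - a < cy k p - u / 4%:R -> cy k p + u / 4%:R < cy k c + a ->
  hseg u k p X `<=` box c a.
Proof.
move=> z1 z2 z3 z4 z5 z6 w /hsegP[s [b y1 y2 y3 y4]]; apply/(box_oriP k).
by clear -z1 z2 z3 z4 z5 z6 b y1 y2 y3 y4; case: b => -[? ?]; split; lra.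
Qed.

Lemma vseg_sub_box (R : realType) (u : R) k (c p : plane R) (Y a : R) :
  cy k c - a < cy k p - u / 4%:R -> cy k p + u / 4%:R < cy k c + a ->
  cy k c - a < Y - u / 4%:R -> Y + u / 4%:R < cy k c + a ->
  cx k c - a < cx k p - u / 4%:R -> cx k p + u / 4%:R < cx k c + a ->
  vseg u k p Y `<=` box c a.
Proof.
move=> z1 z2 z3 z4 z5 z6 w /vsegP[s [b y1 y2 y3 y4]]; apply/(box_oriP k).
by clear -z1 z2 z3 z4 z5 z6 b y1 y2 y3 y4; case: b => -[? ?]; split; lra.
Qed.

(** Brings one coordinate within 12 u of that of c without visiting the box of size 10 u, by
    stopping between 11 u and 12 u; nothing is done when it is already within 11 u. The part of the
    loop-erasure lying in that box must not be touched on the approach. *)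
Lemma clamp_rule (R : realType) (G : planar_graph R) (u al : R) (u0 : 0 < u) (al0 : 0 < al)
  (al1 : al <= 1) (st : steerable G u al) (v0 : plane R) (U : set (plane R))
  (H : seq (plane R) -> R) N k (c p : plane R) (t : seq (plane R)) (m : R) :
  superh G v0 U H -> vtx G v0 -> 0 <= m -> path (estep G U) v0 t -> nearb u p (last v0 t) ->
  90%:R <= N%:R :> R -> box c (31%:R * u) `<=` U -> box c (27%:R * u) p ->
  (forall p' t', cy k p' = cy k p -> `|cx k p' - cx k c| <= 12%:R * u ->
     (forall w, w \in t' -> ~ box c (10%:R * u) w) ->
     (box c (11%:R * u) p -> t' = [::] /\ p' = p) ->
     path (estep G U) v0 (t ++ t') -> nearb u p' (last v0 (t ++ t')) -> m <= H (t ++ t')) ->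
  m * al ^+ N <= H t.
Proof.
move=> sH vv m0 pt np hN cU /(box_oriP k)[b1 b2 b3 b4] hm.
have alN : 0 <= al ^+ N by apply: exprn_ge0; exact: ltW.
have Nu : 90%:R * u <= N%:R * u by rewrite ler_wpM2r // ltW.
have [small|big] := lerP `|cx k p - cx k c| (11%:R * u).
  apply: (@le_trans _ _ m).
    by rewrite ler_piMr // exprn_ile1 // ltW.
  rewrite -[t]cats0; apply: (hm p) => //; rewrite ?cats0 //.
  by clear -small u0; lra.
have bnd (X : R) : cx k c - 12%:R * u <= X -> X <= cx k c + 12%:R * u ->
    `|X - cx k p| <= N%:R * u /\ hseg u k p X `<=` U.
  move=> z1 z2; split.
    by rewrite ler_norml; apply/andP; clear -z1 z2 b1 b2 Nu u0; split; lra.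
  apply: subset_trans cU; apply: (hseg_sub_box (k := k));
  by clear -z1 z2 b1 b2 b3 b4 u0; lra.
have nb11 : ~ box c (11%:R * u) p.
  by move=> /(box_ori k)[z _]; clear -z big; lra.
move: big; rewrite ltr_normr => /orP[] big.
  have [||c1 c2] := bnd (cx k c + 11%:R * u); try by clear -u0; lra.
  apply: (goX u0 al0 al1 st (k := k) (X := cx k c + 11%:R * u) sH vv m0 pt np c1 c2).
  move=> p1 t1 y1 bt d1 w1 v1 n1.
  have [f1 f2] : cx k c + 11%:R * u <= cx k p1 /\ cx k p1 <= cx k c + 12%:R * u.
    move: d1; rewrite ltr_norml => /andP[z1 z2].
    by clear -z1 z2 bt big u0; case: bt => -[? ?]; split; lra.
  apply: (hm p1) => //.
    by rewrite ler_norml; apply/andP; clear -f1 f2 u0; split; lra.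
  move=> w wt; have /hsegP[s [bs z1 z2 _ _]] := walk_in w1 wt.
  move=> /(box_oriP k)[_ z3 _ _].
  by clear -bs z1 z2 z3 f1 f2 big u0; case: bs => -[? ?]; lra.
have [||c1 c2] := bnd (cx k c - 11%:R * u); try by clear -u0; lra.
apply: (goX u0 al0 al1 st (k := k) (X := cx k c - 11%:R * u) sH vv m0 pt np c1 c2).
move=> p1 t1 y1 bt d1 w1 v1 n1.
have [f1 f2] : cx k p1 <= cx k c - 11%:R * u /\ cx k c - 12%:R * u <= cx k p1.
  move: d1; rewrite ltr_norml => /andP[z1 z2].
  by clear -z1 z2 bt big u0; case: bt => -[? ?]; split; lra.
apply: (hm p1) => //.
  by rewrite ler_norml; apply/andP; clear -f1 f2 u0; split; lra.
move=> w wt; have /hsegP[s [bs z1 z2 _ _]] := walk_in w1 wt.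
move=> /(box_oriP k)[z3 _ _ _].
by clear -bs z1 z2 z3 f1 f2 big u0; case: bs => -[? ?]; lra.
Qed.

(* The part g0 of the loop-erasure meeting l is only erased if the walk comes back
   to the box of size 26u. *)
Definition robust (R : realType) (u : R) (y : plane R) (l g : seq (plane R)) :=
  exists g0 g1 w, [/\ g = g0 ++ g1, w \in g0, w \in l &
    forall x, x \in g0 -> box y (26%:R * u) x].

(** Eight segments and a turn, hence 20 * N. The trajectory has three parts: [ta] approaches y
    outside the box of size 10 u, [tb] turns around y and thereby erases all that lies beyond the
    box of size 13 u, and [tc] draws a fresh arc to the left, up, and across side k at height about
    17 u, which is where the path l must be met. The end near abscissa 30 u is the starting point of
    [esc_harnack]. *)
Lemma robust_rule (R : realType) (G : planar_graph R) (u al : R) (u0 : 0 < u) (al0 : 0 < al)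
  (al1 : al <= 1) (st : steerable G u al)
  (shortE : forall a b, edge G a b -> arc_set G a b `<=` box a (u / 8%:R))
  (y : plane R) (t0 : seq (plane R)) (H : seq (plane R) -> R) N k (l : seq (plane R)) (m : R) :
  90%:R <= N%:R :> R -> vtx G y ->
  (forall V vs, side_walk G V k y (15%:R * u) (18%:R * u) vs ->
     exists w, [/\ w \in vs, V w & w \in l]) ->
  path (estep G setT) y t0 -> box y (26%:R * u) (last y t0) -> 0 <= m ->
  superh G (last y t0) (box y (31%:R * u)) H ->
  (forall p' t', path (estep G (box y (31%:R * u))) (last y t0) t' ->
     29%:R * u < cx k p' - cx k y <= 30%:R * u -> 16%:R * u < cy k p' - cy k y <= 17%:R * u ->
     nearb u p' (last (last y t0) t') ->
     robust u y l (les [:: y] (t0 ++ t')) -> m <= H t') ->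
  m * al ^+ (20 * N) <= H [::].
Proof.
move=> N90 vy hl p0 b0 m0 sH hm.
have vv0 : vtx G (last y t0) by apply: (walk_vtx p0 vy); exact: mem_last.
set v0 := last y t0 in b0 sH hm vv0 *.
pose k' : ori := (~~ k.1, k.2).
have E (a b : R) : `|- a - - b| = `|a - b| by rewrite opprK addrC distrC.
have exy w : `|cy k w - cy k y| = `|cx k' w - cx k' y|.
  by rewrite /cy /cx /k' /=; case: (k) => [[] []] //=; rewrite ?E.
have eyx w : `|cx k w - cx k y| = `|cy k' w - cy k' y|.
  by rewrite /cy /cx /k' /=; case: (k) => [[] []] //=; rewrite ?E.
have Nu : 90%:R * u <= N%:R * u by rewrite ler_wpM2r // ltW.
have alN n : 0 <= al ^+ n by apply: exprn_ge0; exact: ltW.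
have -> : al ^+ (20 * N) = al ^+ N * al ^+ N * al ^+ N * al ^+ N * al ^+ (12 * N) *
    al ^+ N * al ^+ N * al ^+ N * al ^+ N.
  by rewrite -[20%N]/(1 + 1 + 1 + 1 + 12 + 1 + 1 + 1 + 1)%N !mulnDl !mul1n !exprD.
rewrite !mulrA.
have b27 : box y (27%:R * u) v0 by apply: sub_box b0; clear -u0; lra.
apply: (clamp_rule u0 al0 al1 st (k := k) (c := y) (p := v0) (t := [::]) sH vv0 _ isT (nearb_refl u0 v0) N90 (@subset_refl _ _) b27).
  by rewrite !mulr_ge0.
move=> p1 s1 y1 x1 av1 nil1 v1 n1 /=; rewrite /= in v1 n1.
have b271 : box y (27%:R * u) p1.
  apply/(box_ori k); split; first by clear -x1 u0; lra.
  by rewrite y1; move/(box_ori k): b27 => [].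
apply: (clamp_rule u0 al0 al1 st (k := k') (c := y) (p := p1) (t := s1) sH vv0 _ v1 n1 N90 (@subset_refl _ _) b271).
  by rewrite !mulr_ge0.
move=> p2 s2 y2 x2 av2 nil2 v2 n2.
have X2 : `|cx k p2 - cx k y| <= 12%:R * u by rewrite eyx y2 -eyx.
have Y2 : `|cy k p2 - cy k y| <= 12%:R * u by rewrite exy.
have {nil1 nil2} nil12 : box y (10%:R * u) v0 -> s1 ++ s2 = [::].
  move=> bv; have bv1 : box y (11%:R * u) v0 by apply: sub_box bv; clear -u0; lra.
  by have [-> e1] := nil1 bv1; rewrite e1 in nil2; have [-> _] := nil2 bv1.
have av w : w \in s1 ++ s2 -> ~ box y (10%:R * u) w.
  by rewrite mem_cat => /orP[/av1|/av2].
move: (X2) (Y2); rewrite !ler_norml => /andP[X2a X2b] /andP[Y2a Y2b].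
clear av1 av2 y1 x1 y2 x2 v1 n1 b271.
set ta := s1 ++ s2 in v2 n2 nil12 av *.
have N3 : `|cy k y + 5%:R * u - cy k p2| <= N%:R * u.
  by rewrite ler_norml; apply/andP; clear -Nu Y2a Y2b u0; split; lra.
apply: (goY u0 al0 al1 st (k := k) (Y := cy k y + 5%:R * u) sH vv0 _ v2 n2 N3).
- by rewrite !mulr_ge0.
- by apply: (vseg_sub_box (k := k)); clear -X2a X2b Y2a Y2b u0; lra.
move=> p3 s3 x3 bt3 d3 w3 v3 n3.
have [Y3a Y3b] : 4%:R * u < cy k p3 - cy k y /\ cy k p3 - cy k y < 6%:R * u.
  by move: d3; rewrite ltr_norml => /andP[z1 z2]; clear -z1 z2 u0; split; lra.
have in3 : vseg u k p2 (cy k p3) `<=` box y (13%:R * u).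
  by apply: (vseg_sub_box (k := k)); clear -X2a X2b Y2a Y2b Y3a Y3b u0; lra.
clear bt3 d3.
have N4 : `|cx k y + 8%:R * u - cx k p3| <= N%:R * u.
  by rewrite ler_norml x3; apply/andP; clear -Nu X2a X2b u0; split; lra.
apply: (goX u0 al0 al1 st (k := k) (X := cx k y + 8%:R * u) sH vv0 _ v3 n3 N4).
- by rewrite !mulr_ge0.
- by apply: (hseg_sub_box (k := k)); rewrite ?x3; clear -X2a X2b Y3a Y3b u0; lra.
move=> p4 s4 y4 bt4 d4 w4 v4 n4.
have [X4a X4b] : 7%:R * u < cx k p4 - cx k y /\ cx k p4 - cx k y < 9%:R * u.
  by move: d4; rewrite ltr_norml => /andP[z1 z2]; clear -z1 z2 u0; split; lra.
have in4 : hseg u k p3 (cx k p4) `<=` box y (13%:R * u).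
  by apply: (hseg_sub_box (k := k)); rewrite ?x3; clear -X2a X2b X4a X4b Y3a Y3b u0; lra.
clear bt4 d4.
have ringU : ring y (5%:R * u - 2%:R * u) (5%:R * u + 5%:R * u) `<=` box y (31%:R * u).
  by move=> w [_]; apply: sub_box; clear -u0; lra.
apply: (turn_rule u0 al0 al1 st (k := k) (c := y) (h := 5%:R * u) (N := N) sH vv0 _ v4 n4).
- by rewrite !mulr_ge0.
- by clear -u0; lra.
- by clear -u0 Nu; lra.
- by rewrite ger0_norm; try (apply/andP; split); clear -X4a X4b u0; lra.
- by rewrite y4 ler_norml; apply/andP; clear -Y3a Y3b u0; split; lra.
- exact: ringU.
move=> p5 s5 Y5 X5 w5 v5 n5 td.
move: Y5 X5; rewrite !ler_norml => /andP[Y5a Y5b] /andP[X5a X5b].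
have N6 : `|cx k y - 24%:R * u - cx k p5| <= N%:R * u.
  by rewrite ler_norml; apply/andP; clear -Nu X5a X5b u0; split; lra.
apply: (goX u0 al0 al1 st (k := k) (X := cx k y - 24%:R * u) sH vv0 _ v5 n5 N6).
- by rewrite !mulr_ge0.
- by apply: (hseg_sub_box (k := k)); clear -X5a X5b Y5a Y5b u0; lra.
move=> p6 s6 y6 bt6 d6 w6 v6 n6.
have [X6a X6b] : - (24%:R * u) <= cx k p6 - cx k y /\ cx k p6 - cx k y < - (23%:R * u).
  move: d6; rewrite ltr_norml => /andP[z1 z2].
  by clear -z1 z2 bt6 X5a u0; case: bt6 => -[? ?]; split; lra.
clear bt6 d6.
have N7 : `|cy k y + 17%:R * u - cy k p6| <= N%:R * u.
  by rewrite ler_norml y6; apply/andP; clear -Nu Y5a Y5b u0; split; lra.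
apply: (goY u0 al0 al1 st (k := k) (Y := cy k y + 17%:R * u) sH vv0 _ v6 n6 N7).
- by rewrite !mulr_ge0.
- by apply: (vseg_sub_box (k := k)); rewrite ?y6; clear -X6a X6b Y5a Y5b u0; lra.
move=> p7 s7 x7 bt7 d7 w7 v7 n7.
have [Y7a Y7b] : 16%:R * u < cy k p7 - cy k y /\ cy k p7 - cy k y <= 17%:R * u.
  move: d7; rewrite ltr_norml => /andP[z1 z2]; rewrite y6 in bt7.
  by clear -z1 z2 bt7 Y5b u0; case: bt7 => -[? ?]; split; lra.
clear bt7 d7.
have N8 : `|cx k y + 24%:R * u - cx k p7| <= N%:R * u.
  by rewrite ler_norml x7; apply/andP; clear -Nu X6a X6b u0; split; lra.
apply: (goX u0 al0 al1 st (k := k) (X := cx k y + 24%:R * u) sH vv0 _ v7 n7 N8).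
- by rewrite !mulr_ge0.
- by apply: (hseg_sub_box (k := k)); rewrite ?x7; clear -X6a X6b Y7a Y7b u0; lra.
move=> p8 s8 y8 bt8 d8 w8 v8 n8.
have [X8a X8b] : 23%:R * u < cx k p8 - cx k y /\ cx k p8 - cx k y <= 24%:R * u.
  move: d8; rewrite ltr_norml => /andP[z1 z2]; rewrite x7 in bt8.
  by clear -z1 z2 bt8 X6b u0; case: bt8 => -[? ?]; split; lra.
clear bt8 d8.
have N9 : `|cx k y + 30%:R * u - cx k p8| <= N%:R * u.
  by rewrite ler_norml; apply/andP; clear -Nu X8a X8b u0; split; lra.
apply: (goX u0 al0 al1 st (k := k) (X := cx k y + 30%:R * u) sH vv0 _ v8 n8 N9).
- by [].
- by apply: (hseg_sub_box (k := k)); rewrite ?y8; clear -X8a X8b Y7a Y7b u0; lra.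
move=> p9 s9 y9 bt9 d9 w9 v9 n9.
have [X9a X9b] : 29%:R * u < cx k p9 - cx k y /\ cx k p9 - cx k y <= 30%:R * u.
  move: d9; rewrite ltr_norml => /andP[z1 z2].
  by clear -z1 z2 bt9 X8b u0; case: bt9 => -[? ?]; split; lra.
clear bt9 d9 N3 N4 N6 N7 N8 N9.
apply: (hm p9 _ v9) => //.
- by apply/andP.
- by rewrite y9 y8; apply/andP.
clear hm sH alN N90 Nu m0.
set tb := s3 ++ s4 ++ s5; set tc := s6 ++ s7 ++ s8 ++ s9.
have TE : (((((((ta ++ s3) ++ s4) ++ s5) ++ s6) ++ s7) ++ s8) ++ s9) = (ta ++ tb) ++ tc.
  by rewrite /tb /tc !catA.
rewrite TE in v9 n9 *.
have pT : path (estep G setT) y (t0 ++ (ta ++ tb) ++ tc).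
  by rewrite cat_path p0; exact: sub_walk v9.
have [p ep pp] := les_path pT.
have [pg eg ppg] := les_path p0.
have ug : uniq (y :: pg) by rewrite -eg; exact: les_uniq.
have lg : last y pg = v0.
  by have := last_les y [:: y] t0; rewrite eg.
have lp : last y p = last v0 ((ta ++ tb) ++ tc).
  by have := last_les y [:: y] (t0 ++ (ta ++ tb) ++ tc); rewrite ep last_cat.
pose P1 w := `[< box y (10%:R * u) w >]; pose P' w := `[< box y (13%:R * u) w >].
have PP : {subset P1 <= P'}.
  move=> w; rewrite /P1 /P' /in_mem /= => /asboolP h; apply/asboolP.
  by apply: sub_box h; clear -u0; lra.
have ring10 w : ring y (5%:R * u - 2%:R * u) (5%:R * u + 5%:R * u) w -> box y (10%:R * u) w.
  by move=> [_]; apply: sub_box; clear -u0; lra.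
have tbP : all P' tb.
  rewrite /tb !all_cat; apply/and3P; split; apply/allP => w wt; apply/asboolP.
  - by apply: in3; exact: walk_in w3 wt.
  - by apply: in4; exact: walk_in w4 wt.
  - by apply: sub_box (ring10 w (walk_in w5 wt)); clear -u0; lra.
have clean : all P' (les (y :: pg) (ta ++ tb)).
  (* If the loop-erasure stays in the box of size 10 u, so does its last vertex v0 and [ta] is
     empty. Otherwise it contains a path from y out of that box, which the turn meets. *)
  have [allP1|notP1] := boolP (all P1 (y :: pg)).
    have v0g : v0 \in y :: pg by rewrite -lg mem_last.
    rewrite nil12; last by have := allP allP1 v0 v0g => /asboolP.
    by apply: all_les => //; apply: sub_all allP1 => w; exact: PP.
  have yP : P1 y by apply/asboolP; split; rewrite subrr normr0 mulr_gt0.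
  have yP1 : ~~ predC P1 y by rewrite /= yP.
  have hasP1 : has (predC P1) pg by move: notP1; rewrite /= yP /= has_predC.
  have [t1 [x [s2' [ex nx nt pt]]]] := path_first_in ppg yP1 hasP1.
  have nx10 : ~ box y (10%:R * u) x by move: nx => /asboolPn.
  have aP1 : all P1 (y :: t1) by apply: sub_all nt => w; rewrite /= negbK.
  rewrite ex -cats1 -catA -cat_cons; apply: (les_clean (P := P1)) => //.
    by apply/allP => w /av h; apply/asboolPn.
  have [|||||k'' hk] := crossed_by_walk (a := 5%:R * u - 2%:R * u) (b := 5%:R * u + 2%:R * u)
     (c := y) _ _ vy pt (wtrace_head pt) _ (wtrace_vtx pt (w := x) _) _.
  - by clear -u0; lra.
  - by clear -u0; lra.
  - by move=> ?; rewrite subrr; clear -u0; lra.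
  - by rewrite inE mem_rcons mem_head orbT.
  - by move=> h; apply: nx10; apply: sub_box h; clear -u0; lra.
  have [w [wt rw wy]] := hk _ _ (td k'').
  have wg : w \in y :: t1.
    move: wy; rewrite -rcons_cons mem_rcons inE => /orP[/eqP e|//].
    by case: nx10; rewrite -e; exact: ring10.
  apply/hasP; exists w => //.
  move: wt; rewrite inE => /orP[/eqP ew|ws]; last by rewrite /tb !mem_cat ws !orbT.
  have := mem_last v0 ((ta ++ s3) ++ s4); rewrite -ew inE => /orP[/eqP ev|].
    move: ug; rewrite ex -cats1 -catA -cat_cons cat_uniq => /and3P[_ /hasPn nh _].
    have := nh w; rewrite -ev in lg => /(_ _)/negP; case => //.
    by rewrite -lg ex last_cat last_rcons /= mem_last.
  by rewrite /tb !mem_cat => /orP[/orP[->|->]|->]; rewrite ?orbT.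
have hp w : w \in y :: p -> box y (13%:R * u) w \/ w \in tc.
  rewrite -ep les_cat eg les_cat => wl.
  have : all (fun w => P' w || (w \in tc)) (les (les (y :: pg) (ta ++ tb)) tc).
    apply: all_les; first by apply: sub_all clean => x ->.
    by apply/allP => x ->; rewrite orbT.
  by move=> /allP/(_ w wl)/orP[/asboolP|]; [left|right].
rewrite ep; apply: (le_crosses u0 shortE vy hl pp _ hp).
- have [] := nearb_ori k n9; rewrite lp !ltr_norml => /andP[z1 z2] _.
  by clear -z1 z2 X9a u0; lra.
- move=> w; rewrite !mem_cat => /or4P[] wt.
  + have /hsegP[s [b z1 z2 z3 z4]] := walk_in w6 wt; constructor 1.
    by clear -b z1 z2 z3 z4 X5a X5b X6a X6b Y5a Y5b u0; case: b => -[? ?]; split; lra.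
  + have /vsegP[s [b z1 z2 z3 z4]] := walk_in w7 wt; constructor 2.
    by clear -z3 z4 X6b u0; lra.
  + have /hsegP[s [b z1 z2 z3 z4]] := walk_in w8 wt; constructor 3.
    by apply/andP; clear -z3 z4 Y7a Y7b u0; split; lra.
  + have /hsegP[s [b z1 z2 z3 z4]] := walk_in w9 wt; constructor 3.
    by rewrite y8 in z3 z4; apply/andP; clear -z3 z4 Y7a Y7b u0; split; lra.
move=> w; rewrite !mem_cat => /or4P[] wt hx.
- have /hsegP[s [b z1 z2 z3 z4]] := walk_in w6 wt; apply/(box_oriP k).
  by clear -b z1 z2 z3 z4 X5a X5b X6a X6b Y5a Y5b u0; case: b => -[? ?]; split; lra.
- have /vsegP[s [b z1 z2 z3 z4]] := walk_in w7 wt; apply/(box_oriP k).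
  rewrite y6 in b.
  by clear -b z1 z2 z3 z4 X6a X6b Y5a Y5b Y7a Y7b u0; case: b => -[? ?]; split; lra.
- have /hsegP[s [b z1 z2 z3 z4]] := walk_in w8 wt; apply/(box_oriP k).
  rewrite x7 in b.
  by clear -b z1 z2 z3 z4 X6a X6b X8a X8b Y7a Y7b u0; case: b => -[? ?]; split; lra.
- have /hsegP[s [b z1 z2 z3 z4]] := walk_in w9 wt; exfalso.
  by clear -b z1 z2 hx X8a X9a u0; case: b => -[? ?]; lra.
Qed.

(** * Leaving D before coming back near y *)

Section Escape.
Variables (R : realType) (G : planar_graph R) (D B : set (plane R)).
Implicit Types (v w : plane R) (t : seq (plane R)).
Local Notation q := (trans_prob G).
Local Notation nb := (nb G).

Definition in_set (s : option (plane R)) := if s is Some v then `[< B v >] else false.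
Definition is_out (s : option (plane R)) := s == None.

Definition exitv := val G (kstep G D) (@kcur R) is_out (fun=> false).
Definition escv := val G (kstep G D) (@kcur R) is_out in_set.
Definition retv := val G (kstep G D) (@kcur R) in_set is_out.
Definition exitp v := vinf G (kstep G D) (@kcur R) is_out (fun=> false) (Some v).
Definition escp v := vinf G (kstep G D) (@kcur R) is_out in_set (Some v).
Definition retp v := vinf G (kstep G D) (@kcur R) in_set is_out (Some v).

Lemma exit_le_esc_ret n s : exitv n s <= escv n s + retv n s.
Proof.
have nn (s' : option (plane R)) m : 0 <= retv m s' by exact: val_ge0.
elim: n s => [|n IH] [v|]; rewrite /exitv /escv /retv /=.
- by case: ifP => _; rewrite ?add0r ?addr0 ?ler01.
- by rewrite addr0 lexx.
- case: ifP => _.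
    by rewrite add0r -[X in X <= _]/(exitv n.+1 (Some v)); exact: val_le1.
  rewrite -big_split ler_sum //= => w _; rewrite -mulrDr ler_wpM2l ?q_ge0 //.
- by rewrite addr0 lexx.
Qed.

Lemma esc_ret v : exitp v = 1 -> 1 <= escp v + retp v.
Proof.
move=> <-; apply: vinf_le => n; apply: le_trans (exit_le_esc_ret n (Some v)) _.
by apply: lerD; exact: val_vinf.
Qed.

Lemma escp_step v : ~ B v -> escp v = \sum_(w <- nb v) q v w *
  (if `[< arc_set G v w `<=` D >] then escp w else 1).
Proof.
move=> Bv; rewrite /escp vinf_step //=; last by apply/asboolPn.
apply: eq_bigr => w _; case: ifP => // _; by rewrite vinf_win.
Qed.

(** Following the best neighbour leads out of D along vertices whose escape probability does not
    fall below m. *)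
Lemma esc_path n v m : 0 < m -> m <= escv n (Some v) ->
  exists t b, [/\ path (estep G setT) v t, edge G (last v t) b,
    ~ arc_set G (last v t) b `<=` D & forall x, x \in v :: t -> m <= escp x].
Proof.
move=> m0; elim: n v => [|n IH] v hm.
  by move: hm; rewrite /escv /=; case: ifP => _; rewrite leNgt m0.
have [x [vx hx]] : exists x, 0 < wt G v x /\
    escv n.+1 (Some v) <= escv n (kstep G D (Some v) x).
  have [//||x [h1 h2]] := @val_step_ge _ G _ (kstep G D) (@kcur R) is_out in_set n (Some v).
    exact: lt_le_trans hm.
  by exists x.
have hv : m <= escp v by apply: le_trans hm _; exact: val_vinf.
rewrite /kstep in hx; case: (asboolP (arc_set G v x `<=` D)) hx => aD hx; last first.
  exists [::], x; split => //; first exact: wt_edge.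
  by move=> y; rewrite inE => /eqP ->.
have [t [b [pt e nD ht]]] := IH x (le_trans hm hx).
exists (x :: t), b; split => //=; first by rewrite pt andbT; apply/estepP.
by move=> y; rewrite inE => /orP[/eqP ->//|/ht].
Qed.

(** Serves to show that escape is possible at all: if no edge out of B led to a vertex that can
    escape, a walk from B would never leave D. *)
Lemma exit_zero : (forall v w, edge G v w -> B v -> arc_set G v w `<=` D) ->
  (forall v w, edge G v w -> B v -> ~ B w -> escp w <= 0) ->
  forall n v, vtx G v -> exitv n (Some v) <= if `[< B v >] then 0 else escv n (Some v).
Proof.
move=> BD B0; elim=> [|n IH] v vv.
  by rewrite /exitv /escv /=; case: asboolP.
case: asboolP => Bv; rewrite /exitv /=.
  rewrite big_seq big1 // => w; rewrite nbP => vw.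
  have e := wt_edge vw; rewrite asboolT; last exact: BD.
  suff -> : val G (kstep G D) (kcur (R:=R)) is_out (fun=> false) n (Some w) = 0 by rewrite mulr0.
  apply/eqP; rewrite eq_le val_ge0 andbT.
  have [_ vw'] := edge_vtx e; apply: le_trans (IH w vw') _.
  case: asboolP => Bw //; apply: le_trans (B0 v w e Bv Bw).
  exact: (@val_vinf _ G _ (kstep G D) (@kcur R) is_out in_set n (Some w)).
rewrite /escv /= asboolF // big_seq [X in _ <= X]big_seq ler_sum // => w wn.
rewrite ler_wpM2l ?q_ge0 //; case: asboolP => _; last by rewrite !val_win.
apply: le_trans (IH w (nb_vtx wn).2) _; case: ifP => _ //; exact: val_ge0.
Qed.

End Escape.

Section LEChain.
Variables (R : realType) (G : planar_graph R) (D : set (plane R)) (y : plane R).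
Variable l : seq (plane R).
Implicit Types (v w : plane R) (t : seq (plane R)).
Local Notation q := (trans_prob G).
Local Notation nb := (nb G).

(* The walk inside D, seen through its loop-erasure; [Out b] records whether the
   loop-erasure met l when the walk left D. *)
Inductive le_state := Run of seq (plane R) | Out of bool.

Definition le_next (s : le_state) w : le_state :=
  if s is Run g then
    if `[< arc_set G (last (0, 0) g) w `<=` D >] then Run (lestep g w)
    else Out (has (mem l) g)
  else s.

Definition le_cur (s : le_state) : plane R := if s is Run g then last (0, 0) g else (0, 0).
Definition le_win (s : le_state) := if s is Out b then b else false.
Definition le_lose (s : le_state) := if s is Out b then ~~ b else false.

Definition meetv n t : R := val G le_next le_cur le_win le_lose n (Run (les [:: y] t)).
Definition meetp t : R := vinf G le_next le_cur le_win le_lose (Run (les [:: y] t)).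

Lemma last_le t : last (0, 0) (les [:: y] t) = last y t.
Proof. by rewrite last_les. Qed.

Lemma meetp_step t : meetp t = \sum_(w <- nb (last y t)) q (last y t) w *
  (if `[< arc_set G (last y t) w `<=` D >] then meetp (rcons t w)
   else (has (mem l) (les [:: y] t))%:R).
Proof.
rewrite /meetp vinf_step //= last_le; apply: eq_bigr => w _; congr (_ * _).
case: ifP => _; first by rewrite les_rcons.
by case: (has _ _); [rewrite vinf_win|rewrite vinf_lose].
Qed.

Lemma meetp_ge0 t : 0 <= meetp t. Proof. exact: vinf_ge0. Qed.
Lemma meetp_le1 t : meetp t <= 1. Proof. exact: vinf_le1. Qed.

End LEChain.

(** The best-neighbour path from v leaves D. From v1 the walk moves to abscissa 41 u and turns
    around y with h = 38 u, inside the box of size 44 u and outside that of size 26 u, so it meets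
    this path: one segment and a turn. *)
Lemma esc_harnack (R : realType) (G : planar_graph R) (u al : R) (u0 : 0 < u) (al0 : 0 < al)
  (al1 : al <= 1) (st : steerable G u al) (y : plane R) (D : set (plane R)) N k n
  (v v1 p1 : plane R) : 90%:R <= N%:R :> R -> box y (44%:R * u) `<=` D ->
  vtx G v -> vtx G v1 -> box y (32%:R * u) v -> nearb u p1 v1 ->
  29%:R * u < cx k p1 - cx k y <= 30%:R * u -> 16%:R * u < cy k p1 - cy k y <= 17%:R * u ->
  escv G D (box y (26%:R * u)) n (Some v) * al ^+ (13 * N) <= escp G D (box y (26%:R * u)) v1.
Proof.
move=> N90 bD vv vv1 bv np /andP[z1 z2] /andP[z3 z4].
set B := box y (26%:R * u).
have Nu : 90%:R * u <= N%:R * u by rewrite ler_wpM2r // ltW.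
have alN n' : 0 <= al ^+ n' by apply: exprn_ge0; exact: ltW.
have [e0|n0] := eqVneq (escv G D B n (Some v)) 0.
  by rewrite e0 mul0r; exact: vinf_ge0.
set m := escv G D B n (Some v) in n0 *.
have m0 : 0 < m by rewrite lt_neqAle eq_sym n0 val_ge0.
have [t [b [pt e nD ht]]] := esc_path m0 (lexx m).
pose P := mem (v :: t); pose h x := escp G D B x.
(* U avoids B, where the escape probability is 0 and not an average over the neighbours. *)
pose U := box y (44%:R * u) `&` ~` B.
have nB1 : ~ B v1.
  move=> /(box_oriP k)[_ q1 _ _]; have [] := nearb_ori k np.
  by rewrite ltr_norml => /andP[q2 q3] _; clear -q1 q2 q3 z1 u0; lra.
have sH : superh G v1 U (fun t => if has P (v1 :: t) then m else h (last v1 t)).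
  apply: stopped_superh => //.
  - exact: ltW.
  - by move=> x; exact: vinf_ge0.
  - move=> t' pt'; rewrite [X in _ <= X]/h escp_step; last first.
      have := mem_last v1 t'; rewrite inE => /orP[/eqP ->//|h'].
      by have [] := walk_in pt' h'.
    rewrite ler_sum // => w _; rewrite ler_wpM2l ?q_ge0 //.
    case: asboolP => [aU|_]; last by case: ifP => _ //; exact: vinf_ge0.
    by rewrite asboolT // => x /aU[/bD].
have H0 : (if has P (v1 :: [::]) then m else h v1) <= escp G D B v1.
  by case: ifP => //=; rewrite orbF => /ht.
apply: le_trans H0.
rewrite mulSn addnC exprD mulrA.
have N1 : `|cx k y + 41%:R * u - cx k p1| <= N%:R * u.
  by rewrite ler_norml; apply/andP; clear -Nu z1 z2 u0; split; lra.
apply: (goX u0 al0 al1 st (k := k) (X := cx k y + 41%:R * u) (t := [::]) (p := p1) sH vv1 _ isT np N1).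
- by rewrite mulr_ge0 // ltW.
- move=> w /hsegP[s [bs q1 q2 q3 q4]]; split.
    apply/(box_oriP k); clear -bs q1 q2 q3 q4 z1 z2 z3 z4 u0.
    by case: bs => -[? ?]; split; lra.
  move=> /(box_oriP k)[_ q5 _ _].
  by clear -bs q1 q5 z1 u0; case: bs => -[? ?]; lra.
move=> p2 t2 y2 b2 d2 w2 v2 n2.
have [f1 f2] : 40%:R * u < cx k p2 - cx k y /\ cx k p2 - cx k y <= 41%:R * u.
  move: d2; rewrite ltr_norml => /andP[q1 q2].
  by clear -q1 q2 b2 z2 u0; case: b2 => -[? ?]; split; lra.
have rU : ring y (38%:R * u - 2%:R * u) (38%:R * u + 5%:R * u) `<=` U.
  move=> w [w1 w3]; split; first by apply: sub_box w3; clear -u0; lra.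
  by move=> hb; apply: w1; apply: sub_box hb; clear -u0; lra.
apply: (turn_rule u0 al0 al1 st (k := k) (c := y) (h := 38%:R * u) sH vv1 (ltW m0) v2 n2).
- by clear -u0; lra.
- by clear -u0 Nu; lra.
- by rewrite ger0_norm; try (apply/andP; split); clear -f1 f2 u0; lra.
- by rewrite y2 ler_norml; apply/andP; clear -z3 z4 u0; split; lra.
- exact: rU.
move=> p3 t3 _ _ w3 v3 n3 td /=; rewrite -/([::] ++ t2) in v3 n3 td *.
suff hp : has P (v1 :: t2 ++ t3) by move: hp => /= ->.
have [||||k' hk] := crossed_by_exit (a := 38%:R * u - 2%:R * u) (b := 38%:R * u + 2%:R * u) (c := y) _ _ vv pt
  (wtrace_head pt) _ e nD _.
- by clear -u0; lra.
- by clear -u0; lra.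
- by move=> k'; apply: box_cy_le; apply: sub_box bv; clear -u0; lra.
- by apply: subset_trans bD; apply: sub_box; clear -u0; lra.
have rD : ring y (38%:R * u - 2%:R * u) (38%:R * u + 5%:R * u) `<=` D.
  by move=> w /rU[/bD].
have [w [wt _ wg]] := hk _ _ rD (td k').
apply/hasP; exists w => //; move: wt; rewrite inE => /orP[/eqP ->|wt].
  by have := mem_last v1 t2; rewrite !inE mem_cat => /orP[->//|->]; rewrite orbT.
by rewrite inE mem_cat wt !orbT.
Qed.

Section Rounds.
Variables (R : realType) (G : planar_graph R) (u al : R).
Hypotheses (u0 : 0 < u) (al0 : 0 < al) (al1 : al <= 1).
Hypothesis st : steerable G u al.
Hypothesis shortE : forall a b, edge G a b -> arc_set G a b `<=` box a (u / 8%:R).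
Variables (y : plane R) (D : set (plane R)) (N : nat) (k : ori) (l : seq (plane R)).
Hypothesis N90 : 90%:R <= N%:R :> R.
Hypothesis bD : box y (44%:R * u) `<=` D.
Hypothesis vy : vtx G y.
Hypothesis hl : forall V vs, side_walk G V k y (15%:R * u) (18%:R * u) vs ->
  exists w, [/\ w \in vs, V w & w \in l].
Hypothesis exit1 : forall v, vtx G v -> exitp G D v = 1.
Implicit Types (v w : plane R) (t : seq (plane R)).

Local Notation B := (box y (26%:R * u)).
Local Notation meetp := (meetp G D y l).
Local Notation esc := (escp G D B).
Local Notation ret := (retp G D B).
Local Notation inside t := (path (estep G D) y t).

Let S : set R := [set meetp t | t in [set t | inside t /\ B (last y t)]].
Let m : R := inf S.

Let By : B y. Proof. by split; rewrite subrr normr0 mulr_gt0. Qed.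

Let S_inf : has_inf S.
Proof.
split; first by exists (meetp [::]), [::].
by exists 0 => _ [t _ <-]; exact: meetp_ge0.
Qed.

Let m_le t : inside t -> B (last y t) -> m <= meetp t.
Proof. by move=> h1 h2; apply: ge_inf; [case: S_inf|exists t]. Qed.

Let m_ge c : (forall t, inside t -> B (last y t) -> c <= meetp t) -> c <= m.
Proof.
move=> h; apply: lb_le_inf; first by case: S_inf.
by move=> _ [t [h1 h2] <-]; exact: h.
Qed.

Let m0 : 0 <= m. Proof. by apply: m_ge => t _ _; exact: meetp_ge0. Qed.
Let m1 : m <= 1.
Proof. by apply: le_trans (m_le (t := [::]) isT By) _; exact: meetp_le1. Qed.

Let meet_ret t : inside t -> m * ret (last y t) <= meetp t.
Proof.
move=> pt; suff h n : m * retv G D B n (Some (last y t)) <= meetp t.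
  have [e|mn] := eqVneq m 0; first by rewrite e mul0r; exact: meetp_ge0.
  have mp : 0 < m by rewrite lt_neqAle eq_sym mn m0.
  rewrite mulrC -ler_pdivlMr //; apply: vinf_le => n.
  by rewrite ler_pdivlMr // mulrC; exact: h.
elim: n t pt => [|n IH] t pt.
  rewrite /retv /=; case: asboolP => Bl; last by rewrite mulr0; exact: meetp_ge0.
  by rewrite mulr1; exact: m_le.
have [Bl|nB] := pselect (B (last y t)).
  by rewrite /retv val_win ?mulr1 /=; [exact: m_le|exact/asboolP].
rewrite /retv valS //=; last by apply/asboolPn.
rewrite meetp_step mulr_sumr big_seq [X in _ <= X]big_seq ler_sum // => w.
rewrite nbP => vw; rewrite mulrCA ler_wpM2l ?q_ge0 //.
case: asboolP => aD; last by rewrite val_lose // mulr0 ler0n.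
have := IH (rcons t w); rewrite last_rcons; apply.
by rewrite rcons_path pt; apply/estepP.
Qed.

(** While the walk stays outside B the robust part cannot be erased: leaving D is then a success,
    and coming back to B leaves a probability of at least m. *)
Let meet_robust t : inside t -> robust u y l (les [:: y] t) ->
  esc (last y t) + m * ret (last y t) <= meetp t.
Proof.
move=> pt rt.
suff h n : escv G D B n (Some (last y t)) + m * retv G D B n (Some (last y t)) <= meetp t.
  have h' n n' : escv G D B n (Some (last y t)) + m * retv G D B n' (Some (last y t)) <= meetp t.
    apply: le_trans (h (maxn n n')); apply: lerD; first by rewrite val_mono // leq_maxl.
    by rewrite ler_wpM2l ?m0 // val_mono // leq_maxr.
  have h2 n' : esc (last y t) + m * retv G D B n' (Some (last y t)) <= meetp t.
    by rewrite -lerBrDr; apply: vinf_le => n; rewrite lerBrDr; exact: h'.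
  have [e|mn] := eqVneq m 0; first by have := h2 0%N; rewrite e !mul0r !addr0.
  have mp : 0 < m by rewrite lt_neqAle eq_sym mn m0.
  rewrite -lerBrDl mulrC -ler_pdivlMr //; apply: vinf_le => n.
  by rewrite ler_pdivlMr // mulrC lerBrDl; exact: h2.
have {rt} : B (last y t) \/ robust u y l (les [:: y] t) by right.
elim: n t pt => [|n IH] t pt hB.
  rewrite /escv /retv /=; case: asboolP => Bl; first by rewrite mulr1 add0r; exact: m_le.
  by rewrite mulr0 addr0; exact: meetp_ge0.
have [Bl|nB] := pselect (B (last y t)).
  rewrite [retv _ _ _ _ _]val_win; last exact/asboolP.
  by rewrite [escv _ _ _ _ _]val_lose //; [rewrite mulr1 add0r; exact: m_le|exact/asboolP].
have {hB} [g0 [g1 [x [eg xg xl gB]]]] : robust u y l (les [:: y] t) by case: hB.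
have hl' : has (mem l) (les [:: y] t).
  by apply/hasP; exists x => //; rewrite eg mem_cat xg.
rewrite [retv _ _ _ _ _]valS ?[escv _ _ _ _ _]valS //=; try by apply/asboolPn.
rewrite meetp_step mulr_sumr -big_split /= big_seq [X in _ <= X]big_seq ler_sum // => w.
rewrite nbP => vw; rewrite mulrCA -mulrDr ler_wpM2l ?q_ge0 //.
case: asboolP => aD; last by rewrite val_win // val_lose // mulr0 addr0 hl'.
have := IH (rcons t w); rewrite last_rcons; apply.
  by rewrite rcons_path pt; apply/estepP.
have [Bw|nBw] := pselect (B w); first by left.
right; rewrite les_rcons eg.
have [|g2 e2] := @les_prefix _ g0 g1 [:: w].
  by move=> z; rewrite inE => /eqP ->; apply/negP => /gB.
by rewrite -[lestep _ _]/(les (g0 ++ g1) [:: w]) e2; exists g0, g2, x.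
Qed.

(** Size 32, because the robust strategy runs in the box of size 31 u and one more edge adds at most
    u / 8. *)
Let S' : set R := [set esc v | v in [set v | vtx G v /\ box y (32%:R * u) v]].
Let eh : R := sup S'.

Let y32 : box y (32%:R * u) y.
Proof. by split; rewrite subrr normr0 mulr_gt0. Qed.

Let S'_sup : has_sup S'.
Proof.
split; first by exists (esc y), y.
by exists 1 => _ [v _ <-]; exact: vinf_le1.
Qed.

Let esc_eh v : vtx G v -> box y (32%:R * u) v -> esc v <= eh.
Proof. by move=> h1 h2; apply: ub_le_sup; [case: S'_sup|exists v]. Qed.

Let meet_far t : inside t -> box y (32%:R * u) (last y t) -> m * (1 - eh) <= meetp t.
Proof.
move=> pt bt; apply: le_trans (meet_ret pt); rewrite ler_wpM2l ?m0 //.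
have vl : vtx G (last y t) := walk_vtx pt vy (mem_last y t).
have := esc_ret B (exit1 vl); have := esc_eh vl bt => e1 e2.
by rewrite lerBlDl (le_trans e2) // lerD2r.
Qed.

Let arc_box v w a b : edge G v w -> box y a v -> a + u / 8%:R <= b ->
  arc_set G v w `<=` box y b.
Proof. by move=> e bv ab x /(shortE e) h; apply: (box_sub bv ab h). Qed.

Let eh_gt0 : 0 < eh.
Proof.
rewrite ltNge; apply/negP => eh0.
have BD v w : edge G v w -> B v -> arc_set G v w `<=` D.
  move=> e Bv; apply: subset_trans bD; apply: (arc_box e Bv).
  by have := u0 => u0'; lra.
have B0 v w : edge G v w -> B v -> ~ B w -> esc w <= 0.
  move=> e Bv _; apply: le_trans eh0; apply: esc_eh; first by case: (edge_vtx e).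
  apply: (arc_box e Bv _ (arc_set_r e)); have := u0 => u0'; lra.
have : exitp G D y <= 0.
  by apply: vinf_le => n; apply: le_trans (exit_zero BD B0 n vy) _; rewrite asboolT.
by rewrite exit1 // ler10.
Qed.

Let c1 : R := al ^+ (13 * N).
Let c2 : R := al ^+ (20 * N).
Let c10 : 0 <= c1. Proof. by apply: exprn_ge0; exact: ltW. Qed.
Let c20 : 0 <= c2. Proof. by apply: exprn_ge0; exact: ltW. Qed.

Let round t : inside t -> B (last y t) ->
  m * (1 - eh) + (c1 * eh) * (1 - m) * c2 <= meetp t.
Proof.
move=> pt Bt; have pt' := sub_walk (@subsetT _ D) pt.
(* The value m (1 - eh) is guaranteed throughout the box of size 32 u. Once it is subtracted H
   remains nonnegative and superharmonic, and the cost c2 of the strategy only affects the gain. *)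
pose H t' := meetp (t ++ t') - m * (1 - eh).
rewrite -lerBrDl -[t]cats0 -/(H [::]) /c2.
have in_sub t' : path (estep G (box y (31%:R * u))) (last y t) t' -> inside (t ++ t').
  move=> p'; rewrite cat_path pt; apply: sub_walk p'; apply: subset_trans bD.
  by apply: sub_box; have := u0 => u0'; lra.
have in31 t' : path (estep G (box y (31%:R * u))) (last y t) t' ->
    box y (31%:R * u) (last y (t ++ t')).
  move=> p'; rewrite last_cat; have := mem_last (last y t) t'.
  rewrite inE => /orP[/eqP ->|]; last exact: walk_in p'.
  by apply: sub_box Bt; have := u0 => u0'; lra.
have sub3132 : box y (31%:R * u) `<=` box y (32%:R * u).
  by apply: sub_box; have := u0 => u0'; lra.
apply: (robust_rule u0 al0 al1 st shortE (N := N) (k := k) (l := l) N90 vy hl pt' Bt).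
- by rewrite mulr_ge0 ?subr_ge0 ?m1 // mulr_ge0 // ltW.
- split=> t' p'.
    by rewrite subr_ge0; apply: meet_far; [exact: in_sub|exact/sub3132/in31].
  have vl : vtx G (last y (t ++ t')) := walk_vtx (in_sub _ p') vy (mem_last _ _).
  pose F w := if `[< arc_set G (last y (t ++ t')) w `<=` D >]
    then meetp (rcons (t ++ t') w) else (has (mem l) (les [:: y] (t ++ t')))%:R.
  have -> : H t' = \sum_(w <- nb G (last y (t ++ t')))
      trans_prob G (last y (t ++ t')) w * (F w - m * (1 - eh)).
    under eq_bigr do rewrite mulrBr.
    by rewrite sumrB -mulr_suml q_sum1 // mul1r -meetp_step.
  rewrite -last_cat big_seq [X in _ <= X]big_seq ler_sum // => w; rewrite nbP => vw.
  have e := wt_edge vw.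
  have aD : arc_set G (last y (t ++ t')) w `<=` box y (32%:R * u).
    by apply: (arc_box e (in31 _ p')); have := u0 => u0'; lra.
  have aD' : arc_set G (last y (t ++ t')) w `<=` D.
    by apply: subset_trans aD _; apply: subset_trans bD; apply: sub_box; have := u0 => u0'; lra.
  rewrite /F (asboolT aD') ler_wpM2l ?q_ge0 // /H.
  rewrite -rcons_cat; case: ifP => _ //; rewrite subr_ge0; apply: meet_far.
    by rewrite rcons_path in_sub //; apply/estepP.
  by rewrite last_rcons; apply: aD; exact: arc_set_r.
move=> p1 t' p' z1 z2 n1 rb.
have pin := in_sub _ p'.
have vl : vtx G (last y (t ++ t')) := walk_vtx pin vy (mem_last _ _).
rewrite -last_cat in n1.
have eE : eh * c1 <= esc (last y (t ++ t')).
  have [e|cn] := eqVneq c1 0; first by rewrite e mulr0; exact: vinf_ge0.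
  have cp : 0 < c1 by rewrite lt_neqAle eq_sym cn c10.
  rewrite -ler_pdivlMr //; apply: ge_sup; first by case: S'_sup.
  move=> _ [v [vv bv] <-]; apply: vinf_le => n; rewrite ler_pdivlMr //.
  exact: (esc_harnack u0 al0 al1 st n N90 bD vv vl bv n1 z1 z2).
have h1 := meet_robust pin rb; have h2 := esc_ret B (exit1 vl).
rewrite /H lerBrDl; apply: le_trans h1.
have h3 : esc (last y (t ++ t')) + m * (1 - esc (last y (t ++ t'))) <=
    esc (last y (t ++ t')) + m * ret (last y (t ++ t')).
  by rewrite lerD2l ler_wpM2l ?m0 // lerBlDl.
(* A robust position with escape probability e' has value at least m + e' (1 - m), and e' >= c1 *
   eh. *)
apply: le_trans h3; have h4 : eh * c1 * (1 - m) <= esc (last y (t ++ t')) * (1 - m).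
  by rewrite ler_wpM2r // subr_ge0 m1.
have h5 : 0 <= m * eh by rewrite mulr_ge0 ?m0 // ltW // eh_gt0.
rewrite -subr_ge0 (_ : _ - _ = (esc (last y (t ++ t')) * (1 - m) - eh * c1 * (1 - m)) + m * eh); last by ring.
by rewrite addr_ge0 // subr_ge0.
Qed.

(* Let m be the infimum of the success probability over the trajectories ending in
   the box of size 26u, and e the supremum of the probability of leaving D before
   coming back to this box. From outside, success is at least m (1 - e); from a
   robust position with escape probability e' >= K e it is at least
   e' + m (1 - e'). A round being robust with probability K', this gives
   m >= m (1 - e) + K K' e (1 - m). *)
Lemma meet_lower : al ^+ (33 * N) / 2%:R <= meetp [::].
Proof.
have hm : m * (1 - eh) + c1 * eh * (1 - m) * c2 <= m by apply: m_ge.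
apply: le_trans (m_le (t := [::]) isT By).
have e0 := eh_gt0.
pose K := c1 * c2.
have KE : al ^+ (33 * N) = K by rewrite /K /c1 /c2 -exprD -mulnDl.
rewrite KE.
have K1 : K <= 1 by rewrite -KE exprn_ile1 // ltW.
have K0 : 0 <= K by rewrite mulr_ge0.
(* Division by eh > 0: the unknown escape probability disappears. Then m >= K / (1 + K) >= K / 2 as
   K <= 1. *)
have hK : K * (1 - m) <= m.
  rewrite -(ler_pM2l e0).
  have -> : eh * (K * (1 - m)) = c1 * eh * (1 - m) * c2 by rewrite /K; ring.
  by move: hm; rewrite mulrBr mulr1 [eh * m]mulrC; lra.
rewrite leNgt; apply/negP => hlt.
have h2 : 0 <= K * (1 / 2%:R - m) by rewrite mulr_ge0 //; lra.
by move: h2 hK; rewrite !mulrBr !mulr1; lra.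
Qed.

End Rounds.

(** * Laws of the walk and of the erased loops *)

Section Measure.
Context d (T : measurableType d) (R : realType).

Lemma countable_bigcup_measurable (I : Type) (A : set I) (F : I -> set T) : countable A ->
  (forall i, A i -> measurable (F i)) -> measurable (\bigcup_(i in A) F i).
Proof.
move=> /countable_injP[f fi] mF.
have -> : \bigcup_(i in A) F i =
    \bigcup_k \bigcup_(i in [set i | A i /\ f i = k]) F i.
  apply/seteqP; split => [w [i Ai Fi]|w [k _ [i [Ai _] Fi]]]; last by exists i.
  by exists (f i) => //; exists i.
apply: bigcup_measurable => k _.
have [[i [Ai fik]]|none] := pselect (exists i, A i /\ f i = k).
  suff -> : \bigcup_(i in [set i | A i /\ f i = k]) F i = F i by exact: mF.
  apply/seteqP; split => [w [j [Aj fj]]|w Fi]; last by exists i.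
  by rewrite (fi j i) ?inE // fj fik.
suff -> : \bigcup_(i in [set i | A i /\ f i = k]) F i = set0 by [].
by apply/seteqP; split => [w [j h] _|w []]; apply: none; exists j.
Qed.

Lemma countable_seqs (I : choiceType) (A : set I) : countable A ->
  countable [set p : seq I | forall x, x \in p -> A x].
Proof.
move=> /countable_injP[f fi]; apply/countable_injP.
exists (fun p => CodeSeq.code (map f p)) => p p'; rewrite !inE => hp hp'.
move=> /(can_inj CodeSeq.codeK) e.
have ep : size p = size p' by rewrite -(size_map f p) e size_map.
elim: p p' ep e hp hp' => [|x p IH] [|x' p'] // [ep] [e1 e2] hp hp'.
congr cons.
  by apply: fi => //; rewrite inE; [apply: hp|apply: hp']; rewrite mem_head.
by apply: IH => // y yp; [apply: hp|apply: hp']; rewrite inE yp orbT.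
Qed.

Variable P : probability T R.

Lemma le_prob (A B : set T) : measurable A -> measurable B -> A `<=` B -> (P A <= P B)%E.
Proof. by move=> mA mB; apply: le_measure; rewrite inE. Qed.

Lemma prob_fin (A : set T) : measurable A -> P A \is a fin_num.
Proof. by move=> mA; apply: fin_num_measure. Qed.

Lemma prob_conull (A F : set T) : measurable A -> measurable F -> P F = 1%E ->
  P (A `&` F) = P A.
Proof.
move=> mA mF F1; rewrite [RHS](measureDI P mA mF).
suff h0 : P (A `\` F) = 0%E by rewrite -[LHS]add0e; congr (_ + _)%E.
have h := probability_setC P mF; rewrite F1 in h.
apply/eqP; rewrite eq_le measure_ge0 andbT.
apply: le_trans (le_prob (measurableD mA mF) (measurableC mF) _) _; first by move=> w [].
by rewrite h -EFinB subrr.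
Qed.

Lemma prob_conull_sub (A B F : set T) : measurable A -> measurable B -> measurable F ->
  P F = 1%E -> A `&` F `<=` B -> (P A <= P B)%E.
Proof.
move=> mA mB mF F1 sub; rewrite -(prob_conull mA mF F1).
by apply: le_prob => //; exact: measurableI.
Qed.

Lemma prob_sum (I : choiceType) (r : seq I) (F : I -> set T) : uniq r ->
  (forall i, i \in r -> measurable (F i)) ->
  (forall i j w, i \in r -> j \in r -> F i w -> F j w -> i = j) ->
  P (\bigcup_(i in [set` r]) F i) = (\sum_(i <- r) P (F i))%E.
Proof.
move=> ur mF dis; rewrite measure_fin_bigcup //; first by rewrite -fsbig_seq.
by move=> i j /= ir jr [w [Fi Fj]]; exact: (dis i j w).
Qed.

Lemma prob_increasing (E : nat -> set T) (a : \bar R) : (forall n, measurable (E n)) ->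
  (forall n, E n `<=` E n.+1) -> (a < P (\bigcup_n E n))%E -> exists n, (a < P (E n))%E.
Proof.
move=> mE inc aE; apply: contrapT => none.
have ndE : {homo E : n m / (n <= m)%N >-> (n <= m)%O}.
  by apply: homo_leq => [x|x y z|n] //; [exact: le_trans|apply/subsetPset; exact: inc].
have c := nondecreasing_cvg_mu (mu := P) mE (bigcup_measurable (fun k _ => mE k)) ndE.
move: aE; rewrite ltNge => /negP; apply.
rewrite -(cvg_lim _ c) //; apply: lime_le; first by apply/cvg_ex; eexists; exact: c.
by apply: nearW => n /=; rewrite leNgt; apply/negP => ?; apply: none; exists n.
Qed.

End Measure.

Lemma countable_vtx (R : realType) (G : planar_graph R) : countable (vtx G).
Proof.
pose K (n : nat) : set (plane R) := `[- n%:R, n%:R] `*` `[- n%:R, n%:R].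
have -> : vtx G = \bigcup_n (vtx G `&` K n).
  apply/seteqP; split => [v vv|v [n _ []]//]; exists (Num.truncn (Num.max `|v.1| `|v.2|)).+1 => //.
  split => //; have := truncnS_gt (Num.max `|v.1| `|v.2|).
  by rewrite gt_max => /andP[h1 h2]; split; rewrite /= in_itv /= -ler_norml ltW.
apply: bigcup_countable => // n _; apply: finite_set_countable; apply: vtx_proper.
by apply: compact_setX; exact: segment_compact.
Qed.

(** * The law of finitely many steps *)

Section Walk.
Variables (R : realType) (G : planar_graph R) (X : random_walk G).
Local Notation q := (trans_prob G).
Local Notation nb := (nb G).
Local Notation traj w := (fun i => rw_X X i w).
Implicit Types (v : plane R) (p : seq (plane R)) (x : nat -> plane R) (w : rw_T X).

(** An event depending on the first n positions is a countable union over their values; the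
    induction fixes the last position. *)
Lemma measurable_prefix n (Q : (nat -> plane R) -> Prop) :
  (forall x x', (forall i, (i < n)%N -> x i = x' i) -> Q x -> Q x') ->
  measurable [set w | Q (traj w)].
Proof.
elim: n Q => [|n IH] Q hQ.
  have [h|h] := pselect (exists x, Q x).
    suff -> : [set w | Q (traj w)] = setT by [].
    by apply/seteqP; split => // w _; case: h => x; exact: hQ.
  suff -> : [set w | Q (traj w)] = set0 by [].
  by apply/seteqP; split => // w qw; apply: h; exists (traj w).
have -> : [set w | Q (traj w)] = \bigcup_(v in vtx G)
    ([set w | rw_X X n w = v] `&`
     [set w | Q (fun i => if i == n then v else rw_X X i w)]).
  apply/seteqP; split => [w qw|w [v _ [/= e]]].
    exists (rw_X X n w); first exact: rw_vtx.
    by split => //=; apply: hQ qw => i _; case: eqP => // ->.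
  by apply: hQ => i _; case: eqP => // ->.
apply: countable_bigcup_measurable; first exact: countable_vtx.
move=> v _; apply: measurableI; first exact: rw_meas.
apply: (IH (fun x => Q (fun i => if i == n then v else x i))) => x x' h.
apply: hQ => i; rewrite ltnS leq_eqVlt => /orP[->//|].
by move=> lin; rewrite (ltn_eqF lin); exact: h.
Qed.

Fixpoint paths n v : seq (seq (plane R)) :=
  if n is m.+1 then [seq z :: p | z <- nb v, p <- paths m z] else [:: [::]].

Lemma pathsP n v p : p \in paths n v -> path (estep G setT) v p /\ size p = n.
Proof.
elim: n v p => [|n IH] v p /=; first by rewrite inE => /eqP ->.
move=> /allpairsPdep[x [p' [xn /IH[h1 h2] ->]]] /=; rewrite h1 h2 andbT; split => //.
by apply/estepP; rewrite -nbP.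
Qed.

Lemma paths_uniq n v : uniq (paths n v).
Proof.
elim: n v => //= n IH v; apply: allpairs_uniq_dep; first exact: nb_uniq.
  by move=> x _; exact: IH.
by move=> [x p] [x' p'] _ _ /= [-> ->].
Qed.

Lemma pw_sum n v : vtx G v -> \sum_(p <- paths n v) pw G v p = 1.
Proof.
elim: n v => [|n IH] v vv /=; first by rewrite big_seq1.
rewrite big_allpairs_dep /= -(q_sum1 vv) big_seq [RHS]big_seq; apply: eq_bigr => x xn.
by rewrite -mulr_sumr IH ?mulr1 //; case: (nb_vtx xn).
Qed.

Definition steps n x := mkseq (fun i => x i.+1) n.

Lemma stepsS n x : steps n.+1 x = x 1%N :: steps n (fun i => x i.+1).
Proof. by rewrite /steps /mkseq /= (iotaDl 1 0 n) -map_comp. Qed.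

Lemma eq_steps n x x' : (forall i, (i < n)%N -> x i.+1 = x' i.+1) -> steps n x = steps n x'.
Proof. by move=> h; apply/eq_in_map => i; rewrite mem_iota /= add0n; exact: h. Qed.

Lemma prod_pw n x : \prod_(i < n) q (x i) (x i.+1) = pw G (x 0%N) (steps n x).
Proof.
elim: n x => [|n IH] x; first by rewrite big_ord0.
by rewrite big_ord_recl stepsS /= -IH.
Qed.

Let cyl v p := [set w | rw_X X 0%N w = v /\ steps (size p) (traj w) = p].

Let meas_cyl v p : measurable (cyl v p).
Proof.
apply: (@measurable_prefix (size p).+1 (fun x => x 0%N = v /\ steps (size p) x = p)).
move=> x x' h [e0 e]; split; first by rewrite -h.
by rewrite -[RHS]e; apply: eq_steps => i ?; rewrite -h.
Qed.

Lemma prob_cyl v p : vtx G v -> rw_P X v (cyl v p) = (pw G v p)%:E.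
Proof.
move=> vv; have := rw_law X (size p) (fun i => nth v (v :: p) i) vv.
rewrite /= eqxx mul1r (prod_pw (size p) (fun i => nth v (v :: p) i)) /=.
rewrite /steps (mkseq_nth v p) => <-; congr (rw_P X v _).
apply/seteqP; split => w /=.
  move=> [e0 e] [|i] //= hi; rewrite -[in RHS]e nth_mkseq //.
move=> h; split; first by rewrite h.
rewrite -[RHS](mkseq_nth v p); apply/eq_in_map => i.
by rewrite mem_iota /= add0n => hi; rewrite h.
Qed.

Let front n v := \bigcup_(p in [set` paths n v]) cyl v p.

Let meas_front n v : measurable (front n v).
Proof.
apply: fin_bigcup_measurable => // p _; exact: meas_cyl.
Qed.

Let prob_front n v (Q : pred (seq (plane R))) : vtx G v ->
  rw_P X v (\bigcup_(p in [set` [seq p <- paths n v | Q p]]) cyl v p) =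
  (\sum_(p <- paths n v) pw G v p * (Q p)%:R)%:E.
Proof.
move=> vv; rewrite prob_sum.
- under eq_bigr do rewrite prob_cyl //.
  rewrite big_filter sumEFin big_mkcond /=; congr (_%:E).
  by apply: eq_bigr => p _; case: (Q p); rewrite ?mulr1 ?mulr0.
- by rewrite filter_uniq // paths_uniq.
- by move=> p _; exact: meas_cyl.
move=> p p' w; rewrite !mem_filter => /andP[_ /pathsP[_ sp]] /andP[_ /pathsP[_ sp']].
by move=> [_ e] [_ e']; rewrite -e -e' sp sp'.
Qed.

Let prob_front1 n v : vtx G v -> rw_P X v (front n v) = 1%E.
Proof.
move=> vv; have := prob_front n xpredT vv; rewrite filter_predT => ->.
by under eq_bigr do rewrite mulr1; rewrite pw_sum.
Qed.

(** The cylinders over paths along edges have total weight 1, so all other trajectories are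
    negligible. *)
Lemma prob_steps n v (Q : pred (seq (plane R))) : vtx G v ->
  rw_P X v [set w | Q (steps n (traj w))] = (\sum_(p <- paths n v) pw G v p * (Q p)%:R)%:E.
Proof.
move=> vv; have mQ : measurable [set w | Q (steps n (traj w))].
  apply: (@measurable_prefix n.+1 (fun x => Q (steps n x))) => x x' h.
  by rewrite (@eq_steps n x x') // => i ?; rewrite h.
rewrite -(prob_conull mQ (meas_front n v) (prob_front1 n vv)) -prob_front //.
congr (rw_P X v _); apply/seteqP; split => w.
  move=> [/= Qw [p /= pn [e0 e]]]; exists p => //=; rewrite mem_filter pn andbT.
  by have [_ sp] := pathsP pn; rewrite -e sp.
move=> [p /=]; rewrite mem_filter => /andP[Qp pn] [e0 e].
have [_ sp] := pathsP pn; split; last by exists p.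
by rewrite /= -sp e.
Qed.

(** A set of full probability on which every step follows an edge; arcs are meaningful only
    there. *)
Definition walks v : set (rw_T X) :=
  [set w | rw_X X 0%N w = v /\ forall n, steps n (traj w) \in paths n v].

Lemma walksE v : walks v = \bigcap_n front n v.
Proof.
apply/seteqP; split => w.
  move=> [e0 h] n _; exists (steps n (traj w)) => //=; split => //.
  by rewrite size_mkseq.
move=> h; have [p0 _ [e0 _]] := h 0%N I; split => // n.
by have [p /= pn [_ e]] := h n I; have [_ sp] := pathsP pn; rewrite -sp e sp.
Qed.

Lemma meas_walks v : measurable (walks v).
Proof. by rewrite walksE; apply: bigcap_measurable => // n _; exact: meas_front. Qed.

Lemma prob_walks v : vtx G v -> rw_P X v (walks v) = 1%E.
Proof.
move=> vv; suff h : rw_P X v (~` walks v) = 0%E.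
  by rewrite -[walks v]setCK probability_setC ?h ?sube0 //; apply: measurableC; exact: meas_walks.
suff : (rw_P X v).-negligible (~` walks v).
  by move=> /negligibleP; apply; apply: measurableC; exact: meas_walks.
rewrite walksE setC_bigcap; apply: negligible_bigcup => n.
have h : rw_P X v (~` front n v) = 0%E.
  by rewrite probability_setC // prob_front1 // -EFinB subrr.
by apply/negligibleP => //; exact: measurableC.
Qed.

Lemma walks_step v w n : walks v w -> 0 < wt G (rw_X X n w) (rw_X X n.+1 w).
Proof.
move=> [e0 h]; have [] := pathsP (h n.+1) => /(pathP v) /(_ n).
rewrite size_mkseq ltnSn nth_mkseq // => /(_ isT) /[swap] _.
have -> : nth v (v :: steps n.+1 (traj w)) n = rw_X X n w.
  by case: n => [|n] /=; [rewrite e0|rewrite nth_mkseq].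
by move=> /estepP[].
Qed.

End Walk.

Section Machine.
Variables (R : realType) (G : planar_graph R) (X : random_walk G).
Variables (S : Type) (nxt : S -> plane R -> S) (cur : S -> plane R).
Variables (win lose : pred S).

Fixpoint accepts s (p : seq (plane R)) : bool :=
  if win s then true else if lose s then false else
  if p is x :: p' then accepts (nxt s x) p' else false.

Hypothesis cur_next : forall s x, ~~ win s -> ~~ lose s ->
  [|| win (nxt s x), lose (nxt s x) | cur (nxt s x) == x].

(** The recursion [val] steps from [cur s], so it computes probabilities for the actual walk
    provided an undecided state remembers the current vertex. *)
Lemma val_paths n s v : vtx G v -> [|| win s, lose s | cur s == v] ->
  val G nxt cur win lose n s = \sum_(p <- paths G n v) pw G v p * (accepts s p)%:R.
Proof.
elim: n s v => [|n IH] s v vv hs; rewrite /=.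
  by rewrite big_seq1 mul1r /=; case: (win s) => //; case: (lose s).
case: ifP hs => [ws _|/negbT ws /= hs].
  rewrite big_allpairs_dep /= -[LHS](q_sum1 vv) big_seq [RHS]big_seq.
  apply: eq_bigr => x xn; rewrite ws; under eq_bigr do rewrite mulr1.
  by rewrite -mulr_sumr pw_sum ?mulr1 //; case: (nb_vtx xn).
case: ifP hs => [ls _|/negbT ls /= /eqP cs].
  rewrite big1_seq // => p /andP[_ _]; case: p => [|x p] /=;
  by rewrite (negbTE ws) ls mulr0.
rewrite cs big_allpairs_dep /= big_seq [RHS]big_seq; apply: eq_bigr => x xn.
have [_ vx] := nb_vtx xn.
rewrite (IH _ x vx (cur_next x ws ls)) mulr_sumr; apply: eq_bigr => p _.
by rewrite (negbTE ws) (negbTE ls) mulrA.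
Qed.

Lemma val_prob n s v : vtx G v -> [|| win s, lose s | cur s == v] ->
  rw_P X v [set w | accepts s (steps n (fun i => rw_X X i w))] = (val G nxt cur win lose n s)%:E.
Proof. by move=> vv hs; rewrite (val_paths n vv hs) prob_steps. Qed.

End Machine.

Lemma edist_dilate (R : realType) (s : R) (z a b : plane R) : 0 <= s ->
  Defs.edist (s *: a + z) (s *: b + z) = s * Defs.edist a b.
Proof.
move=> s0; rewrite /Defs.edist /=.
have -> : (s *: a.1 + z.1 - (s *: b.1 + z.1)) ^+ 2 + (s *: a.2 + z.2 - (s *: b.2 + z.2)) ^+ 2
    = s ^+ 2 * ((a.1 - b.1) ^+ 2 + (a.2 - b.2) ^+ 2).
  by rewrite /GRing.scale /=; ring.
by rewrite sqrtrM ?sqr_ge0 // sqrtr_sqr ger0_norm.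
Qed.

Section Translate.
Variables (R : realType) (G : planar_graph R).
Implicit Types (v : plane R) (x : nat -> plane R).

Lemma kstep_run U (win lose : pred (option (plane R))) n x m : (m <= n)%N ->
  (forall i, (i < m)%N -> arc_set G (x i) (x i.+1) `<=` U) -> win (Some (x m)) ->
  (forall v, ~~ lose (Some v)) ->
  accepts (kstep G U) win lose (Some (x 0%N)) (steps n x).
Proof.
move=> mn hU hw hl; elim: m x n mn hU hw => [|m IH] x [|n] // mn hU hw.
- by rewrite /= hw.
- by rewrite stepsS /= hw.
rewrite stepsS /=; case: ifP => //; rewrite (negbTE (hl _)) /= => _.
rewrite asboolT; last exact: hU.
by apply: (IH (fun i => x i.+1)) => // i im; exact: hU.
Qed.

Lemma kstep_exit U n x m : (m < n)%N -> ~ arc_set G (x m) (x m.+1) `<=` U ->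
  accepts (kstep G U) (@is_out R) (fun=> false) (Some (x 0%N)) (steps n x).
Proof.
move=> + hU; elim: m x n hU => [|m IH] x [|n] // hU mn.
  by rewrite stepsS /= asboolF //; case: (steps n _).
rewrite stepsS /=; case: ifP => _; last by case: (steps n _).
exact: (IH (fun i => x i.+1)).
Qed.

Lemma kcur_next U (win lose : pred (option (plane R))) : win None || lose None ->
  forall s w, ~~ win s -> ~~ lose s ->
  [|| win (kstep G U s w), lose (kstep G U s w) | kcur (kstep G U s w) == w].
Proof.
move=> h [v|] w; last by move=> /negbTE ws /negbTE ls; move: h; rewrite ws ls.
by rewrite /=; case: ifP => _ _ _; [rewrite /= eqxx !orbT|rewrite orbA h].
Qed.

Variable X : random_walk G.
Local Notation traj w := (fun i => rw_X X i w).

Lemma kval_prob U (win lose : pred (option (plane R))) n v : win None || lose None -> vtx G v ->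
  rw_P X v [set w | accepts (kstep G U) win lose (Some v) (steps n (traj w))] =
  (val G (kstep G U) (@kcur R) win lose n (Some v))%:E.
Proof. by move=> h vv; rewrite (val_prob X (kcur_next U h) n vv) //= eqxx !orbT. Qed.

Lemma meas_run U (win lose : pred (option (plane R))) n s :
  measurable [set w | accepts (kstep G U) win lose s (steps n (traj w))].
Proof.
apply: (@measurable_prefix _ _ X n.+1 (fun x => accepts (kstep G U) win lose s (steps n x))).
by move=> x x' h; rewrite (@eq_steps _ n x x') // => i ?; rewrite h.
Qed.

Lemma hits_val B U (a : R) v : vtx G v ->
  (a%:E < rw_P X v [set w | hits_before_exiting G B U (traj w)])%E ->
  exists n, a < hit G B U n v.
Proof.
move=> vv ha.
pose E n := [set w | exists m, (m <= n)%N /\ (B (rw_X X m w) /\ stays_in G U (traj w) m)].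
have mE n : measurable (E n).
  apply: (@measurable_prefix _ _ X n.+1
    (fun x => exists m, (m <= n)%N /\ (B (x m) /\ stays_in G U x m))) => x x' h.
  move=> [m [mn [h1 h2]]]; exists m; split => //; split; first by rewrite -h.
  move=> i im; have in' := leq_trans im mn.
  by rewrite -!h // ?ltnS //; [exact: h2|exact: leq_trans (leq_pred _) in'].
have [||n hn] := @prob_increasing _ _ _ (rw_P X v) E a%:E mE.
- by move=> n w [m [mn h]]; exists m; split => //; exact: leqW.
- suff <- : [set w | hits_before_exiting G B U (traj w)] = \bigcup_n E n by [].
  apply/seteqP; split => [w [n h]|w [n _ [m [_ h]]]]; last by exists m.
  by exists n => //; exists n.
exists n; rewrite -lte_fin; apply: lt_le_trans hn _.
rewrite /hit -kval_prob //.
refine (prob_conull_sub (F := @walks _ _ X v) (mE n) _ (meas_walks _ _) (prob_walks _ vv) _).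
  exact: meas_run.
move=> w [[m [mn [h1 h2]]] [e0 _]] /=.
have -> : v = (traj w) 0%N by rewrite /= e0.
apply: (kstep_run mn) => //; last exact/asboolP.
by move=> i im; have [_ h] := h2 i.+1 im; exact: h.
Qed.

Lemma hit_sub B B' U U' n v : B `<=` B' -> U `<=` U' -> hit G B U n v <= hit G B' U' n v.
Proof.
move=> sB sU; elim: n v => [|n IH] v; rewrite /hit /=.
  by case: asboolP => hB; [rewrite asboolT //; exact: sB|case: ifP].
case: asboolP => hB; first by rewrite asboolT //; exact: sB.
case: asboolP => [hB'|_].
  by have := val_le1 G (kstep G U) (@kcur R) (fun s => if s is Some v then `[< B v >] else false)
    (fun s => s == None) n.+1 (Some v); rewrite /= asboolF.
apply: ler_sum => w _; rewrite ler_wpM2l ?q_ge0 //.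
case: asboolP => aU; last by rewrite val_lose // val_ge0.
by rewrite asboolT; [exact: IH|exact: subset_trans sU].
Qed.

Definition leaves_by D n := [set w | exists m, (m <= n)%N /\ leaves_at G D (traj w) m].

Lemma eq_stays_in D x x' n : (forall i, (i <= n)%N -> x i = x' i) ->
  stays_in G D x n -> stays_in G D x' n.
Proof.
by move=> h hs i im; have := hs i im; rewrite !h // (leq_trans (leq_pred _)).
Qed.

Lemma eq_leaves_at D x x' n : (forall i, (i <= n)%N -> x i = x' i) ->
  leaves_at G D x n -> leaves_at G D x' n.
Proof.
move=> h [h1 h2]; split.
  by move=> h3; apply: h1; apply: eq_stays_in h3 => i im; rewrite h.
by move=> m mn; apply: eq_stays_in (h2 m mn) => i im; rewrite h // ltnW // (leq_ltn_trans im).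
Qed.

Lemma meas_leaves_by D n : measurable (leaves_by D n).
Proof.
apply: (@measurable_prefix _ _ X n.+1
  (fun x => exists m, (m <= n)%N /\ leaves_at G D x m)) => x x' h [m [mn hm]].
by exists m; split => //; apply: eq_leaves_at hm => i im; rewrite h // ltnS (leq_trans im).
Qed.

Lemma leaves_soon D v e : vtx G v ->
  rw_P X v [set w | exists n, leaves_at G D (traj w) n] = 1%E -> 0 < e ->
  exists n, ((1 - e)%:E < rw_P X v (leaves_by D n))%E.
Proof.
move=> vv h1 e0.
apply: (prob_increasing (meas_leaves_by D)).
- by move=> n w [m [mn h]]; exists m; split => //; exact: leqW.
- suff <- : [set w | exists n, leaves_at G D (traj w) n] = \bigcup_n leaves_by D n.
    by rewrite h1 lte_fin ltrBlDr ltrDl.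
  apply/seteqP; split => [w [n h]|w [n _ [m [_ h]]]]; last by exists m.
  by exists n => //; exists n.
Qed.

Lemma exitp_as D v : vtx G v ->
  rw_P X v [set w | exists n, leaves_at G D (traj w) n] = 1%E -> exitp G D v = 1.
Proof.
move=> vv h1; apply/eqP; rewrite eq_le vinf_le1 /=; apply/ler_addgt0Pl => e e0.
(* The chain tests edges only, but from a vertex outside D every edge leaves D and one step
   decides. *)
have [Dv|nDv] := pselect (D v); last first.
  rewrite /exitp vinf_step //= big_seq (eq_bigr (fun w => trans_prob G v w)).
    by rewrite -big_seq q_sum1 // lerDr ltW.
  move=> w wn; rewrite asboolF ?vinf_win ?mulr1 //.
  by move=> /(_ v (arc_set_l (wt_edge _))) h; apply: nDv; apply: h; rewrite -nbP.
have [n hn] := leaves_soon vv h1 e0.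
rewrite -lerBlDl; apply: ltW; rewrite -lte_fin; apply: lt_le_trans hn _.
apply: (@le_trans _ _ (exitv G D n (Some v))%:E); last by rewrite lee_fin; exact: val_vinf.
rewrite /exitv -kval_prob //.
refine (prob_conull_sub (F := @walks _ _ X v) (meas_leaves_by _ _) _ (meas_walks _ _) (prob_walks _ vv) _).
  exact: meas_run.
move=> w [[m [mn [h2 h3]]] ww] /=; have [w0 _] := ww.
apply: contrapT => nr; apply: h2 => i im.
have h' j : (j < n)%N -> arc_set G (traj w j) (traj w j.+1) `<=` D.
  move=> jn; apply: contrapT => h; apply: nr.
  have -> : v = (traj w) 0%N by rewrite /= w0.
  exact: (kstep_exit jn).
case: i im => [|i] im; first by rewrite w0.
have hi := h' i (leq_trans im mn); split => // .
by apply: hi; apply: arc_set_r; exact: wt_edge (walks_step i ww).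
Qed.

Lemma le_run D l n g x : last (0, 0) g = x 0%N ->
  accepts (le_next G D l) (@le_win R) (@le_lose R) (Run g) (steps n x) ->
  exists m, [/\ (m < n)%N, forall i, (i < m)%N -> arc_set G (x i) (x i.+1) `<=` D,
    ~ arc_set G (x m) (x m.+1) `<=` D & has (mem l) (les g (steps m x))].
Proof.
elim: n g x => [|n IH] g x eg //; rewrite stepsS /= eg.
case: asboolP => aD h; last first.
  exists 0%N; split => //; rewrite /steps /=; move: h.
  by case: (steps n _) => /=; case: (has _ _).
have [|m [mn h1 h2 h3]] := IH (lestep g (x 1%N)) (fun i => x i.+1) _ h.
  by rewrite /lestep last_rcons.
exists m.+1; split => //; last by rewrite stepsS.
by case=> [|i] im //; exact: h1.
Qed.

End Translate.

(** * From the crossing assumption to steering *)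

Section Crossing.
Variables (R : realType) (G : R -> planar_graph R) (X : forall delta, random_walk (G delta)).
Variables (delta0 alpha0 delta u al : R).
Hypotheses (d00 : 0 < delta0) (d0 : 0 < delta) (u0 : 0 < u) (al_le : al <= alpha0).
Hypothesis du : delta / delta0 <= u / 2%:R.
Implicit Types (c p v w : plane R).

Lemma crossing_hit rect c c' p v (T : set (plane R)) :
  crossing X delta0 alpha0 rect (eball c 4%:R^-1) (eball c' 4%:R^-1) ->
  (forall w, rect w -> T ((u / 2%:R) *: (w - c) + p)) -> nearb u p v -> vtx (G delta) v ->
  exists n, al < hit (G delta) (nearb u ((u / 2%:R) *: (c' - c) + p)) T n v.
Proof.
move=> cr rT np vv; set s := u / 2%:R.
have s0 : 0 < s by rewrite divr_gt0.
(* This similarity sends the ball about c to the ball of radius u / 8 about p, and the condition on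
   l says that delta is small compared with u. *)
pose z := p - s *: c; pose l := s / delta.
have ls : l * delta = s by rewrite divfK // gt_eqF.
have l0 : delta0^-1 <= l by rewrite ler_pdivlMr // mulrC.
have zE w : s *: (w - c) + p = s *: w + z by rewrite scalerBr addrAC -addrA.
have u8 : u / 8%:R = s * 4%:R^-1 by rewrite /s; field.
have vz : v - z + z = v by rewrite subrK.
have hv : dilate (l * delta) 0 (eball c 4%:R^-1) (v - z).
  rewrite ls; exists (s^-1 *: (v - z)); last by rewrite addr0 scalerA divff ?scale1r // gt_eqF.
  rewrite /eball /= -(ltr_pM2l s0) -(edist_dilate z) ?(ltW s0) //.
  rewrite -zE subrr scaler0 add0r scalerA divff ?gt_eqF // scale1r vz -u8; exact: np.
have := cr z delta l (v - z) d0 l0 hv; rewrite vz ls => /(_ vv) /(hits_val vv)[n hn].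
exists n; apply: le_lt_trans al_le _; apply: lt_le_trans hn _.
apply: hit_sub.
  move=> _ [b hb <-]; rewrite /nearb /eball /= zE (edist_dilate z) ?(ltW s0) // u8.
  by rewrite ltr_pM2l.
by move=> _ [b hb <-]; rewrite -zE; exact: rT.
Qed.

(** The two axes and the two signs of A correspond to the four crossings assumed. *)
Lemma crossing_steerable : uniform_crossing X delta0 alpha0 -> steerable (G delta) u al.
Proof.
have s0 : 0 < u / 2%:R by rewrite divr_gt0.
have half (a : R) : 0 <= a <= 1 -> `|(u / 2%:R) * (a - 2%:R^-1)| <= u / 4%:R.
  move=> a01; rewrite normrM (gtr0_norm s0) (_ : u / 4%:R = u / 2%:R * 2%:R^-1); last by field.
  by rewrite ler_pM2l // ler_norml; apply/andP; split; lra.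
have long (a : R) : 0 <= a <= 3%:R -> exists s, 0 <= s <= u /\
    `|(u / 2%:R) * (a - 2%:R^-1) - s| <= u / 4%:R.
  move=> /andP[a0 a3]; have ua0 : 0 <= u * a by rewrite mulr_ge0 // ltW.
  have ua3 : u * a <= u * 3%:R by rewrite ler_pM2l.
  have -> : u / 2%:R * (a - 2%:R^-1) = u * a / 2%:R - u / 4%:R by field.
  have [h1|h1] := leP (u * a / 2%:R) (u / 4%:R).
    by exists 0; rewrite subr0 ler_norml lexx; split; [|apply/andP; split]; lra.
  have [h2|h2] := leP (u * a / 2%:R) (u + u / 4%:R).
    exists (u * a / 2%:R - u / 4%:R); rewrite subrr normr0; split; last by lra.
    by apply/andP; split; lra.
  exists u; rewrite lexx ler_norml; split; [|apply/andP; split]; lra.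
have longN (a : R) : 0 <= a <= 3%:R -> exists s, - u <= s <= 0 /\
    `|(u / 2%:R) * (a - 5%:R / 2%:R) - s| <= u / 4%:R.
  move=> /andP[a0 a3]; have [|s [/andP[h1 h2] h3]] := long (3%:R - a); first by lra.
  exists (- s); split; first by apply/andP; split; lra.
  rewrite -normrN (_ : - _ = u / 2%:R * (3%:R - a - 2%:R^-1) - s) //.
  by field.
case=> h1 h2 v1 v2 sw p A v Au vv np.
have [A0|A0] := leP 0 A.
  move: Au; rewrite ger0_norm // => Au; rewrite Au.
  case: sw.
    have [|n hn] := crossing_hit (T := tube u true p u) v1 _ np vv.
      move=> w [/half w1 /long[s [/andP[s1 s2] w2]]]; exists s; split => /=.
      - by left.
      - by rewrite addrK.
      - by rewrite addrK.
    exists n; apply: lt_le_trans hn _; rewrite (_ : _ + p = p + sh true u) //.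
    by rewrite addrC /sh; congr (_ + _); congr pair; rewrite /= /GRing.scale /=; field.
  have [|n hn] := crossing_hit (T := tube u false p u) h1 _ np vv.
    move=> w [/long[s [/andP[s1 s2] w1]] /half w2]; exists s; split => /=.
    - by left.
    - by rewrite addrK.
    - by rewrite addrK.
  exists n; apply: lt_le_trans hn _; rewrite (_ : _ + p = p + sh false u) //.
  by rewrite addrC /sh; congr (_ + _); congr pair; rewrite /= /GRing.scale /=; field.
move: Au; rewrite ltr0_norm // => Au; have -> : A = - u by rewrite -Au opprK.
case: sw.
  have [|n hn] := crossing_hit (T := tube u true p (- u)) v2 _ np vv.
    move=> w [/half w1 /longN[s [/andP[s1 s2] w2]]]; exists s; split => /=.
    - by right.
    - by rewrite addrK.
    - by rewrite addrK.
  exists n; apply: lt_le_trans hn _; rewrite (_ : _ + p = p + sh true (- u)) //.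
  by rewrite addrC /sh; congr (_ + _); congr pair; rewrite /= /GRing.scale /=; field.
have [|n hn] := crossing_hit (T := tube u false p (- u)) h2 _ np vv.
  move=> w [/longN[s [/andP[s1 s2] w1]] /half w2]; exists s; split => /=.
  - by right.
  - by rewrite addrK.
  - by rewrite addrK.
exists n; apply: lt_le_trans hn _; rewrite (_ : _ + p = p + sh false (- u)) //.
by rewrite addrC /sh; congr (_ + _); congr pair; rewrite /= /GRing.scale /=; field.
Qed.

End Crossing.

(** * Events of the loop-erasure *)

Section Erasure.
Variables (R : realType) (G : planar_graph R) (X : random_walk G) (D : set (plane R)).
Local Notation traj w := (fun i => rw_X X i w).
Implicit Types (v y : plane R) (g l : seq (plane R)) (x : nat -> plane R).

Definition le_event g : set (rw_T X) := [set w | LE_is G D (traj w) g].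

Lemma loop_erasure_steps x n : loop_erasure (mkseq x n.+1) = les [:: x 0%N] (steps n x).
Proof. by rewrite /mkseq /= (iotaDl 1 0 n) -map_comp loop_erasureE. Qed.

Lemma meas_le_event g : measurable (le_event g).
Proof.
have -> : le_event g = \bigcup_n
    [set w | leaves_at G D (traj w) n /\ g = loop_erasure (mkseq (traj w) n)].
  by apply/seteqP; split => [w [n h]|w [n _ h]]; exists n.
apply: bigcup_measurable => n _.
apply: (@measurable_prefix _ _ X n.+1
  (fun x => leaves_at G D x n /\ g = loop_erasure (mkseq x n))) => x x' h [h1 ->].
split; first by apply: eq_leaves_at h1 => i im; rewrite h.
congr loop_erasure; apply/eq_in_map => i; rewrite mem_iota add0n /= => im.
by rewrite h // ltnW.
Qed.

Lemma leaves_at_unique x n n' : leaves_at G D x n -> leaves_at G D x n' -> n = n'.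
Proof.
move=> [h1 h2] [h1' h2']; case: (ltngtP n n') => // h.
  by have := h2' _ h.
by have := h2 _ h.
Qed.

Lemma le_event_inj g g' w : le_event g w -> le_event g' w -> g = g'.
Proof. by move=> [n [h1 ->]] [n' [h1' ->]]; rewrite (leaves_at_unique h1 h1'). Qed.

Lemma walks_leave v w n : walks v w -> D v -> leaves_at G D (traj w) n ->
  exists m, [/\ n = m.+1, forall i, (i < m)%N -> arc_set G (traj w i) (traj w i.+1) `<=` D
    & ~ arc_set G (traj w m) (traj w m.+1) `<=` D].
Proof.
move=> ww Dv [h1 h2]; have [w0 _] := ww.
case: n h1 h2 => [|m] h1 h2.
  by exfalso; apply: h1 => i; rewrite leqn0 => /eqP ->; rewrite w0.
exists m; split => //.
  by move=> i im; have [_ h] := h2 m (ltnSn m) i.+1 im; exact: h.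
move=> hm; apply: h1 => i; rewrite leq_eqVlt => /orP[/eqP ->|im]; last exact: h2 m (ltnSn m) i im.
by split => //; apply: hm; apply: arc_set_r; exact: wt_edge (walks_step m ww).
Qed.

Lemma leave_walks v w m : walks v w -> D v ->
  (forall i, (i < m)%N -> arc_set G (traj w i) (traj w i.+1) `<=` D) ->
  ~ arc_set G (traj w m) (traj w m.+1) `<=` D -> leaves_at G D (traj w) m.+1.
Proof.
move=> ww Dv hi hm; have [w0 _] := ww; split.
  by move=> /(_ m.+1 (leqnn _))[_ h]; apply: hm; exact: h.
move=> k km [|i] ik; first by rewrite w0.
have h := hi i (leq_trans ik km); split => //.
by apply: h; apply: arc_set_r; exact: wt_edge (walks_step i ww).
Qed.

Lemma le_event_walk v g : vtx G v -> D v -> (0 < rw_P X v (le_event g))%E ->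
  exists t b, [/\ path (estep G setT) v t, edge G (last v t) b,
    ~ arc_set G (last v t) b `<=` D & g = v :: t].
Proof.
move=> vv Dv hg.
have [w [[n [hl ->]] ww]] : (le_event g `&` walks v) !=set0.
  apply/set0P; apply/eqP => e; move: hg.
  by rewrite -(prob_conull (meas_le_event g) (meas_walks X v) (prob_walks X vv)) e measure0 ltxx.
have [m [-> _ hm]] := walks_leave ww Dv hl; have [w0 wp] := ww.
have [p1 p2] := pathsP (wp m).
have [t et pt] := les_path p1; have lt : last v t = traj w m.
  have := last_les v [:: v] (steps m (traj w)); rewrite et /= => ->.
  case: (m) => [|k]; first by rewrite /steps /= w0.
  by rewrite /steps mkseqS last_rcons.
exists t, (traj w m.+1); rewrite lt; split => //; first exact: wt_edge (walks_step m ww).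
by rewrite (loop_erasure_steps (traj w) m) -et w0.
Qed.

(** A finite stand-in for the set of all loop-erasures, which carries all but an arbitrarily small
    part of the probability when n is large. *)
Definition lerws n y := undup [seq les [:: y] p | k <- iota 0 n, p <- paths G k y].

Lemma lerwsP n y m w : walks y w -> (m < n)%N -> les [:: y] (steps m (traj w)) \in lerws n y.
Proof.
move=> [_ wp] mn; rewrite mem_undup; apply/allpairsPdep.
by exists m, (steps m (traj w)); rewrite mem_iota.
Qed.

Lemma prob_lerws n y (Q : pred (seq (plane R))) :
  rw_P X y (\bigcup_(g in [set` [seq g <- lerws n y | Q g]]) le_event g) =
  (\sum_(g <- lerws n y | Q g) rw_P X y (le_event g))%E.
Proof.
rewrite prob_sum ?big_filter ?filter_uniq ?undup_uniq //.
  by move=> g _; exact: meas_le_event.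
by move=> g g' w _ _; exact: le_event_inj.
Qed.

Lemma meas_lerws n y (Q : pred (seq (plane R))) :
  measurable (\bigcup_(g in [set` [seq g <- lerws n y | Q g]]) le_event g).
Proof. by apply: fin_bigcup_measurable => // g _; exact: meas_le_event. Qed.

Lemma lerws_cover y e : vtx G y -> D y ->
  rw_P X y [set w | exists n, leaves_at G D (traj w) n] = 1%E -> 0 < e ->
  exists n, ((1 - e)%:E < \sum_(g <- lerws n y) rw_P X y (le_event g))%E.
Proof.
move=> vy Dy h1 e0; have [n hn] := leaves_soon vy h1 e0; exists n.
apply: lt_le_trans hn _; have := prob_lerws n y xpredT => <-.
refine (prob_conull_sub (F := @walks _ _ X y) (meas_leaves_by _ _ _) _ (meas_walks _ _) (prob_walks _ vy) _).
  exact: meas_lerws.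
move=> w [[m [mn hm]] ww]; have [k [ek _ _]] := walks_leave ww Dy hm.
exists (les [:: y] (steps k (traj w))) => /=.
  by rewrite mem_filter /= lerwsP // -ek.
have [w0 _] := ww; exists k.+1; split; first by rewrite -ek.
by rewrite (loop_erasure_steps (traj w) k) w0.
Qed.

(** Valid for all larger n', so that finitely many loops admit a common n. *)
Lemma lerws_hit y l c : vtx G y -> D y -> c < meetp G D y l [::] ->
  exists n, forall n', (n <= n')%N ->
    (c%:E < \sum_(g <- lerws n' y | has (mem l) g) rw_P X y (le_event g))%E.
Proof.
move=> vy Dy hc.
have [n hn] : exists n, c < meetv G D y l n [::].
  apply: contrapT => none; move: hc; rewrite ltNge => /negP; apply.
  by apply: vinf_le => n; rewrite leNgt; apply/negP => ?; apply: none; exists n.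
exists n => n' nn'; apply: (@lt_le_trans _ _ (meetv G D y l n' [::])%:E).
  by rewrite lte_fin; apply: lt_le_trans hn _; exact: val_mono.
have cn (s : le_state R) w : ~~ le_win s -> ~~ le_lose s ->
    [|| le_win (le_next G D l s w), le_lose (le_next G D l s w)
      | le_cur (le_next G D l s w) == w].
  case: s => [g|b] /=; last by case: b.
  by case: ifP => _ _ _ /=; [rewrite /lestep last_rcons eqxx|case: (has _ _)].
rewrite /meetv /= -(val_prob X cn n' vy) /= ?eqxx // -prob_lerws.
refine (prob_conull_sub (F := @walks _ _ X y) _ _ (meas_walks _ _) (prob_walks _ vy) _).
- apply: (@measurable_prefix _ _ X n'.+1
    (fun x => accepts (le_next G D l) (@le_win R) (@le_lose R) (Run [:: y]) (steps n' x))).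
  by move=> x x' h; rewrite (@eq_steps _ n' x x') // => i ?; rewrite h.
- exact: meas_lerws.
move=> w [/= hr ww]; have [w0 _] := ww.
have [|m [mn h1 h2 h3]] := le_run _ hr; first by rewrite /= w0.
exists (les [:: y] (steps m (traj w))) => /=; first by rewrite mem_filter h3 lerwsP.
by exists m.+1; split; [exact: (leave_walks ww Dy h1 h2)|rewrite (loop_erasure_steps (traj w) m) w0].
Qed.

End Erasure.

Lemma finite_reroot (R : realType) (s : seq (plane R)) : finite_set (reroot s).
Proof.
suff -> : reroot s = (fun k => rot k s) @` `I_(size s).+1.
  by apply: finite_image; exact: finite_II.
apply/seteqP; split => [t [k ->]|t [k _ <-]]; last by exists k.
have [h|h] := leqP k (size s); first by exists k.
by exists (size s) => //=; rewrite rot_size rot_oversize // ltnW.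
Qed.

Lemma countable_unrooted (R : realType) (G : planar_graph R) : countable (unrooted_loops G).
Proof.
have c := countable_seqs (countable_vtx G).
have c' := sub_countable (card_image_le (@reroot R) _) c.
apply: (sub_countable _ c'); apply: subset_card_le => u [s [_ qs] ->]; exists s => // v.
exact: loop_vtx.
Qed.

Lemma visits_reroot (R : realType) (g s : seq (plane R)) : visits g (reroot s) <-> has (mem s) g.
Proof.
split=> [[_ [v [[k ->] vs vg]]]|/hasP[v vg vs]].
  by apply/hasP; exists v => //; move: vs; rewrite mem_rot.
by exists s, v; split => //; exists 0%N; rewrite rot0.
Qed.

(** * Poisson counts of erased loops *)

Section Poisson.
Variables (R : realType) (G : planar_graph R) (X : random_walk G) (D : set (plane R)).
Variables (L : erased_loops X D).
Local Notation traj w := (fun i => rw_X X i w).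
Local Notation loop := (set (seq (plane R))).
Implicit Types (v y : plane R) (g l : seq (plane R)) (A : set loop) (F : seq loop).
Local Notation Y := (@le_event R G X D).

Definition mass (u : loop) : R := fine (loop_mass G u).

Lemma loop_mass_ge0 (u : loop) : (0 <= loop_mass G u)%E.
Proof.
apply: esum_ge0 => s _; rewrite lee_fin divr_ge0 // /loop_q.
by apply: prodr_ge0 => e _; exact: q_ge0.
Qed.

Lemma mass_ge0 u : 0 <= mass u. Proof. by rewrite fine_ge0 // loop_mass_ge0. Qed.

Lemma massE u : unrooted_loops G u -> loop_mass G u = (mass u)%:E.
Proof.
move=> [s _ ->]; rewrite /mass fineK // /loop_mass esum_fset; first last.
- move=> t _; rewrite lee_fin divr_ge0 // /loop_q.
  by apply: prodr_ge0 => e _; exact: q_ge0.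
- exact: finite_reroot.
rewrite fsbig_finite /=; last exact: finite_reroot.
by apply/sum_fin_numP.
Qed.

Lemma Lambda_seq F (Q : set loop) : uniq F -> (forall u, u \in F -> loops_in G D u) ->
  Lambda G D ([set` F] `&` Q) = (\sum_(u <- F | `[< Q u >]) mass u)%:E.
Proof.
move=> uF hF; rewrite /Lambda.
have -> : [set` F] `&` Q `&` loops_in G D = [set` [seq u <- F | `[< Q u >]]].
  apply/seteqP; split => [u [[/= uF' Qu] _]|u /=].
    by rewrite mem_filter uF' andbT; apply/asboolP.
  by rewrite mem_filter => /andP[/asboolP Qu uF']; split => //; exact: hF.
rewrite esum_fset; [|exact: finite_seq|by move=> u _; exact: loop_mass_ge0].
rewrite -fsbig_seq ?filter_uniq // big_filter big_seq_cond [in RHS]big_seq_cond -sumEFin.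
by apply: eq_bigr => u /andP[/hF[hu _] _]; rewrite massE.
Qed.

Definition avoid A := [set w | avoids (el_N L w) A].

Lemma meas_avoid A : A `<=` unrooted_loops G -> measurable (avoid A).
Proof.
move=> sA; have -> : avoid A = ~` \bigcup_(u in A) ~` [set w | el_N L w u = 0%N].
  rewrite setC_bigcup; apply/seteqP; split => [w h u Au|w h u Au]; rewrite ?setCK.
    exact: h.
  by have := h u Au; rewrite setCK.
apply: measurableC; apply: countable_bigcup_measurable.
  by apply: sub_countable (countable_unrooted G); exact: subset_card_le.
by move=> u _; apply: measurableC; exact: el_meas.
Qed.

Lemma nb_loops0 (N : loop -> nat) A : nb_loops N A = 0%E <-> avoids N A.
Proof.
split=> [h u Au|h]; last by apply: esum1 => u Au; rewrite h.
apply/eqP; rewrite -(eqr_nat R) eq_le ler0n andbT -lee_fin -[X in (_ <= X)%E]h.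
apply: esum_ge; exists [set u]; first by split => //; move=> _ /= ->.
by rewrite fsbig_set1.
Qed.

Lemma prob_avoid y g A (Z : R) : vtx G y -> Lambda G D (A `&` visits g) = Z%:E -> 0 <= Z ->
  rw_P X y (Y g `&` avoid A) = (rw_P X y (Y g) * (expR (- Z))%:E)%E.
Proof.
move=> vy LZ Z0.
have h := @el_law _ _ _ _ L y g 1 (fun=> A) (fun=> 0%N) vy _ _.
have -> : avoid A = [set w | forall i : 'I_1, nb_loops (el_N L w) A = (0%:R)%:E].
  by apply/seteqP; split => [w h' _|w /(_ ord0)] /=; rewrite ?nb_loops0 //;
   exact/nb_loops0.
rewrite /Y /le_event h; first last.
- by move=> i; rewrite LZ ltry.
- by move=> i j _ _ _; rewrite [i]ord1 [j]ord1.
rewrite big_ord1 LZ /=; congr (_ * _)%E; rewrite /poisson_prob; case: ifP => Zp.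
  by rewrite esum_set1 /poisson_pmf ?Zp ?expr0 ?fact0 ?divr1 ?mul1r //= lee_fin ?expR_ge0.
(* With parameter 0, [poisson_prob] is a point mass at 0, in accordance with [expR 0 = 1]. *)
have -> : Z = 0 by apply/eqP; rewrite eq_le Z0 leNgt Zp.
by rewrite oppr0 expR0 diracE mem_set.
Qed.

Lemma finite_mass A (a : R) : (a%:E < Lambda G D A)%E ->
  exists F, [/\ uniq F, forall u, u \in F -> A u /\ loops_in G D u & a < \sum_(u <- F) mass u].
Proof.
rewrite /Lambda => /ereal_sup_gt[_ [S [fS sS] <-]] h.
exists (finmap.enum_fset (fset_set S)).
have hS u : u \in finmap.enum_fset (fset_set S) -> S u.
  by rewrite -[u \in _]/(u \in fset_set S) in_fset_set // inE.
split; first exact: finmap.fset_uniq.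
  by move=> u /hS/sS[].
move: h; rewrite fsbig_finite // -lte_fin => /lt_le_trans; apply.
rewrite -sumEFin big_seq [X in (_ <= X)%E]big_seq; apply: lee_sum => u uS.
by rewrite massE //; have [_ []] := sS u (hS u uS).
Qed.

Let pr y B := fine (rw_P X y B).

Let prE y B : measurable B -> rw_P X y B = (pr y B)%:E.
Proof. by move=> mB; rewrite /pr fineK //; exact: prob_fin. Qed.

Let pr_ge0 y B : 0 <= pr y B. Proof. by rewrite fine_ge0. Qed.

(** Otherwise each possible g would leave a conditional probability of avoidance at most p / 4. With
    p / 4 more for the walks not covered by [lerws], the total is p / 2 < p. *)
Lemma exists_thin_lerw y A (p : R) : vtx G y -> D y ->
  rw_P X y [set w | exists n, leaves_at G D (traj w) n] = 1%E ->
  A `<=` loops_in G D -> 0 < p -> (p%:E <= rw_P X y (avoid A))%E ->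
  exists g, (0 < rw_P X y (Y g))%E /\ (Lambda G D (A `&` visits g) <= (ln (4%:R / p))%:E)%E.
Proof.
move=> vy Dy h1 sA p0 hp; apply: contrapT => none.
have mA : measurable (avoid A) by apply: meas_avoid => u /sA[].
have small g : (rw_P X y (avoid A `&` Y g) <= rw_P X y (Y g) * (p / 4%:R)%:E)%E.
  have mY := meas_le_event X D g.
  have [g0|] := leP (rw_P X y (Y g)) 0%E.
    have -> : rw_P X y (Y g) = 0%E by apply/eqP; rewrite eq_le g0 measure_ge0.
    rewrite mul0e; apply: le_trans g0; apply: le_prob => //; exact: measurableI.
  move=> gp; have : ((ln (4%:R / p))%:E < Lambda G D (A `&` visits g))%E.
    by rewrite ltNge; apply/negP => ?; apply: none; exists g.
  (* The Poisson law is only available for finite intensities, and Lambda may still be infinite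
     here: a finite subfamily already exceeds the threshold. *)
  move=> /finite_mass[F [uF hF lF]].
  have e : Lambda G D ([set` F] `&` visits g) = (\sum_(u <- F) mass u)%:E.
    rewrite Lambda_seq //; last by move=> u /hF[].
    rewrite big_seq_cond [in RHS]big_seq; congr (_%:E); apply: eq_bigl => u.
    by case: (boolP (u \in F)) => //= /hF[[_ h] _]; apply/asboolP.
  apply: (@le_trans _ _ (rw_P X y (Y g `&` avoid [set` F]))).
    apply: le_prob; first exact: measurableI.
      by apply: measurableI => //; apply: meas_avoid => u /hF[_ []].
    by move=> w [h1' h2]; split => // u /= /hF[[Au _] _]; exact: h1'.
  rewrite (prob_avoid vy e); last by rewrite sumr_ge0 // => *; exact: mass_ge0.
  apply: lee_wpmul2l => //; rewrite lee_fin.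
  have p4 : 0 < 4%:R / p by rewrite divr_gt0.
  rewrite -[p / _]invrK invf_div -[4%:R / p in X in _ <= X]lnK ?posrE // -expRN ler_expR lerN2.
  exact: ltW.
have p40 : 0 < p / 4%:R by rewrite divr_gt0.
have [n hn] := lerws_cover vy Dy h1 p40.
pose U := \bigcup_(g in [set` lerws G n y]) Y g.
have mU : measurable U by apply: fin_bigcup_measurable => // g _; exact: meas_le_event.
have PU : rw_P X y U = (\sum_(g <- lerws G n y) rw_P X y (Y g))%E.
  by have := prob_lerws X D n y xpredT; rewrite filter_predT.
have d1 : (rw_P X y (avoid A `\` U) <= (p / 4%:R)%:E)%E.
  apply: (@le_trans _ _ (rw_P X y (~` U))).
    apply: le_prob; [exact: measurableD|exact: measurableC|by move=> w []].
  rewrite probability_setC // leeBlDr ?prob_fin // -leeBlDl // -EFinB PU; exact: ltW.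
have d2 : (rw_P X y (avoid A `&` U) <= (p / 4%:R)%:E)%E.
  have -> : avoid A `&` U = \bigcup_(g in [set` lerws G n y]) (avoid A `&` Y g).
    by rewrite setI_bigcupr.
  rewrite prob_sum ?undup_uniq //; first last.
  - by move=> g g' w _ _ [_ h] [_]; exact: le_event_inj h.
  - by move=> g _; apply: measurableI => //; exact: meas_le_event.
  apply: (@le_trans _ _ (\sum_(g <- lerws G n y) rw_P X y (Y g) * (p / 4%:R)%:E)%E).
    by apply: lee_sum => g _; exact: small.
  rewrite -ge0_sume_distrl; last by move=> *; exact: measure_ge0.
  rewrite -PU -[X in (_ <= X)%E]mul1e; apply: lee_wpmul2r; first by rewrite lee_fin ltW.
  exact: probability_le1.
move: hp; rewrite (measureDI _ mA mU) => /le_trans /(_ (leeD d1 d2)).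
by rewrite -EFinD lee_fin; lra.
Qed.

Lemma prob_meets_loops y F n (c : R) : vtx G y -> uniq F ->
  (forall u, u \in F -> loops_in G D u) -> 0 <= c ->
  (forall u, u \in F ->
    (c%:E <= \sum_(g <- lerws G n y | `[< visits g u >]) rw_P X y (Y g))%E) ->
  ((c * ((\sum_(u <- F) mass u) / (1 + \sum_(u <- F) mass u)))%:E <= rw_P X y (~` avoid [set` F]))%E.
Proof.
move=> vy uF hF c0 hc; set M := \sum_(u <- F) mass u.
have M0 : 0 <= M by apply: sumr_ge0 => *; exact: mass_ge0.
have mF : measurable (avoid [set` F]) by apply: meas_avoid => u /= /hF[].
have mY g := meas_le_event X D g.
apply: (@le_trans _ _ (rw_P X y (\bigcup_(g in [set` lerws G n y]) (Y g `\` avoid [set` F])))); last first.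
  apply: le_prob; [|exact: measurableC|by move=> w [g _ []]].
  by apply: fin_bigcup_measurable => // g _; exact: measurableD.
rewrite prob_sum ?undup_uniq //; first last.
- by move=> g g' w _ _ [h _] [h' _]; exact: le_event_inj h h'.
- by move=> g _; exact: measurableD.
pose Z g := \sum_(u <- F | `[< visits g u >]) mass u.
have Z0 g : 0 <= Z g by apply: sumr_ge0 => *; exact: mass_ge0.
have ZM g : Z g <= M.
  rewrite /M (bigID (fun u => `[< visits g u >])) /= lerDl sumr_ge0 // => *; exact: mass_ge0.
have dg g : pr y (Y g) * (Z g / (1 + M)) <= pr y (Y g `\` avoid [set` F]).
  have : rw_P X y (Y g) = (rw_P X y (Y g `\` avoid [set` F]) +
    rw_P X y (Y g `&` avoid [set` F]))%E := measureDI (rw_P X y) (mY g) mF.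
  rewrite (prob_avoid vy (Lambda_seq (visits g) uF hF) (Z0 g)) !prE //; last exact: measurableD.
  rewrite -EFinM -EFinD => -[] /eqP; rewrite -subr_eq => /eqP <-.
  rewrite -[X in X - _]mulr1 -mulrBr ler_wpM2l // expRN lerBrDr -lerBrDl.
  (* 1 - exp (- Z) >= 1 - 1 / (1 + Z) = Z / (1 + Z) >= Z / (1 + M), from exp Z >= 1 + Z and Z <=
     M. *)
  have e1 := expR_ge1Dx (Z g); have e0 : 0 < 1 + Z g by rewrite ltr_wpDr.
  have e2 : 0 < 1 + M by rewrite ltr_wpDr.
  apply: (@le_trans _ _ (1 + Z g)^-1); first by rewrite lef_pV2 // posrE expR_gt0.
  apply: (@le_trans _ _ (1 - Z g / (1 + Z g))).
    rewrite (_ : 1 - Z g / (1 + Z g) = (1 + Z g)^-1) //; field; exact: lt0r_neq0.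
  by rewrite lerD2l lerN2 ler_wpM2l // lef_pV2 ?posrE // lerD2l.
rewrite (eq_bigr (fun g => (pr y (Y g `\` avoid [set` F]))%:E)); last first.
  by move=> g _; rewrite prE //; exact: measurableD.
rewrite sumEFin lee_fin.
apply: le_trans (ler_sum _ (fun g _ => dg g)).
under [X in _ <= X]eq_bigr do rewrite mulrA.
rewrite mulrA.
rewrite -mulr_suml ler_wpM2r ?invr_ge0 ?addr_ge0 //.
under eq_bigr do rewrite /Z big_mkcond mulr_sumr.
rewrite exchange_big /= /M mulr_sumr big_seq [X in _ <= X]big_seq ler_sum // => u uF'.
have := hc u uF'.
rewrite (eq_bigr (fun g => (pr y (Y g))%:E)); last by move=> g _; rewrite prE.
rewrite sumEFin lee_fin => h.
apply: le_trans (ler_wpM2r (mass_ge0 u) h) _.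
rewrite mulr_suml big_mkcond; apply: ler_sum => g _.
by case: ifP => _; rewrite ?mulr0.
Qed.

End Poisson.

(** * Big loops *)

Section Distances.
Variable R : realType.
Implicit Types (a b w x y : plane R).

Lemma edist_perturb x w y : Defs.edist x y <= Defs.edist x w + (`|w.1 - y.1| + `|w.2 - y.2|).
Proof.
rewrite /Defs.edist.
rewrite (_ : x.1 - y.1 = (x.1 - w.1) + (w.1 - y.1)); last by rewrite addrA subrK.
rewrite (_ : x.2 - y.2 = (x.2 - w.2) + (w.2 - y.2)); last by rewrite addrA subrK.
move: (x.1 - w.1) (w.1 - y.1) (x.2 - w.2) (w.2 - y.2) => p s q t.
have pq0 : 0 <= p ^+ 2 + q ^+ 2 by rewrite addr_ge0 ?sqr_ge0.
set S := Num.sqrt (p ^+ 2 + q ^+ 2).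
have S0 : 0 <= S := sqrtr_ge0 _.
have SS : S ^+ 2 = p ^+ 2 + q ^+ 2 by rewrite sqr_sqrtr.
have pS : `|p| <= S.
  by rewrite -sqrtr_sqr ler_wsqrtr // lerDl sqr_ge0.
have qS : `|q| <= S.
  by rewrite -sqrtr_sqr ler_wsqrtr // lerDr sqr_ge0.
have T0 : 0 <= S + (`|s| + `|t|) by rewrite !addr_ge0.
rewrite -[X in _ <= X]ger0_norm // -sqrtr_sqr ler_wsqrtr //.
have ps : p * s <= S * `|s|.
  by apply: le_trans (ler_norm _) _; rewrite normrM ler_wpM2r.
have qt : q * t <= S * `|t|.
  by apply: le_trans (ler_norm _) _; rewrite normrM ler_wpM2r.
have st0 : 0 <= `|s| * `|t| by rewrite mulr_ge0.
rewrite -subr_ge0.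
have -> : (S + (`|s| + `|t|)) ^+ 2 - ((p + s) ^+ 2 + (q + t) ^+ 2) =
  (S ^+ 2 - (p ^+ 2 + q ^+ 2)) + 2%:R * (S * `|s| - p * s) + 2%:R * (S * `|t| - q * t)
  + 2%:R * (`|s| * `|t|) + (`|s| ^+ 2 - s ^+ 2) + (`|t| ^+ 2 - t ^+ 2) by ring.
rewrite SS !real_normK ?num_real // !subrr !addr0 add0r.
by rewrite !addr_ge0 // mulr_ge0 // subr_ge0.
Qed.

Lemma edist_refl x : Defs.edist x x = 0.
Proof. by rewrite /Defs.edist !subrr expr0n /= addr0 sqrtr0. Qed.

Lemma edist_coord x y : `|x.1 - y.1| <= Defs.edist x y /\ `|x.2 - y.2| <= Defs.edist x y.
Proof.
by split; rewrite -sqrtr_sqr ler_wsqrtr // ?lerDl ?lerDr sqr_ge0.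
Qed.

End Distances.

Section Grid.
Variables (R : realType) (u : R).
Hypothesis u0 : 0 < u.

Lemma grid_line (c a : R) m : `|a - c| <= m%:R * u ->
  exists2 i, (i < m.*2.+1)%N & `|a - (c - m%:R * u + i%:R * u)| < u.
Proof.
rewrite ler_norml => /andP[h1 h2].
have b0 : 0 <= (a - c + m%:R * u) / u by rewrite divr_ge0 ?(ltW u0) //; lra.
exists (Num.truncn ((a - c + m%:R * u) / u)).
  rewrite truncn_lt_nat ?b0 // ltr_pdivrMr // -addnn -addn1 !natrD !mulrDl mul1r.
  by clear b0; have := u0; lra.
have := truncn_itv b0; set i := Num.truncn _.
rewrite ler_pdivlMr // ltr_pdivrMr // -natr1 mulrDl mul1r => /andP[h3 h4].
rewrite ltr_norml; apply/andP; split; clear b0; lra.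
Qed.

Definition grid (x : plane R) m : seq (plane R) :=
  [seq (x.1 - m%:R * u + i%:R * u, x.2 - m%:R * u + j%:R * u) |
     i <- iota 0 m.*2.+1, j <- iota 0 m.*2.+1].

Lemma size_grid x m : size (grid x m) = (m.*2.+1 * m.*2.+1)%N.
Proof. by rewrite size_allpairs size_iota. Qed.

Lemma grid_cover x m a : `|a.1 - x.1| <= m%:R * u -> `|a.2 - x.2| <= m%:R * u ->
  exists2 z, z \in grid x m & box z u a.
Proof.
move=> /grid_line[i hi h1] /grid_line[j hj h2].
exists (x.1 - m%:R * u + i%:R * u, x.2 - m%:R * u + j%:R * u); last by split.
by apply/allpairsP; exists (i, j); rewrite !mem_iota.
Qed.

Lemma grid_near x m z : z \in grid x m -> `|z.1 - x.1| <= m%:R * u /\ `|z.2 - x.2| <= m%:R * u.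
Proof.
have h i : (i < m.*2.+1)%N -> forall c : R, `|c - m%:R * u + i%:R * u - c| <= m%:R * u.
  rewrite ltnS => hi c; have : i%:R * u <= m.*2%:R * u by rewrite ler_pM2r // ler_nat.
  have : 0 <= i%:R * u by rewrite mulr_ge0 // ltW.
  rewrite -addnn natrD mulrDl ler_norml => h1 h2.
  by apply/andP; split; clear hi; lra.
move=> /allpairsP[[i j] [hi hj ->]]; rewrite !mem_iota /= add0n in hi hj.
by split; exact: h.
Qed.

End Grid.

Section LambdaCover.
Variables (R : realType) (G : planar_graph R) (D : set (plane R)).
Implicit Types B Q : set (set (seq (plane R))).

Lemma Lambda_ge0 B : (0 <= Lambda G D B)%E.
Proof. by apply: esum_ge0 => l _; exact: loop_mass_ge0. Qed.

Lemma Lambda_split Q B : Lambda G D B = (Lambda G D (B `&` Q) + Lambda G D (B `&` ~` Q))%E.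
Proof.
rewrite /Lambda (esumID Q) => [|l _]; last exact: loop_mass_ge0.
by congr (_ + _)%E; congr (\esum_(l in _) _); rewrite setIAC.
Qed.

Lemma Lambda_mono B Q : B `<=` Q -> (Lambda G D B <= Lambda G D Q)%E.
Proof.
move=> BQ; rewrite (Lambda_split B Q) (_ : Q `&` B = B); last exact/setIidPr.
by rewrite leeDl // Lambda_ge0.
Qed.

Lemma Lambda_cover (I : eqType) (r : seq I) (C : I -> set (set (seq (plane R)))) B (K : R) :
  (forall l, B l -> loops_in G D l -> exists2 i, i \in r & C i l) ->
  (forall i, i \in r -> (Lambda G D (B `&` C i) <= K%:E)%E) ->
  (Lambda G D B <= ((size r)%:R * K)%:E)%E.
Proof.
elim: r B => [|i r IH] B hB hC.
  rewrite mul0r /Lambda (_ : B `&` _ = set0) ?esum_set0 //.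
  by apply/seteqP; split => // l [Bl lD]; have [] := hB l Bl lD.
rewrite (Lambda_split (C i) B) /= -nat1r mulrDl mul1r EFinD.
apply: leeD; first by apply: hC; rewrite mem_head.
apply: IH.
  move=> l [Bl nC] lD; have [j] := hB l Bl lD; rewrite inE => /orP[/eqP -> //|jr Cj].
  by exists j.
move=> j jr; apply: le_trans (hC j _); last by rewrite inE jr orbT.
by apply: Lambda_mono => l [[Bl _] Cl].
Qed.

End LambdaCover.

Section BigLoops.
Variables (R : realType) (G : planar_graph R) (u : R).
Hypothesis u0 : 0 < u.
Hypothesis shortE : forall a b, edge G a b -> arc_set G a b `<=` box a (u / 8%:R).
Variables (x : plane R) (r : R) (D : set (plane R)).
Implicit Types (l : set (seq (plane R))) (s : seq (plane R)) (a b w z : plane R).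

Lemma trace_near l s w : unrooted_loops G l -> l s -> trace G l w ->
  exists2 a, a \in s & box a (u / 8%:R) w.
Proof.
move=> ul ls [s' [e [ls' es' ew]]].
have [el [_ q0]] := unrooted_reroot ul ls.
have [_ [_ q0']] := unrooted_reroot ul ls'.
have e0 := loop_q_step q0' es'.
exists e.1; last exact: shortE (wt_edge e0) _ ew.
have es : e.1 \in s' by move: es'; rewrite {1}[e]surjective_pairing => /zip_mem[].
by move: ls' es; rewrite el => -[k ->]; rewrite mem_rot.
Qed.

(** The point w near a, inside the ball, locates z: in (2) it shows that a vertex close to z belongs
    to the larger Euclidean ball. *)
Definition spans z : set (set (seq (plane R))) := [set l |
  exists s a b w, [/\ l s, a \in s, b \in s, core u z a & far u z b] /\
    (box a (u / 8%:R) w /\ eball x r w)].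

Lemma spans_excursion z l : spans z l ->
  exists s a b, [/\ l s, a \in s, b \in s, core u z a & far u z b].
Proof. by move=> [s [a [b [w [h _]]]]]; exists s, a, b. Qed.

Lemma big_spans l m : unrooted_loops G l -> ((100%:R * u)%:E <= ediam (trace G l))%E ->
  (trace G l `&` eball x r) !=set0 -> r + u <= m%:R * u ->
  exists2 z, z \in grid u x m & spans z l.
Proof.
move=> ul big [w [tw xw]] mr.
have [s rs el] := ul; have ls : l s by rewrite el; exists 0%N; rewrite rot0.
have [a sa aw] := trace_near ul ls tw.
have [h1 h2] := edist_coord x w; have [h3 h4] := aw.
have [z zg za] : exists2 z, z \in grid u x m & box z u a.
  apply: grid_cover => //.
    rewrite (le_trans _ mr) // (_ : a.1 - x.1 = - (x.1 - w.1) - (w.1 - a.1)); last by ring.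
    apply: le_trans (ler_normB _ _) _; rewrite normrN.
    by move: xw; rewrite /eball /= => xw; clear h2 h4; have := u0; lra.
  rewrite (le_trans _ mr) // (_ : a.2 - x.2 = - (x.2 - w.2) - (w.2 - a.2)); last by ring.
  apply: le_trans (ler_normB _ _) _; rewrite normrN.
  by move: xw; rewrite /eball /= => xw; clear h1 h3; have := u0; lra.
exists z => //; have [b sb fb] : exists2 b, b \in s & far u z b.
  apply: contrapT => none; move: big; rewrite leNgt => /negP; apply.
  (* If no vertex is far, the trace lies in the box of size 21 u around z, and distances are at most
     4 * 21 u = 84 u. *)
  apply: (@le_lt_trans _ _ (90%:R * u)%:E); last by rewrite lte_fin ltr_pM2r // ltr_nat.
  apply: ge_ereal_sup => _ [p [q [tp [tq ->]]]]; rewrite lee_fin.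
  have near o : trace G l o -> `|o.1 - z.1| < 21%:R * u /\ `|o.2 - z.2| < 21%:R * u.
    move=> /(trace_near ul ls)[c so oo].
    have [bz|nbz] := pselect (box z (20%:R * u) c); last by exfalso; apply: none; exists c.
    by apply: (box_sub bz _ oo); have := u0; lra.
  have [p1 p2] := near p tp; have [q1 q2] := near q tq.
  apply: le_trans (edist_perturb p p q) _; rewrite edist_refl add0r.
  rewrite (_ : p.1 - q.1 = (p.1 - z.1) - (q.1 - z.1)); last by ring.
  rewrite (_ : p.2 - q.2 = (p.2 - z.2) - (q.2 - z.2)); last by ring.
  apply: le_trans (lerD (ler_normB _ _) (ler_normB _ _)) _.
  apply: le_trans (lerD (lerD (ltW p1) (ltW q1)) (lerD (ltW p2) (ltW q2))) _.
  by rewrite -!mulrDl -!natrD ler_pM2r // ler_nat.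
by exists s, a, b, w.
Qed.

End BigLoops.

Lemma core_enum (R : realType) (G : planar_graph R) (u : R) z :
  exists2 s1 : seq (plane R), uniq s1 & forall v, v \in s1 <-> vtx G v /\ core u z v.
Proof.
have fin : finite_set (vtx G `&` core u z).
  have fK := vtx_proper G (compact_setX (@segment_compact _ (z.1 - u) (z.1 + u))
    (@segment_compact _ (z.2 - u) (z.2 + u))).
  apply: sub_finite_set fK.
  move=> v [vv [h1 h2]]; split => //; split; rewrite /= in_itv /=.
    by move: h1; rewrite ltr_norml => /andP[? ?]; apply/andP; split; lra.
  by move: h2; rewrite ltr_norml => /andP[? ?]; apply/andP; split; lra.
exists (finmap.enum_fset (fset_set (vtx G `&` core u z))); first exact: finmap.fset_uniq.
move=> v; rewrite -[v \in _]/(v \in fset_set _) in_fset_set //.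
by split; rewrite inE.
Qed.

(** * The two bounds for a fixed graph *)

Section FixedGraph.
Variables (R : realType) (G : planar_graph R) (X : random_walk G) (D : set (plane R)).
Variables (L : erased_loops X D) (u al : R).
Hypotheses (u0 : 0 < u) (al0 : 0 < al) (al1 : al <= 1) (st : steerable G u al).
Hypothesis shortE : forall a b, edge G a b -> arc_set G a b `<=` box a (u / 8%:R).
Variables (x : plane R) (r : R) (m N : nat).
Hypotheses (r0 : 0 < r) (ur : 1000%:R * u <= r) (xD : box x (2%:R * r) `<=` D).
Hypotheses (rm : r + u <= m%:R * u) (mr : m%:R * u < r + 6%:R * u).
Hypothesis rN : 2%:R * r + 214%:R * u <= N%:R * u.
Hypothesis leaves : forall y, vtx G y ->
  rw_P X y [set w | exists n, leaves_at G D (fun i => rw_X X i w) n] = 1%E.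
Variable B : set (set (seq (plane R))).
Hypothesis BD : B `<=` loops_in G D.
Hypothesis big : forall l, B l ->
  ((100%:R * u)%:E <= ediam (trace G l))%E /\ (trace G l `&` eball x r) !=set0.
Local Notation cells := (grid u x m).

Let in_cell l : B l -> exists2 z, z \in cells & spans u x r z l.
Proof.
by move=> Bl; have [h1 h2] := big Bl; apply: (big_spans u0 shortE) => //; have [] := BD Bl.
Qed.

Let cell_in z : z \in cells -> box x (r + 6%:R * u) z.
Proof. by move=> /(grid_near u0)[h1 h2]; split; exact: le_lt_trans mr. Qed.

Lemma avoided_Lambda y p : vtx G y -> box x (r + 100%:R * u) y -> 0 < p ->
  (p%:E <= rw_P X y (avoid L B))%E ->
  (Lambda G D B <= (ln (4%:R / p) + (size cells)%:R * (harnack al * al ^+ (14 * N))^-1)%:E)%E.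
Proof.
move=> vy xy p0 hp.
have Dy : D y by apply: xD; apply: sub_box xy; have := ur; have := u0; lra.
have [g [gp hg]] := exists_thin_lerw vy Dy (leaves vy) BD p0 hp.
have [t [b [pt e nD eg]]] := le_event_walk vy Dy gp.
rewrite (Lambda_split _ _ (visits g) B) EFinD; apply: leeD => //.
apply: (@Lambda_cover _ G D _ cells (spans u x r)).
  by move=> l [Bl _] _; exact: in_cell.
move=> z /cell_in zx.
have [s1 us s1P] := core_enum G u z.
apply: (Lambda_excursions u0 s1P (g := g)).
  by move=> l [[_ nv] sl] _; split => //; exact: spans_excursion sl.
have aN : 0 < al ^+ (14 * N) by exact: exprn_gt0.
move=> n; rewrite [X in harnack al * X](_ : _ = 1 - (1 - al ^+ (14 * N))); last by ring.
apply: (green_trace u0 al0 al1 st us s1P).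
  by rewrite ltrBlDr ltrDl.
move=> n' v vv cv; rewrite eg.
exact: (row_bound u0 al0 al1 st n' r0 ur xD zx vy xy pt e nD rN vv cv).
Qed.

Lemma loop_walk y0 t : 0 < loop_q G (y0 :: t) -> path (estep G setT) y0 t.
Proof.
move=> q0; have h e : e \in zip (y0 :: t) (rot 1 (y0 :: t)) -> 0 < wt G e.1 e.2.
  exact: loop_q_step.
move: h; rewrite rot1_cons => {q0}; move: {2}y0 => c.
elim: t y0 => [|v t IH] a //= h; rewrite IH.
  by rewrite andbT; apply/estepP; split => //; apply: (h (a, v)); rewrite mem_head.
by move=> e he; apply: h; rewrite inE he orbT.
Qed.

(** With y within 2 u of z, the core lies within 3 u of y and the box of size 18 u about y is not
    far from z; the loop, read as a walk, thus crosses the annulus between 15 u and 18 u. *)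
Lemma spans_meet z s y : spans u x r z (reroot s) -> 0 < loop_q G s -> vtx G y ->
  box z (2%:R * u) y -> exists k, forall V vs,
    side_walk G V k y (15%:R * u) (18%:R * u) vs -> exists w, [/\ w \in vs, V w & w \in s].
Proof.
move=> [_ [a [b [_ [[[k ->] sa sb ca fb] _]]]]] q0 vy zy; rewrite !mem_rot in sa sb.
case: s q0 sa sb => [|y0 t] // q0 sa sb; have pt := loop_walk q0.
have [vy0 _] : vtx G y0 /\ True by split => //; exact: loop_vtx q0 (mem_head _ _).
apply: (crossed_by_walk _ _ vy0 pt (wtrace_vtx pt sa) _ (wtrace_vtx pt sb)).
- by have := u0; lra.
- by have := u0; lra.
- move=> k'; apply: box_cy_le.
  by apply: (box_sub (box_sym zy) _ ca); have := u0; lra.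
move=> yb; apply: fb; apply: (box_sub zy _ yb); have := u0; lra.
Qed.

Lemma rare_Lambda (N90 : nat) (m0 : R) : 90%:R <= N90%:R :> R -> 0 < m0 ->
  (forall y, vtx G y -> eball x (r + 100%:R * u) y ->
    (rw_P X y (~` avoid L B) <= (al ^+ (33 * N90) / 4%:R * (m0 / (1 + m0)))%:E)%E) ->
  (Lambda G D B <= ((size cells)%:R * m0)%:E)%E.
Proof.
move=> hN m00 rare; apply: (@Lambda_cover _ G D _ cells (spans u x r)).
  by move=> l Bl _; exact: in_cell.
suff cell (z : plane R) : (Lambda G D (B `&` spans u x r z) <= m0%:E)%E by move=> z _; exact: cell.
rewrite leNgt; apply/negP => /finite_mass[F [uF hF lF]].
set c := al ^+ (33 * N90) in rare.
have c0 : 0 < c by exact: exprn_gt0.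
have [y vy zy] := dense_vtx u0 al0 al1 st z.
have [l0 l0F] : exists l, l \in F.
  case: (F) lF => [|l F' _]; last by exists l; rewrite mem_head.
  by rewrite big_nil => h; have := lt_trans m00 h; rewrite ltxx.
(* The centre z may lie outside the ball of radius r; the estimate goes through w, which is in that
   ball and within 4 u of y in each coordinate. *)
have xy : eball x (r + 100%:R * u) y.
  have [[_ [s [a [b [w [[_ _ _ [a1 a2] _] [[w1 w2] xw]]]]]]] _] := hF l0 l0F.
  have [y1 y2] := zy; rewrite /eball /=; apply: le_lt_trans (edist_perturb x w y) _.
  have q1 : u / 8%:R + u + 2%:R * u <= 4%:R * u by have := u0; lra.
  have q2 : r + (4%:R * u + 4%:R * u) <= r + 100%:R * u by have := u0; lra.
  have e1 : `|w.1 - y.1| < 4%:R * u.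
    rewrite (_ : w.1 - y.1 = (w.1 - a.1) + (a.1 - z.1) - (y.1 - z.1)); last by ring.
    apply: le_lt_trans (ler_normB _ _) _; apply: le_lt_trans (lerD (ler_normD _ _) (lexx _)) _.
    exact: lt_le_trans (ltrD (ltrD w1 a1) y1) q1.
  have e2 : `|w.2 - y.2| < 4%:R * u.
    rewrite (_ : w.2 - y.2 = (w.2 - a.2) + (a.2 - z.2) - (y.2 - z.2)); last by ring.
    apply: le_lt_trans (ler_normB _ _) _; apply: le_lt_trans (lerD (ler_normD _ _) (lexx _)) _.
    exact: lt_le_trans (ltrD (ltrD w2 a2) y2) q1.
  exact: lt_le_trans (ltrD xw (ltrD e1 e2)) q2.
have xyb : box x (r + 100%:R * u) y.
  by have [h1 h2] := edist_coord x y; split; rewrite distrC; exact: le_lt_trans xy.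
have yD : box y (44%:R * u) `<=` D.
  by move=> v yv; apply: xD; apply: (box_sub xyb _ yv); have := ur; have := u0; lra.
have Dy : D y by apply: yD; split; rewrite subrr normr0 mulr_gt0.
have [n hn] : exists n, forall l, l \in F -> forall n', (n <= n')%N ->
    ((c / 4%:R)%:E <= \sum_(g <- lerws G n' y | `[< visits g l >]) rw_P X y (le_event D g))%E.
  have one l : l \in F -> exists n, forall n', (n <= n')%N ->
      ((c / 4%:R)%:E <= \sum_(g <- lerws G n' y | `[< visits g l >]) rw_P X y (le_event D g))%E.
    move=> lF'; have [[_ sl] [ul _]] := hF l lF'; have [s [_ qs] el] := ul.
    rewrite el in sl *; have [k hk] := spans_meet sl qs vy zy.
    have ml := meet_lower u0 al0 al1 st shortE hN yD vy hk
      (fun v vv => exitp_as vv (leaves vv)).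
    (* [lerws_hit] asks for a strict inequality, hence c / 4 below the bound c / 2 of
       [meet_lower]. *)
    have c4 : c / 4%:R < meetp G D y s [::].
      by apply: lt_le_trans ml; rewrite ltr_pM2l // ltf_pV2 ?posrE // ltr_nat.
    have [n hn] := lerws_hit X vy Dy c4; exists n => n' /hn/ltW.
    rewrite (eq_bigl (fun g => `[< visits g (reroot s) >])) // => g.
    by apply/idP/asboolP => /visits_reroot.
  elim: (F) one => [|l F' IH] one; first by exists 0%N.
  have [n1 h1] := one l (mem_head _ _).
  have [|n2 h2] := IH; first by move=> l' hl'; apply: one; rewrite inE hl' orbT.
  exists (maxn n1 n2) => l'; rewrite inE => /orP[/eqP ->|hl'] n'; rewrite geq_max => /andP[m1 m2].
    exact: h1.
  exact: h2.
have FD l : l \in F -> loops_in G D l by move=> /hF[].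
have c40 : 0 < c / 4%:R by rewrite divr_gt0.
have h1 := prob_meets_loops L vy uF FD (ltW c40) (fun l lF' => hn l lF' n (leqnn n)).
have h2 : (rw_P X y (~` avoid L [set` F]) <= rw_P X y (~` avoid L B))%E.
  apply: le_prob.
  - by apply: measurableC; apply: meas_avoid => l /= /FD[].
  - by apply: measurableC; apply: meas_avoid => l /BD[].
  - by move=> w /= hw aw; apply: hw => l /= /hF[[Bl _] _]; exact: aw.
(* M / (1 + M) is increasing in M, so M > m0 contradicts the assumed rarity. *)
have := le_trans h1 (le_trans h2 (rare y vy xy)); rewrite lee_fin ler_pM2l //.
apply/negP; rewrite -ltNge.
set M := \sum_(l <- F) _ in lF *.
have [M1 M2] : 0 < 1 + m0 /\ 0 < 1 + M by split; [|have := lt_trans m00 lF]; lra.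
rewrite ltr_pdivrMr // mulrAC ltr_pdivlMr // !mulrDr !mulr1.
by rewrite [m0 * M]mulrC ltrD2r.
Qed.

End FixedGraph.

(** * Uniform constants and conclusion *)

Theorem theorem4p19 (R : realType) (delta0 alpha0 : R) :
  0 < delta0 -> 0 < alpha0 ->
  exists eta_of p_of : R -> R -> R,
  (forall eps p : R, 0 < eps < 100%:R^-1 -> 0 < p -> 0 < eta_of eps p) /\
  (forall eps eta : R, 0 < eps < 100%:R^-1 -> 0 < eta < 1 -> 0 < p_of eps eta) /\
  forall (eps r : R) (x : R * R) (D : set (R * R)) (G : R -> planar_graph R)
    (X : forall delta, random_walk (G delta))
    (L : forall delta, erased_loops (X delta) D)
    (A : R -> set (set (seq (R * R)))),
  0 < eps < 100%:R^-1 -> 0 < r ->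
  sc_domain D -> eball x (3%:R * r) `<=` D ->
  uniform_crossing X delta0 alpha0 ->
  (forall delta, 0 < delta -> A delta `<=` loops_in (G delta) D) ->
  (forall delta y, 0 < delta -> vtx (G delta) y ->
    rw_P (X delta) y
      [set w | exists n, leaves_at (G delta) D (fun i => rw_X (X delta) i w) n]
    = 1%E) ->
  exists delta1 : R, 0 < delta1 /\
  forall delta : R, 0 < delta < delta1 ->
  (forall p : R, 0 < p ->
    (exists y, [/\ vtx (G delta) y, eball x ((1 + eps) * r) y
      & (p%:E <= rw_P (X delta) y
           [set w | avoids (el_N (L delta) w)
                      (big_loops (G delta) (A delta) x eps r)])%E]) ->
    (Lambda (G delta) D (big_loops (G delta) (A delta) x eps r)
       <= (1 / eta_of eps p)%:E)%E)
  /\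
  (forall eta : R, 0 < eta < 1 ->
    (forall y, vtx (G delta) y -> eball x ((1 + eps) * r) y ->
      (rw_P (X delta) y
         [set w | ~ avoids (el_N (L delta) w)
                      (big_loops (G delta) (A delta) x eps r)]
       <= (p_of eps eta)%:E)%E) ->
    (Lambda (G delta) D (big_loops (G delta) (A delta) x eps r) <= eta%:E)%E).
Proof.
move=> d00 a00.
(* The largest requirement is 2 h + 8 u = 84 u, for the turn with h = 38 u in [esc_harnack]. *)
have [N hN] : exists N : nat, 90%:R <= N%:R :> R by exists 90%N; rewrite lexx.
pose al := Num.min alpha0 1.
have al0 : 0 < al by rewrite lt_min a00 ltr01.
have al1 : al <= 1 by rewrite ge_min lexx orbT.
have ala : al <= alpha0 by rewrite ge_min lexx.
(* Here r / u = 100 / eps. The grid reaches m u, between r + u and r + 6 u, and n u exceeds the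
   length 2 r + 214 u asked by [row_bound]. *)
pose m (eps : R) := (Num.truncn (100%:R / eps)).+2.
pose n (eps : R) := ((Num.truncn (200%:R / eps)).+1 + 214)%N.
pose cells (eps : R) : R := ((m eps).*2.+1 * (m eps).*2.+1)%N%:R.
have cells0 eps : 0 < cells eps by rewrite ltr0n muln_gt0.
(* The bound of [green_trace] for theta = 1 - al ^+ (14 * n eps). *)
pose K (eps : R) := (harnack al * al ^+ (14 * n eps))^-1.
have K0 eps : 0 < K eps by rewrite invr_gt0 mulr_gt0 // exprn_gt0.
(* The logarithm is negative for p > 4; the absolute value and the added 1 keep T positive. *)
pose T (eps p : R) := `|ln (4%:R / p)| + cells eps * K eps + 1.
have T0 eps p : 0 < T eps p.
  by rewrite /T ltr_wpDl // addr_ge0 // mulr_ge0 // ltW.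
pose mesh (eps eta : R) := eta / cells eps.
exists (fun eps p => (T eps p)^-1).
exists (fun eps eta => al ^+ (33 * N) / 4%:R * (mesh eps eta / (1 + mesh eps eta))).
split; first by move=> eps p _ _; rewrite invr_gt0.
split.
  move=> eps eta _ /andP[eta0 _].
  have m0 : 0 < mesh eps eta by rewrite divr_gt0.
  by rewrite mulr_gt0 ?divr_gt0 ?exprn_gt0 // addr_gt0.
move=> eps r x D G X L A /andP[e0 e1] r0 _ xD3 cross AD exits.
pose u := eps * r / 100%:R.
have u0 : 0 < u by rewrite divr_gt0 // mulr_gt0.
have eru : eps * r = 100%:R * u by rewrite /u; field.
have ur : 1000%:R * u <= r.
  have : eps * r <= 100%:R^-1 * r by rewrite ler_pM2r // ltW.
  by rewrite eru; lra.
have xD : box x (2%:R * r) `<=` D by move=> w /(edist_box r0) /xD3.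
have rE (a : R) : a / eps * u = a * r / 100%:R.
  by rewrite /u; field; rewrite lt0r_neq0.
have rm : r + u <= (m eps)%:R * u /\ (m eps)%:R * u < r + 6%:R * u.
  have h0 : 0 <= 100%:R / eps by rewrite divr_ge0 ?ler0n ?(ltW e0).
  rewrite /m; have := truncn_itv h0; set t := Num.truncn _.
  rewrite -[t.+2]addn2 -addn1 !natrD => /andP[h1 h2].
  have q1 := ler_wpM2r (ltW u0) h1; have q2 := ler_wpM2r (ltW u0) (ltW h2).
  rewrite rE in q1 q2; rewrite mulrDl mul1r in q2; rewrite mulrDl.
  by clear -q1 q2 u0; split; lra.
have rn : 2%:R * r + 214%:R * u <= (n eps)%:R * u.
  have h0 : 0 <= 200%:R / eps by rewrite divr_ge0 ?ler0n ?(ltW e0).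
  have /andP[_ h2] := truncn_itv h0.
  have q2 := ler_wpM2r (ltW u0) (ltW h2); rewrite rE in q2.
  by rewrite /n natrD mulrDl; clear -q2; lra.
(* Steering is required at scale u and at scale (u / 8) / 17, where [short_edge] gives edges within
   u / 8; the last 2 is the ratio of a scale to that of its rectangles. *)
exists (delta0 * (u / 8%:R / 17%:R / 2%:R)); split; first by apply: mulr_gt0 => //; do 3! apply: divr_gt0 => //.
move=> delta /andP[dl0 dlt].
have dd : delta / delta0 <= u / 8%:R / 17%:R / 2%:R by rewrite ler_pdivrMr // mulrC ltW.
have st : steerable (G delta) u al.
  apply: (crossing_steerable dl0 u0 ala _ cross).
  by apply: le_trans dd _; clear -u0; lra.
have v0 : 0 < u / 8%:R / 17%:R by do 2! apply: divr_gt0 => //.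
have st' : steerable (G delta) (u / 8%:R / 17%:R) al.
  exact: (crossing_steerable dl0 v0 ala dd cross).
have shortE a b : edge (G delta) a b -> arc_set (G delta) a b `<=` box a (u / 8%:R).
  move=> e; apply: subset_trans (short_edge v0 al0 al1 st' e) _.
  by apply: sub_box; clear -u0; lra.
set B := big_loops (G delta) (A delta) x eps r.
have BD : B `<=` loops_in (G delta) D by move=> l [Al _ _]; exact: AD Al.
have big l : B l -> ((100%:R * u)%:E <= ediam (trace (G delta) l))%E /\
    (trace (G delta) l `&` eball x r) !=set0.
  by move=> [_ h1 h2]; rewrite -eru.
have leaves y (vy : vtx (G delta) y) := exits delta y dl0 vy.
have radius : (1 + eps) * r = r + 100%:R * u by rewrite mulrDl mul1r eru.
have cE : (size (grid u x (m eps)))%:R = cells eps by rewrite size_grid.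
split.
  move=> p p0 [y [vy xy hp]].
  have xyb : box x (r + 100%:R * u) y.
    rewrite -radius; have [h1 h2] := edist_coord x y.
    by split; rewrite distrC; exact: le_lt_trans xy.
  apply: le_trans (avoided_Lambda u0 al0 al1 st shortE r0 ur xD rm.1 rm.2 rn leaves BD big
    vy xyb p0 hp) _.
  rewrite cE lee_fin div1r invrK -/(K eps) /T.
  by have := ler_norm (ln (4%:R / p)); lra.
move=> eta /andP[eta0 _] rare.
have m0 : 0 < mesh eps eta by rewrite divr_gt0.
apply: le_trans (rare_Lambda u0 al0 al1 st shortE ur xD rm.1 leaves BD big hN m0 (L := L delta) _) _.
  by rewrite -radius; exact: rare.
by rewrite cE lee_fin /mesh mulrC divfK // gt_eqF.
Qed.
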